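(* Let $\Lambda=(\lambda_n)_{n\ge1}$ be an increasing sequence of positive real numbers with $\sum_{n\ge1}\frac1{\lambda_n}<\infty$. If $\Lambda$ is quasilacunary, then for any vanishing sublinear measure $\mu$ on $[0,1]$ the embedding $\iota_\mu:M_\Lambda^1\to L^1(\mu)$ is compact.
   Context: Measures $\mu$ are finite positive Borel measures on $[0,1]$ with $\mu(\{1\})=0$. $m$ is Lebesgue measure on $[0,1]$ and $\|\cdot\|_1$ is the norm of $L^1(m)$. ''Increasing'' for $\Lambda$ means strictly increasing. $M_\Lambda^1$ denotes the closed linear span in $L^1(m)$ of the functions $x^{\lambda_n}$, $n\ge1$; its elements have representatives continuous on $[0,1)$, and these are always used. ''Polynomials in $M^1_\Lambda$'' are the finite linear combinations of the $x^{\lambda_n}$. $\mu$ is $\Lambda$-embedding if there is a constant $C>0$ such that $\|p\|_{L^1(\mu)}\le C\|p\|_1$ for all polynomials $p$ in $M_\Lambda^1$. In that case the inequality extends to all $f\in M_\Lambda^1$, and $\iota_\mu:M_\Lambda^1\to L^1(\mu)$, $f\mapsto f$, denotes the resulting bounded embedding operator. Compactness of $\iota_\mu$ includes the assertion that $\mu$ is $\Lambda$-embedding. For $0<\epsilon<1$ let $J_\epsilon=[1-\epsilon,1]$. $\mu$ is vanishing sublinear if $\lim_{\epsilon\to0}\frac{\mu(J_\epsilon)}{\epsilon}=0$. $\Lambda$ is quasilacunary if for some increasing sequence $(n_k)$ of (positive) integers and some $q>1$ we have $\lambda_{n_{k+1}}/\lambda_{n_k}\ge q$ for all $k$, and $\sup_k(n_{k+1}-n_k)<\infty$.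 *)

(* Defs.v *)
From HB Require Import structures.
From mathcomp Require Import all_boot all_order all_algebra.
From mathcomp Require Import all_classical all_reals all_analysis.
From mathcomp Require Import measurable_realfun.

Set Implicit Arguments.
Unset Strict Implicit.
Unset Printing Implicit Defensive.

Import Order.TTheory GRing.Theory Num.Theory.
Import numFieldNormedType.Exports.

Local Open Scope classical_set_scope.
Local Open Scope ring_scope.

(* The library provides the type of a.e.-equality classes of L^1(mu), but no
   topology on it; here it is equipped with the metric of the L^1 norm. *)
Definition L1 d (T : measurableType d) (R : realType)
  (mu : {measure set T -> \bar R}) : Type := LspaceType1 mu.

Definition L1fun d (T : measurableType d) (R : realType)
  (mu : {measure set T -> \bar R}) (F : L1 mu) : T -> R :=
  (F : LspaceType1 mu).
Coercion L1fun : L1 >-> Funclass.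

Definition L1dist d (T : measurableType d) (R : realType)
    (mu : {measure set T -> \bar R}) (F G : L1 mu) : R :=
  fine ('N[mu]_1[EFin \o (F \- G)%R])%E.

Section L1_metric.
Context d (T : measurableType d) (R : realType).
Variable mu : {measure set T -> \bar R}.
Implicit Types F G H : L1 mu.
Local Open Scope quotient_scope.

HB.instance Definition _ := gen_eqMixin (L1 mu).
HB.instance Definition _ := gen_choiceMixin (L1 mu).

Lemma L1_measurable F : measurable_fun setT (F : T -> R).
Proof.
by rewrite /L1fun /aqEqMfun_to_fun; case: (repr _) => f [[]].
Qed.

Lemma L1_Lfun F : (F : T -> R) \in Lfun mu 1.
Proof.
rewrite inE; apply/andP; split; rewrite inE /=; first exact: L1_measurable.
exact: (@Lebesgue_finite _ _ _ _ _ _ F).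
Qed.

Lemma L1_integrable F : mu.-integrable setT (EFin \o F).
Proof. exact/Lfun1_integrable/L1_Lfun. Qed.

Lemma L1_ae_inj F G : (F : T -> R) = G %[ae mu] -> F = G.
Proof.
move: F G => [F [[HF]]] [G [[HG]]]; rewrite /L1fun /= => FG.
have E : F = G.
  by rewrite -[F]reprK -[G]reprK; apply/eqquotP/asboolP.
by subst G; rewrite (Prop_irrelevance HF HG).
Qed.

Lemma L1dist_fin F G : ('N[mu]_1[EFin \o (F \- G)%R] = (L1dist F G)%:E)%E.
Proof.
rewrite /L1dist fineK// ge0_fin_numE ?Lnorm_ge0//.
have : (F : T -> R) - (G : T -> R) \in Lfun mu 1 by rewrite rpredB// L1_Lfun.
by rewrite inE => /andP[_]; rewrite inE.
Qed.

Lemma L1distxx F : L1dist F F = 0.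
Proof.
rewrite /L1dist (@eq_Lnorm _ _ _ _ _ _ (cst 0%E)) ?Lnorm0// => x.
by rewrite /= subrr.
Qed.

Lemma L1dist_eq0 F G : L1dist F G = 0 -> F = G.
Proof.
move=> FG0; apply: L1_ae_inj.
have /Lnorm_eq0_eq0 : ('N[mu]_1[EFin \o (F \- G)%R] = 0)%E.
  by rewrite L1dist_fin FG0.
have mFG : measurable_fun setT (EFin \o (F \- G)).
  by apply/measurable_EFinP; apply: measurable_funB; exact: L1_measurable.
move=> /(_ mFG lte01); apply: filterS => x /(_ I) /= [] /eqP.
by rewrite subr_eq0 => /eqP.
Qed.

Lemma L1dist_sym F G : L1dist F G = L1dist G F.
Proof.
rewrite /L1dist -oppe_Lnorm; congr fine; apply: eq_Lnorm => x /=.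
by rewrite opprB.
Qed.

Lemma L1dist_triangle G F H : L1dist F H <= L1dist F G + L1dist G H.
Proof.
rewrite -lee_fin EFinD -!L1dist_fin.
rewrite (@eq_Lnorm _ _ _ _ _ _ (EFin \o ((F \- G) \+ (G \- H))%R)).
  by apply: minkowski => //; apply: measurable_funB; exact: L1_measurable.
by move=> x /=; rewrite addrA subrK.
Qed.

HB.instance Definition _ := isMetric.Build R (L1 mu)
  L1distxx L1dist_eq0 L1dist_sym L1dist_triangle.

Lemma L1_class (f : T -> R) : f \in Lfun mu 1 ->
  exists F : L1 mu, (F : T -> R) = f %[ae mu].
Proof.
rewrite inE => /andP[]; rewrite inE/= => mf; rewrite inE/= => ff.
pose g := (HB.pack f (@isMeasurableFun.Build _ _ T (measurableTypeR R) f mf) :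
  {mfun T >-> measurableTypeR R}).
pose G : {mfun_ mu, T >-> measurableTypeR R} := \pi g.
have E : repr G = f %[ae mu].
  have : ae_eq_op mu (repr G) g by apply/eqquotP; exact: reprK.
  by move/asboolP.
have H : finite_norm mu 1 G.
  rewrite /finite_norm !Lnorm1 in ff *; move: ff; congr (_ < _)%E.
  have mabs (h : T -> R) : measurable_fun setT h ->
      measurable_fun setT (fun x : T => `|(EFin \o h) x|%E).
    move=> mh; apply: (@measurableT_comp _ _ _ _ _ _ (@abse R)) => //.
    exact/measurable_EFinP.
  apply: (@ae_eq_integral _ _ _ mu setT) => //.
  - exact: mabs.
  - by apply: mabs; rewrite /aqEqMfun_to_fun; case: (repr _) => h [[]].
  - by apply: filterS E => x /(_ I) /= <-.
by exists (HB.pack G (@isFinLebesgue.Build _ _ _ _ _ (lexx 1%E) G H)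
  : LspaceType1 mu).
Qed.

End L1_metric.

(* Lebesgue measure on [0, 1], as a measure on the Borel sets of R carried by
   [0, 1]: functions on [0, 1] are represented by functions on R, whose values
   outside [0, 1] are irrelevant. *)
Definition leb01 {R : realType} : set (measurableTypeR R) -> \bar R :=
  mrestr (@lebesgue_measure R) (measurable_itv `[(0 : R), 1]).
HB.instance Definition _ (R : realType) := Measure.on (@leb01 R).

Section Muntz.
Context {R : realType}.
Implicit Types (lambda : nat -> R)
  (mu : {finite_measure set (measurableTypeR R) -> \bar R}).

Definition measure_on01 mu : Prop :=
  mu (~` `[(0 : R), 1]%classic) = 0%E /\ mu [set (1 : R)] = 0%E.

Definition vanishing_sublinear mu : Prop :=
  fine (mu `[1 - e, 1]%classic) / e @[e --> (0 : R)^'+] --> (0 : R).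

(* Sequences are indexed from 0. *)
Definition quasilacunary lambda : Prop :=
  exists (n : nat -> nat) (q : R),
    [/\ increasing_seq n, 1 < q,
        forall k, q <= lambda (n k.+1) / lambda (n k) &
        exists N : nat, forall k, (n k.+1 - n k <= N)%N].

Definition muntz_polynomial lambda (p : R -> R) : Prop :=
  exists (n : nat) (c : 'I_n -> R),
    p = fun x => \sum_(i < n) c i * x `^ lambda i.

Definition muntz_space lambda : set (L1 (@leb01 R)) :=
  closure [set F : L1 (@leb01 R) | exists2 p : R -> R,
    muntz_polynomial lambda p & (F : R -> R) = p %[ae (@leb01 R)]].

Definition lambda_embedding lambda mu : Prop :=
  exists2 C : R, 0 < C & forall p : R -> R, muntz_polynomial lambda p ->
    ('N[mu]_1[EFin \o p] <= C%:E * 'N[@leb01 R]_1[EFin \o p])%E.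

(* The graph of the embedding: F is sent to the class in L^1(mu) of its
   representative that is continuous on [0, 1). A Lebesgue-null set need not be
   mu-null, so the choice of this representative matters. *)
Definition iota_graph lambda mu (F : L1 (@leb01 R)) (G : L1 mu) : Prop :=
  muntz_space lambda F /\
  exists f : R -> R, [/\ {within `[0, 1[, continuous f},
    (F : R -> R) = f %[ae (@leb01 R)] & (G : R -> R) = f %[ae mu]].

(* The second clause says that the graph above is that of an operator defined
   on the whole Muntz space (its values are unique because mu is carried by
   [0, 1) ); the third one is the compactness of this operator. *)
Definition compact_iota lambda mu : Prop :=
  [/\ lambda_embedding lambda mu,
      forall F, muntz_space lambda F -> exists G : L1 mu, iota_graph lambda F G &
      precompact [set G : L1 mu | exists2 F : L1 (@leb01 R),
        ('N[@leb01 R]_1[EFin \o F] <= 1)%E & iota_graph lambda F G]].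

End Muntz.

(* Main.v *)
Require Import Defs.
From mathcomp Require Import all_boot all_order all_algebra.
From mathcomp Require Import all_classical all_reals all_analysis.
From mathcomp Require Import measurable_realfun.
From mathcomp Require Import ring lra zify.
Import Order.TTheory GRing.Theory Num.Theory.
Import numFieldNormedType.Exports.
Local Open Scope classical_set_scope.
Local Open Scope ring_scope.

(* Quasilacunarity lets one cut the exponents into blocks of bounded length and
   bounded ratio, with a gap of ratio at least r > 1 between consecutive blocks.
   In the variable t = - ln x, the k-th block F_k of a polynomial f is an
   exponential sum with at most W exponents in [L_k, rho L_k]; such sums satisfy
   reverse Hoelder, Bernstein and decay estimates at scale 1 / L_k with constants
   depending only on W and rho. A polynomial in the shift t |-> t + 1 / L_k of the
   form E^p (1 - E)^p prod (E - e^(- lambda / L_k)), over the exponents lambda of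
   the 2 p neighbouring blocks, is invertible on the k-th block, kills its
   neighbours and damps the block j like r^(- p |j - k|). For p large this gives
   diagonal dominance, hence sum_k |F_k|_oo / L_k <= C |f|_1. Since
   |F_k(x)| <= C |F_k|_oo x^(theta L_k), and L int x^(theta L) dmu -> 0 as
   L -> oo for a vanishing sublinear mu, the embedding is a norm limit of the
   finite rank maps f |-> sum_(k < K) F_k. Compactness is obtained by realizing
   the image of the unit ball in the continuous image of a Tychonoff-compact set
   of coefficient sequences. *)

Set Implicit Arguments.
Unset Strict Implicit.
Unset Printing Implicit Defensive.

(** * Exponential sums *)

Section exponential_sums.
Context {R : realType}.
Implicit Types (l : seq R) (a F G H : R -> R) (B M L c d h t u x z : R) (A : (R -> R) -> R -> R).

(** The obstacle is that exponents inside a block may be arbitrarily close to each other, so no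
    uniform constant bounds the coefficients of a block by its size. Estimates on a block are
    therefore inductions on the number of exponents, through operators having the exponentials as
    eigenfunctions: [a x - A] removes the exponent x, and bounds on the eigenvalues suffice to
    invert A. Coefficients are bounded only at the end, with constants depending on the block, which
    is all that Tychonoff's theorem asks for. The order p settles a competition. Isolating a block
    costs at most Z^p, the number of factors being linear in p. A block that is not killed lies at a
    distance d > p, and p factors damp it by r^(- d) each, up to constants; one of them pays for the
    change of weight from 1 / L_j to 1 / L_k, another is kept for summation over d, and the rest
    gives r^(- p (p - 2)). The quadratic exponent wins, however close r is to 1. The factor E has a
    second role: it moves the window of integration away from t = 0, so that the windows of
    different blocks overlap boundedly. *)

Fixpoint espan l : set (R -> R) :=
  if l is x :: l' then
    [set G | exists c, exists2 H, espan l' H &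
      G = fun t => c * expR (- (x * t)) + H t]
  else [set fun=> 0].

Definition diagonal A (a : R -> R) : Prop :=
  (forall c F G, A (fun t => c * F t + G t) = fun t => c * A F t + A G t) /\
  (forall x, A (fun t => expR (- (x * t))) = fun t => a x * expR (- (x * t))).

Definition bounded_op A (B : R) : Prop := forall F M,
  (forall t, 0 <= t -> `|F t| <= M) -> forall t, 0 <= t -> `|A F t| <= B * M.

Lemma diagonal0 A a : diagonal A a -> A (fun=> 0) = fun=> 0.
Proof.
move=> [Al _].
have -> : (fun=> 0) = (fun t : R => (-1) * 0 + 0 :> R).
  by apply/funext => t; rewrite mulr0 addr0.
by rewrite Al; apply/funext => t; rewrite mulr0 addr0 mulN1r addNr.
Qed.

Lemma espanP l (c d : R) F G : espan l F -> espan l G ->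
  espan l (fun t => c * F t + d * G t).
Proof.
elim: l F G => [|x l IH] F G /=.
  by move=> -> ->; apply/funext => t; rewrite !mulr0 addr0.
move=> [a [F' lF ->]] [b [G' lG ->]]; exists (c * a + d * b).
exists (fun t => c * F' t + d * G' t); first exact: IH.
by apply/funext => t; ring.
Qed.

Lemma espan_diagonal A a l G : diagonal A a -> espan l G -> espan l (A G).
Proof.
move=> dA; elim: l G => [|x l IH] G /=; first by move=> ->; exact: diagonal0 dA.
move=> [c [H lH ->]]; exists (c * a x); exists (A H); first exact: IH.
by case: dA => Al Ae; rewrite Al Ae; apply/funext => t; ring.
Qed.

Lemma espan_kill A a x l G : diagonal A a -> espan (x :: l) G ->
  espan l (fun t => a x * G t - A G t).
Proof.
move=> dA [c [H lH ->]]; have [Al Ae] := dA; rewrite Al Ae.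
have -> : (fun t => a x * (c * expR (- (x * t)) + H t) -
    (c * (a x * expR (- (x * t))) + A H t)) = fun t => a x * H t + (-1) * A H t.
  by apply/funext => t; ring.
by apply: espanP => //; exact: espan_diagonal dA lH.
Qed.

Lemma espan_diagonal_zero A a l G : diagonal A a ->
  (forall x, x \in l -> a x = 0) -> espan l G -> A G = fun=> 0.
Proof.
move=> dA; elim: l G => [|x l IH] G /= a0; first by move=> ->; exact: diagonal0 dA.
move=> [c [H lH ->]]; have [Al Ae] := dA; rewrite Al Ae IH//.
  by apply/funext => t; rewrite a0 ?mem_head// mul0r mulr0 addr0.
by move=> y yl; rewrite a0// inE yl orbT.
Qed.

(* [H := a x G - A G] lives in a span with one exponent less, and both
   [H] and [A H] are controlled by [A G]. *)
Lemma espan_inverse A a B c l G M : diagonal A a -> bounded_op A B ->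
  1 <= B -> 0 < c -> c <= B ->
  (forall x, x \in l -> c <= `|a x| <= B) -> espan l G ->
  (forall t, 0 <= t -> `|A G t| <= M) ->
  forall t, 0 <= t -> `|G t| <= (3 * B / c) ^+ size l * M.
Proof.
move=> dA bA B1 c0 cB; elim: l G M => [|x l IH] G M ac lG AM t t0.
  by rewrite lG normr0 expr0 mul1r; apply: le_trans (AM 0 (lexx 0)).
have M0 : 0 <= M by apply: le_trans (AM 0 (lexx 0)).
have /andP[ax axB] := ac x (mem_head _ _).
pose H := fun t => a x * G t - A G t.
have lH : espan l H by exact: espan_kill.
have AH : A H = fun t => a x * A G t - A (A G) t.
  have -> : H = (fun t => (-1) * A G t + (a x * G t + 0)).
    by apply/funext => s; rewrite /H; ring.
  case: (dA) => Al _; rewrite Al.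
  rewrite (Al (a x) G (fun=> 0)) (diagonal0 dA).
  by apply/funext => s; ring.
have AHM s : 0 <= s -> `|A H s| <= 2 * B * M.
  move=> s0; rewrite AH.
  apply: (le_trans (ler_normB _ _)).
  have : `|a x * A G s| <= B * M.
    by rewrite normrM; apply: ler_pM => //; exact: AM.
  have := bA _ _ AM s s0; lra.
have /IH := lH; have acl y : y \in l -> c <= `|a y| <= B.
  by move=> yl; apply: ac; rewrite inE yl orbT.
move=> /(_ _ acl AHM t t0).
set K := (3 * B / c) ^+ size l => HM.
have K1 : 1 <= K.
  apply: exprn_ege1; rewrite ler_pdivlMr// mul1r; lra.
have : `|a x * G t| <= K * (2 * B * M) + M.
  have -> : a x * G t = H t + A G t by rewrite /H; ring.
  by apply: (le_trans (ler_normD _ _)); apply: lerD => //; exact: AM.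
rewrite normrM => aG.
have cG : c * `|G t| <= 3 * B * (K * M).
  apply: (@le_trans _ _ (`|a x| * `|G t|)); first by rewrite ler_wpM2r.
  apply: (le_trans aG).
  have : M <= B * (K * M) by rewrite mulrA ler_peMl// mulr_ege1.
  lra.
rewrite /= exprS -/K -[_ * _ * M]mulrA mulrAC.
by rewrite ler_pdivlMr// mulrC.
Qed.

Lemma diagonal_shift h : diagonal (fun F t => F (t + h)) (fun x => expR (- (x * h))).
Proof.
split => // x; apply/funext => t; rewrite -expRD; congr expR; ring.
Qed.

Lemma pow1D_le (n : nat) (z : R) : 0 <= z <= 1 -> (1 + z) ^+ n <= 1 + 4 ^+ n * z.
Proof.
move=> /andP[z0 z1]; elim: n => [|n IH]; first by rewrite !expr0; lra.
have n1 : 1 <= 4 ^+ n :> R by apply: exprn_ege1; lra.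
rewrite !exprS; apply: (@le_trans _ _ ((1 + z) * (1 + 4 ^+ n * z))).
  by rewrite ler_pM2l//; lra.
set y := 4 ^+ n in n1 *.
have : z <= y * z by rewrite ler_peMl.
have : y * z * z <= y * z by rewrite ler_piMr// mulr_ge0//; lra.
lra.
Qed.

(* Induction on the span: [H := e^(-xu) G - G(. + u)] has one exponent less. *)
Lemma espan_decay_step l u z t0 M G : 0 <= u ->
  (forall x, x \in l -> expR (- (x * u)) <= z) -> espan l G ->
  (forall t, t0 <= t -> `|G t| <= M) ->
  forall t, t0 + (size l)%:R * u <= t -> `|G t| <= ((1 + z) ^+ size l - 1) * M.
Proof.
move=> u0; elim: l G M t0 => [|x l IH] G M t0 xz lG GM t /=.
  by move=> _; rewrite lG normr0 expr0 subrr mul0r.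
move=> tt; have xz0 := xz x (mem_head _ _).
pose w := expR (- (x * u)).
have w0 : 0 < w by exact: expR_gt0.
pose H := fun t => w * G t - G (t + u).
have lH : espan l H by exact: (espan_kill (diagonal_shift u) lG).
have M0 : 0 <= M by apply: le_trans (GM t0 (lexx _)).
have HM s : t0 <= s -> `|H s| <= (1 + z) * M.
  move=> s0; apply: (le_trans (ler_normB _ _)); rewrite normrM gtr0_norm//.
  have := GM _ s0; have : `|G (s + u)| <= M by apply: GM; lra.
  have : w * `|G s| <= z * M by apply: ler_pM => //; [lra|exact: GM].
  lra.
have szS : (size l).+1%:R * u = (size l)%:R * u + u by rewrite -natr1; ring.
rewrite szS in tt.
have nu : 0 <= (size l)%:R * u by rewrite mulr_ge0.
have xzl y : y \in l -> expR (- (y * u)) <= z.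
  by move=> yl; apply: xz; rewrite inE yl orbT.
have Ht : `|H (t - u)| <= ((1 + z) ^+ size l - 1) * ((1 + z) * M).
  by apply: (IH H _ t0) => //; lra.
have -> : G t = w * G (t - u) - H (t - u) by rewrite /H subrK; ring.
apply: (le_trans (ler_normB _ _)); rewrite normrM (gtr0_norm w0).
have : w * `|G (t - u)| <= z * M by apply: ler_pM => //; [lra|apply: GM; lra].
rewrite exprS; set P := (1 + z) ^+ size l in Ht *; lra.
Qed.

(** The constant tau depends on the number of exponents only. The bound M is assumed on a half-line
    with arbitrary origin t0, so that the halving can be iterated. *)
Lemma espan_decay (W : nat) : exists2 tau : R, 0 < tau &
  forall l (L : R) t0 M G, (size l <= W)%N -> 0 < L ->
  (forall x, x \in l -> L <= x) -> espan l G ->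
  (forall t, t0 <= t -> `|G t| <= M) ->
  forall t, t0 + tau / L <= t -> `|G t| <= M / 2.
Proof.
(* Here 4^W z = 1/2, so (1 + z)^W - 1 <= 1/2 by [pow1D_le]; a step u = - ln z / L brings every e^(-
   x u) with x >= L below z. *)
pose z : R := (4 ^+ W)^-1 / 2.
have W0 : 1 <= 4 ^+ W :> R by apply: exprn_ege1; lra.
have z0 : 0 < z by rewrite /z divr_gt0// invr_gt0; lra.
have z1 : z <= 1 / 2.
  by rewrite /z ler_pM2r// invf_le1; lra.
have zW : (1 + z) ^+ W <= 3 / 2.
  apply: (le_trans (pow1D_le _ _)); first by lra.
  rewrite /z mulrA divff ?gt_eqF; lra.
have lz : 0 < - ln z by rewrite oppr_gt0 ln_lt0//; lra.
(* Counting [W.+1] steps instead of W keeps tau positive when W = 0. *)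
exists (W.+1%:R * - ln z); first by rewrite mulr_gt0.
move=> l L t0 M G lW L0 Lx lG GM t tt.
pose u := - ln z / L.
have u0 : 0 < u by rewrite divr_gt0.
have M0 : 0 <= M by apply: le_trans (GM t0 (lexx _)).
apply: (@le_trans _ _ (((1 + z) ^+ size l - 1) * M)); last first.
  rewrite mulrC ler_wpM2l//; apply: le_trans (_ : (1 + z) ^+ W - 1 <= _); last by lra.
  by rewrite lerB// ler_weXn2l//; lra.
apply: (@espan_decay_step l u z t0) => //; first exact: ltW.
- move=> x /Lx Lx'; rewrite -[leRHS](@lnK _ z) ?posrE// ler_expR.
  rewrite lerNl /u mulrA ler_pdivlMr// mulrC ler_wpM2r//; lra.
- apply: le_trans tt; rewrite lerD2l -mulrA ler_wpM2r//; first exact: ltW.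
  by rewrite ler_nat; apply: leq_trans lW _.
Qed.

End exponential_sums.

(** * Sup norm on the half-line: exponential decay, gain under shifts, a Bernstein-type
    inequality *)

Section sup_norm.
Context {R : realType}.
Implicit Types (l : seq R) (a F G H : R -> R) (B M L c d h t u x z : R)
  (A : (R -> R) -> R -> R).

Definition supnorm G : R := sup [set `|G t| | t in [set t | 0 <= t]].

Lemma espan_bounded l G : (forall x, x \in l -> 0 <= x) -> espan l G ->
  exists M, forall t, 0 <= t -> `|G t| <= M.
Proof.
elim: l G => [|x l IH] G /= l0; first by move=> ->; exists 0 => t _; rewrite normr0.
move=> [c [H lH ->]].
have [|M HM] := IH H _ lH; first by move=> y yl; apply: l0; rewrite inE yl orbT.
exists (`|c| + M) => t t0; apply: (le_trans (ler_normD _ _)); apply: lerD; last exact: HM.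
rewrite normrM ler_piMr// gtr0_norm ?expR_gt0// -expR0 ler_expR.
by rewrite oppr_le0 mulr_ge0// l0// mem_head.
Qed.

Lemma supnorm_has_sup l G : (forall x, x \in l -> 0 <= x) -> espan l G ->
  has_sup [set `|G t| | t in [set t | 0 <= t]].
Proof.
move=> l0 /(espan_bounded l0)[M GM]; split; first by exists `|G 0|; exists 0 => /=.
by exists M => _ [t /= t0 <-]; exact: GM.
Qed.

Lemma supnorm_ub l G t : (forall x, x \in l -> 0 <= x) -> espan l G ->
  0 <= t -> `|G t| <= supnorm G.
Proof.
by move=> l0 lG t0; apply: sup_upper_bound; [exact: supnorm_has_sup lG|exists t].
Qed.

Lemma supnorm_le G M : (forall t, 0 <= t -> `|G t| <= M) -> supnorm G <= M.
Proof.
move=> GM; apply: ge_sup; first by exists `|G 0|; exists 0 => /=.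
by move=> _ [t /= t0 <-]; exact: GM.
Qed.

Lemma supnorm_ge0 l G : (forall x, x \in l -> 0 <= x) -> espan l G -> 0 <= supnorm G.
Proof. by move=> l0 lG; apply: le_trans (supnorm_ub l0 lG (lexx 0)). Qed.

(** The halving of [espan_decay] is iterated with period tau / L, whence theta = ln 2 / tau; the
    leading 2 pays for rounding t L / tau down to an integer. *)
Lemma espan_exp_decay (W : nat) : exists2 theta : R, 0 < theta &
  forall l L G, (size l <= W)%N -> 0 < L ->
  (forall x, x \in l -> L <= x) -> espan l G ->
  forall t, 0 <= t -> `|G t| <= 2 * supnorm G * expR (- (theta * (L * t))).
Proof.
have [tau tau0 dec] := @espan_decay R W.
have ln2 : 0 < ln (2 : R) by rewrite ln_gt0//; lra.
exists (ln 2 / tau); first by rewrite divr_gt0.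
move=> l L G lW L0 Lx lG t t0.
have l0 x : x \in l -> 0 <= x by move=> /Lx; lra.
have M0 := supnorm_ge0 l0 lG.
have GM := fun t => @supnorm_ub _ _ t l0 lG.
have Gj (j : nat) s : j%:R * (tau / L) <= s -> `|G s| <= supnorm G * 2^-1 ^+ j.
  elim: j s => [|j IH] s js; first by rewrite expr0 mulr1 GM//; lra.
  rewrite exprSr mulrA; apply: (dec l L (j%:R * (tau / L))) => //.
  by move: js; rewrite -natr1; lra.
pose y := t * L / tau; have y0 : 0 <= y by rewrite divr_ge0 ?mulr_ge0// ltW.
have /andP[jy yj] := truncn_itv y0; set j := Num.trunc y in jy yj.
apply: (le_trans (Gj j t _)).
  move: jy; rewrite /y ler_pdivlMr// mulrA ler_pdivrMr//.
rewrite [leRHS](_ : _ = supnorm G * (2 * expR (- (ln 2 / tau * (L * t))))); last by ring.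
rewrite ler_wpM2l//.
have -> : expR (- (ln 2 / tau * (L * t))) = expR (- (ln 2 * y)).
  by congr expR; rewrite /y; ring.
rewrite -[2^-1](@lnK _) ?posrE ?invr_gt0// -expRM_natl.
rewrite -[X in _ <= X * _](@lnK _ 2) ?posrE//.
rewrite -expRD ler_expR lnV ?posrE//.
have : ln (2 : R) * y <= ln 2 * j.+1%:R by rewrite ler_wpM2l// ltW.
rewrite -natr1; lra.
Qed.

(** Exponential decay is weakened through e^(- y) <= 1 / y. For h = 1 / L_k and a block j above k
    the gain is of order L_k / L_j, and p shifts raise it to the power p. *)
Lemma espan_shift_gain (W : nat) : exists2 C : R, 0 < C &
  forall l L h G, (size l <= W)%N -> 0 < L -> 0 < h ->
  (forall x, x \in l -> L <= x) -> espan l G ->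
  supnorm (fun t => G (t + h)) <= C / (L * h) * supnorm G.
Proof.
have [th th0 dec] := espan_exp_decay W.
exists (2 / th); first by rewrite divr_gt0.
move=> l L h G lW L0 h0 Lx lG; apply: supnorm_le => t t0.
have l0 x : x \in l -> 0 <= x by move=> /Lx; lra.
have M0 := supnorm_ge0 l0 lG.
apply: (le_trans (dec l L G lW L0 Lx lG (t + h) _)); first by lra.
rewrite mulrAC ler_wpM2r// -!mulrA ler_wpM2l//.
have Lh : 0 < th * (L * h) by rewrite !mulr_gt0.
apply: (@le_trans _ _ (expR (- (th * (L * h))))).
  by rewrite ler_expR lerN2 ler_pM2l// ler_pM2l//; lra.
rewrite -invfM expRN lef_pV2 ?posrE ?expR_gt0//.
by apply: le_trans (expR_ge1Dx _); lra.
Qed.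

Definition average (n : nat) h F : R -> R :=
  fun t => n%:R^-1 * \sum_(i < n) F (t + i%:R * h).

Lemma diagonal_average n h : diagonal (average n h)
  (fun x => n%:R^-1 * \sum_(i < n) expR (- (x * (i%:R * h)))).
Proof.
split => [c F G|x]; apply/funext => t; rewrite /average.
  rewrite big_split /= -mulr_sumr; ring.
rewrite -mulrA mulr_suml; congr (_ * _); apply: eq_bigr => i _.
by rewrite -expRD; congr expR; ring.
Qed.

Lemma bounded_op_average n h : 0 <= h -> bounded_op (average n h) 1.
Proof.
move=> h0 F M FM t t0; rewrite mul1r /average.
have M0 : 0 <= M by apply: le_trans (FM 0 (lexx _)).
case: n => [|n]; first by rewrite big_ord0 mulr0 normr0.
rewrite normrM ger0_norm ?invr_ge0// mulrC ler_pdivrMr//.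
apply: (le_trans (ler_norm_sum _ _ _)).
apply: (@le_trans _ _ (\sum_(i < n.+1) M)).
  by apply: ler_sum => i _; apply: FM; rewrite addr_ge0// mulr_ge0.
by rewrite sumr_const card_ord mulr_natr.
Qed.

(* The average [A] over [n] steps of length [h], where [n h] is about [1 / L],
   is boundedly invertible and [A (G - G(. + h)) = (G - G(. + n h)) / n]. *)
Lemma espan_difference (W : nat) rho : exists2 C : R, 0 < C &
  forall l L h G, (size l <= W)%N -> 0 < L -> 0 <= h -> L * h <= 1 ->
  (forall x, x \in l -> 0 <= x <= rho * L) -> espan l G ->
  forall t, 0 <= t -> `|G t - G (t + h)| <= C * (L * h) * supnorm G.
Proof.
(* The eigenvalues of the average are at least e^(- |rho|), since x i h <= |rho| n L h <= |rho| for
   i < n; the absolute value is taken because the sign of rho is unknown. *)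
pose K : R := (3 * 1 / expR (- `|rho|)) ^+ W.
have K1 : 1 <= K.
  rewrite /K exprn_ege1// ler_pdivlMr ?expR_gt0// mul1r.
  by apply: (@le_trans _ _ 1); last lra; rewrite -expR0 ler_expR oppr_le0.
exists (4 * K); first by lra.
move=> l L h G lW L0 h0 Lh Lx lG t t0.
have l0 x : x \in l -> 0 <= x by move=> /Lx /andP[].
have GM := fun t => @supnorm_ub _ _ t l0 lG.
have M0 := supnorm_ge0 l0 lG.
have [->|hn0] := eqVneq h 0; first by rewrite addr0 subrr normr0 !mulr0 mul0r.
have {h0 hn0} h0 : 0 < h by rewrite lt_neqAle eq_sym hn0.
have Lh0 : 0 < L * h by rewrite mulr_gt0.
pose y := (L * h)^-1; have y1 : 1 <= y by rewrite invf_ge1.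
have y0 : 0 <= y by lra.
have /andP[ny yn] := truncn_itv y0; set n := Num.trunc y in ny yn.
have n1 : (1 <= n)%N by rewrite -truncn_ge_nat// in ny *; rewrite truncn_ge_nat.
have n1R : 1 <= n%:R :> R by rewrite ler1n.
have n0R : 0 < n%:R :> R by lra.
have nLh : n%:R * (L * h) <= 1 by rewrite -ler_pdivlMr// mul1r.
have nLh2 : n%:R^-1 <= 2 * (L * h).
  rewrite -[leRHS]invrK lef_pV2 ?posrE ?invr_gt0 ?mulr_gt0//.
  rewrite invfM -/y; move: yn; rewrite -natr1; lra.
pose D := fun t => G t - G (t + h).
have lD : espan l D.
  have -> : D = fun t => 1 * G t + (-1) * G (t + h) by apply/funext => s; rewrite /D; ring.
  by apply: espanP => //; exact: espan_diagonal (diagonal_shift h) lG.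
have AD s : average n h D s = n%:R^-1 * (G s - G (s + n%:R * h)).
  rewrite /average /D; congr (_ * _); elim: (n) => [|m IH].
    by rewrite big_ord0 mul0r addr0 subrr.
  rewrite big_ord_recr/= IH addrA subrK; congr (_ - G _).
  by rewrite -natr1; ring.
have ADM s : 0 <= s -> `|average n h D s| <= 4 * (L * h) * supnorm G.
  move=> s0; rewrite AD normrM gtr0_norm ?invr_gt0//.
  apply: (@le_trans _ _ (2 * (L * h) * (2 * supnorm G))); last lra.
  apply: ler_pM => //.
  apply: (le_trans (ler_normB _ _)).
  have := GM s s0; have : `|G (s + n%:R * h)| <= supnorm G.
    by apply: GM; rewrite addr_ge0// mulr_ge0 ?ltW.
  lra.
have := @espan_inverse _ _ _ 1 (expR (- `|rho|)) l D _ (diagonal_average n h)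
  (bounded_op_average n (ltW h0)) (lexx 1) (expR_gt0 _) _ _ lD ADM t t0.
have er1 : expR (- `|rho|) <= 1 by rewrite -expR0 ler_expR oppr_le0.
move=> /(_ er1) Dt.
apply: (le_trans (Dt _)).
- move=> x /Lx /andP[x0 xrL].
  have bnd i : (i < n)%N -> expR (- `|rho|) <= expR (- (x * (i%:R * h))) <= 1.
    move=> im; have xi0 : 0 <= x * (i%:R * h) by rewrite !mulr_ge0// ltW.
    rewrite -[X in _ <= _ <= X]expR0 !ler_expR lerN2 oppr_le0 xi0 andbT.
    apply: (@le_trans _ _ (rho * L * (i%:R * h))).
      by rewrite ler_wpM2r// mulr_ge0// ltW.
    have -> : rho * L * (i%:R * h) = rho * (i%:R * (L * h)) by ring.
    have p0 : 0 <= i%:R * (L * h) by rewrite mulr_ge0// ltW.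
    apply: (@le_trans _ _ (`|rho| * (i%:R * (L * h)))).
      by rewrite ler_wpM2r// ler_norm.
    rewrite ler_piMr// (le_trans _ nLh)// ler_wpM2r ?ltW// ltr_nat//.
  rewrite [`|_ * _|]ger0_norm; last first.
    by rewrite mulr_ge0 ?invr_ge0// sumr_ge0// => i _; exact: expR_ge0.
  have sumc (c : R) : \sum_(i < n) c = n%:R * c by rewrite sumr_const card_ord mulr_natl.
  rewrite ler_pdivlMl// ler_pdivrMl// mulr1; apply/andP; split.
    by rewrite -sumc; apply: ler_sum => i _; case/andP: (bnd i (ltn_ord i)).
  have -> : n%:R = \sum_(i < n) (1 : R) by rewrite sumc mulr1.
  by apply: ler_sum => i _; case/andP: (bnd i (ltn_ord i)).
- apply: (@le_trans _ _ (K * (4 * (L * h) * supnorm G))).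
    rewrite ler_wpM2r//; first by rewrite !mulr_ge0// ltW.
    by rewrite ler_weXn2l// ler_pdivlMr ?expR_gt0// mul1r; lra.
  by rewrite le_eqVlt; apply/orP; left; apply/eqP; ring.
Qed.

End sup_norm.

(** * Isolating a block with shift operators *)

Section shift_operators.
Context {R : realType}.
Implicit Types (l : seq R) (a F G H : R -> R) (B M L c d h t u x z : R)
  (o : seq (R * R)).

(** A pair (u, v) encodes the linear factor u E + v in the shift E by h, and a list of pairs the
    product of its factors; the eigenvalue at x is this polynomial evaluated at e^(- x h). *)
Definition shift_factor h (p : R * R) F : R -> R :=
  fun t => p.1 * F (t + h) + p.2 * F t.

Definition shift_op h o F : R -> R := foldr (shift_factor h) F o.

Lemma diagonal_factor h p : diagonal (shift_factor h p)
  (fun x => p.1 * expR (- (x * h)) + p.2).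
Proof.
split => [c F G|x]; apply/funext => t; rewrite /shift_factor; first by ring.
have -> : expR (- (x * (t + h))) = expR (- (x * h)) * expR (- (x * t)).
  by rewrite -expRD; congr expR; ring.
ring.
Qed.

Lemma espan_factor h p l F : espan l F -> espan l (shift_factor h p F).
Proof. exact: espan_diagonal (diagonal_factor h p). Qed.

Lemma espan_shift_op h o l F : espan l F -> espan l (shift_op h o F).
Proof. by move=> lF; elim: o => //= p o IH; exact: espan_factor. Qed.

Lemma diagonal_shift_op h o : diagonal (shift_op h o)
  (fun x => \prod_(p <- o) (p.1 * expR (- (x * h)) + p.2)).
Proof.
elim: o => [|p o [IHl IHe]].
  by split => // x; apply/funext => t; rewrite big_nil mul1r.
have [pl pe] := diagonal_factor h p; split => [c F G|x] /=; first by rewrite IHl pl.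
rewrite IHe.
have -> : (fun t => (\prod_(p0 <- o) (p0.1 * expR (- (x * h)) + p0.2)) * expR (- (x * t))) =
   (fun t => (\prod_(p0 <- o) (p0.1 * expR (- (x * h)) + p0.2)) * expR (- (x * t)) +
     (fun=> 0) t).
  by apply/funext => t; rewrite addr0.
rewrite pl pe (diagonal0 (diagonal_factor h p)).
by apply/funext => t; rewrite big_cons; ring.
Qed.

Lemma shift_op_sum h o (K : nat) (f : nat -> R -> R) :
  shift_op h o (fun t => \sum_(k < K) f k t) =
  fun t => \sum_(k < K) shift_op h o (f k) t.
Proof.
elim: o => [|p o IH] //=; rewrite IH; apply/funext => t; rewrite /shift_factor.
by rewrite big_split /= !mulr_sumr.
Qed.

Lemma bounded_op_factor h p B : 0 <= h -> `|p.1| + `|p.2| <= B ->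
  bounded_op (shift_factor h p) B.
Proof.
move=> h0 pB F M FM t t0; have M0 : 0 <= M by apply: le_trans (FM 0 (lexx _)).
apply: (le_trans (ler_normD _ _)); rewrite !normrM.
have : `|p.1| * `|F (t + h)| <= `|p.1| * M by rewrite ler_wpM2l// FM// addr_ge0.
have : `|p.2| * `|F t| <= `|p.2| * M by rewrite ler_wpM2l// FM.
have : (`|p.1| + `|p.2|) * M <= B * M by rewrite ler_wpM2r.
lra.
Qed.

Lemma supnorm_factor h p l G : 0 <= h -> (forall x, x \in l -> 0 <= x) -> espan l G ->
  supnorm (shift_factor h p G) <= (`|p.1| + `|p.2|) * supnorm G.
Proof.
move=> h0 l0 lG; apply: supnorm_le => t t0.
by apply: (bounded_op_factor h0 (lexx _)) t0 => s s0; exact: supnorm_ub l0 lG s0.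
Qed.

Lemma supnorm_shift_op h o l G (g : R * R -> R) :
  (forall p, p \in o -> 0 <= g p) ->
  (forall p H, p \in o -> espan l H -> supnorm (shift_factor h p H) <= g p * supnorm H) ->
  espan l G -> supnorm (shift_op h o G) <= (\prod_(p <- o) g p) * supnorm G.
Proof.
move=> g0 og lG; elim: o g0 og => [|p o IH] g0 og; first by rewrite big_nil mul1r.
rewrite big_cons /= -mulrA.
apply: (le_trans (og p _ (mem_head _ _) (espan_shift_op h o lG))).
rewrite ler_wpM2l ?g0 ?mem_head// IH//.
  by move=> q qo; apply: g0; rewrite inE qo orbT.
by move=> q H qo; apply: og; rewrite inE qo orbT.
Qed.

(** The factors are inverted one at a time by [espan_inverse] with B = 2, each at the cost (3 * 2 /
    c)^W. *)
Lemma supnorm_shift_op_inverse h o l (c : R) (W : nat) G : (size l <= W)%N ->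
  0 <= h -> 0 < c -> c <= 2 -> (forall x, x \in l -> 0 <= x) ->
  (forall p, p \in o -> `|p.1| + `|p.2| <= 2) ->
  (forall p x, p \in o -> x \in l -> c <= `|p.1 * expR (- (x * h)) + p.2|) ->
  espan l G -> supnorm G <= (6 / c) ^+ (W * size o) * supnorm (shift_op h o G).
Proof.
move=> lW h0 c0 c2 l0 o2 oc lG; elim: o o2 oc => [|p o IH] o2 oc.
  by rewrite muln0 expr0 mul1r.
have c6 : 1 <= 6 / c by rewrite ler_pdivlMr// mul1r; lra.
have c60 : 0 <= 6 / c by lra.
have p2 := o2 p (mem_head _ _).
have lo := espan_shift_op h o lG; have lpo := espan_factor h p lo.
rewrite /= mulnS addnC exprD -mulrA; apply: (le_trans (IH _ _)).
- by move=> q qo; apply: o2; rewrite inE qo orbT.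
- by move=> q x qo; apply: oc; rewrite inE qo orbT.
rewrite ler_wpM2l ?exprn_ge0//; apply: supnorm_le => t t0.
have N0 := supnorm_ge0 l0 lpo.
apply: (@le_trans _ _ ((3 * 2 / c) ^+ size l * supnorm (shift_factor h p (shift_op h o G)))).
  apply: (@espan_inverse _ _ _ 2 c l (shift_op h o G) _ (diagonal_factor h p)) => //.
  - exact: bounded_op_factor.
  - lra.
  - move=> x xl; rewrite oc ?mem_head//=.
    apply: (le_trans (ler_normD _ _)); apply: le_trans p2; rewrite lerD2r normrM.
    rewrite ler_piMr// gtr0_norm ?expR_gt0// -[leRHS]expR0 ler_expR oppr_le0.
    by rewrite mulr_ge0// l0.
  - by move=> s s0; exact: supnorm_ub l0 lpo s0.
have -> : 3 * 2 / c = 6 / c by congr (_ / _); ring.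
by rewrite ler_wpM2r// ler_weXn2l.
Qed.

(** Beyond tau / L nothing exceeds half the norm, so a point where |G| is above 3/4 of the norm lies
    in [0, tau / L]; the difference estimate allows a loss of at most 1/4 over a length delta / L.
    This turns a sup norm into a lower bound for an integral over a window of length comparable to 1
    / L. *)
Lemma espan_peak (W : nat) rho : exists2 D : R, 0 < D & exists2 delta : R, 0 < delta &
  forall l L G, (size l <= W)%N -> 0 < L ->
  (forall x, x \in l -> L <= x <= rho * L) -> espan l G ->
  exists2 s, 0 <= s <= D / L & forall t, s <= t <= s + delta / L ->
    supnorm G / 2 <= `|G t|.
Proof.
have [tau tau0 dec] := @espan_decay R W.
have [C C0 dif] := @espan_difference R W rho.
exists tau => //; pose de : R := Num.min 1 (1 / (4 * C)).
have de0 : 0 < de by rewrite /de lt_min ltr01/= divr_gt0// mulr_gt0.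
have de1 : de <= 1 by rewrite /de ge_min lexx.
have deC : C * de <= 1 / 4.
  rewrite -ler_pdivlMl//; apply: (@le_trans _ _ (1 / (4 * C))).
    by rewrite /de ge_min lexx orbT.
  by rewrite le_eqVlt; apply/orP; left; apply/eqP; field; rewrite gt_eqF.
exists de => // l L G lW L0 Lx lG.
have l0 x : x \in l -> 0 <= x by move=> /Lx; lra.
have tL : 0 <= tau / L by rewrite divr_ge0// ltW.
have N0 := supnorm_ge0 l0 lG.
have GN t : 0 <= t -> `|G t| <= supnorm G by exact: supnorm_ub l0 lG.
have [N00|Nn0] := eqVneq (supnorm G) 0.
  by exists 0; rewrite ?lexx// => t _; rewrite N00 mul0r.
have {Nn0} N0' : 0 < supnorm G by rewrite lt_neqAle eq_sym Nn0.
have : exists2 s, 0 <= s & supnorm G * (3 / 4) < `|G s|.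
  have /sup_adherent : 0 < supnorm G / 4 by rewrite divr_gt0.
  move=> /(_ _ (supnorm_has_sup l0 lG)) [_ [s /= s0 <-] Gs]; exists s => //.
  by move: Gs; rewrite -/(supnorm G); lra.
move=> [s s0 Gs]; exists s.
  rewrite s0 leNgt; apply/negP => st.
  have : `|G s| <= supnorm G / 2.
    apply: (dec l L 0 _ G lW L0) => //; last lra.
    by move=> x /Lx /andP[].
  lra.
move=> t /andP[st ts].
have Lts : L * (t - s) <= de by rewrite -ler_pdivlMl// mulrC; lra.
have Lts0 : 0 <= L * (t - s) by rewrite mulr_ge0//; lra.
have := dif l L (t - s) G lW L0 _ _ _ lG s s0.
have ts0 : 0 <= t - s by lra.
have Lts1 : L * (t - s) <= 1 by lra.
have Lx' x : x \in l -> 0 <= x <= rho * L by move=> xl; rewrite l0//; case/andP: (Lx x xl).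
move=> /(_ ts0 Lts1 Lx').
have -> : s + (t - s) = t by ring.
have : C * (L * (t - s)) * supnorm G <= (1 / 4) * supnorm G.
  rewrite ler_wpM2r// (le_trans _ deC)// ler_wpM2l//; lra.
have : `|G s| <= `|G s - G t| + `|G t|.
  by rewrite -[X in `|X| <= _](subrK (G t)) ler_normD.
lra.
Qed.

End shift_operators.

(** * The distance |j - k| of block indices, written (j - k) + (k - j) with truncated subtraction *)

Section distance.
Implicit Types j k p d : nat.

Lemma dist_ltl j k : (j < k)%N -> ((j - k) + (k - j) = k - j)%N.
Proof. lia. Qed.

Lemma dist_ltr j k : (k < j)%N -> ((j - k) + (k - j) = j - k)%N.
Proof. lia. Qed.

Lemma dist_far p j k : ~~ (k - p <= j <= k + p)%N -> (p < (j - k) + (k - j))%N.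
Proof. by rewrite negb_and -!ltnNge; lia. Qed.

(** Of p - 1 damping factors r^(- d), one is kept to be summed over d; the other p - 2, at a
    distance d > p, yield r^(- p (p - 2)). *)
Lemma exponent_bound p d : (2 <= p)%N -> (p < d)%N ->
  (p * (p - 2) + d <= d * (p - 1))%N.
Proof.
case: p => [|[|p]]// _ pd; rewrite subSS subn1 subSS subn0 /= mulnS addnC leq_add2l.
by rewrite leq_mul2r ltnW// orbT.
Qed.

End distance.

(** * Separated blocks of exponents and the operator isolating one of them *)

Section blocks.
Context {R : realType}.
Implicit Types (L : nat -> R) (bl : nat -> seq R).

Record block_sequence (W : nat) (rho r : R) bl L : Prop := BlockSequence {
  bs_r : 1 < r ;
  bs_size : forall k, (size (bl k) <= W)%N ;
  bs_gt0 : forall k, 0 < L k ;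
  bs_bound : forall k x, x \in bl k -> L k <= x <= rho * L k ;
  bs_gap : forall j k x y, (j < k)%N -> x \in bl j -> y \in bl k -> r * x <= y ;
  bs_growth : forall j d, r ^+ d * L j <= L (j + d)%N }.

(** For k < p the truncated subtraction makes the range start at 0 and overshoot k + p. It still
    contains all indices within p of k and keeps the length 2 p + 1 on which the size bound
    rests. *)
Definition neighbours p bl k : seq R :=
  flatten [seq bl j | j <- iota (k - p) (2 * p).+1 & j != k].

(* Applied at scale [h = 1 / L k], this operator kills the blocks [j] with
   [0 < |j - k| <= p], damps the higher blocks by its factors [E] and the lower
   blocks by its factors [1 - E], and is invertible on the block [k]. *)
Definition isolate p bl k h : seq (R * R) :=
  nseq p (1, 0) ++ nseq p (-1, 1) ++
  [seq (1, - expR (- (y * h))) | y <- neighbours p bl k].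

Lemma size_neighbours W p bl k : (forall j, size (bl j) <= W)%N ->
  (size (neighbours p bl k) <= (2 * p).+1 * W)%N.
Proof.
move=> blW; rewrite /neighbours.
apply: (@leq_trans (size [seq j <- iota (k - p) (2 * p).+1 | j != k] * W)).
  elim: [seq j <- _ | _] => //= j s IH; rewrite size_cat mulSn.
  exact: leq_add.
by rewrite leq_mul2r size_filter (leq_trans (count_size _ _)) ?size_iota ?orbT.
Qed.

Lemma isolate_bound p bl k h q : 0 <= h -> (forall j x, x \in bl j -> 0 <= x) ->
  q \in isolate p bl k h -> `|q.1| + `|q.2| <= 2.
Proof.
move=> h0 bl0; rewrite !mem_cat => /or3P[/nseqP[-> _]|/nseqP[-> _]|/mapP[y yn ->]] /=.
- by rewrite normr1 normr0; lra.
- by rewrite normrN1 normr1; lra.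
- rewrite normr1 normrN gtr0_norm ?expR_gt0//.
  have : expR (- (y * h)) <= 1.
    move: yn => /flattenP[_ /mapP[j _ ->] yj].
    by rewrite -[leRHS]expR0 ler_expR oppr_le0 mulr_ge0// (bl0 j).
  lra.
Qed.

Lemma expR_sub_ge (a c x y : R) : x <= a -> 0 <= c <= y - x ->
  expR (- a) * (1 - expR (- c)) <= expR (- x) - expR (- y).
Proof.
move=> xa /andP[c0 cxy].
have -> : expR (- y) = expR (- x) * expR (- (y - x)).
  by rewrite -expRD; congr expR; ring.
have E1 : expR (- (y - x)) <= expR (- c) by rewrite ler_expR; lra.
have E2 : expR (- c) <= 1 by rewrite -expR0 ler_expR; lra.
rewrite -[X in _ <= X - _]mulr1 -mulrBr.
by apply: ler_pM; rewrite ?expR_ge0 ?ler_expR//; lra.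
Qed.

Section with_blocks.
Variables (W : nat) (rho r : R) (bl : nat -> seq R) (L : nat -> R).
Hypothesis BS : block_sequence W rho r bl L.

Lemma block_ge0 k x : x \in bl k -> 0 <= x.
Proof. by move=> /(bs_bound BS) /andP[Lx _]; apply: le_trans Lx; exact/ltW/(bs_gt0 BS). Qed.

(** After scaling by 1 / L_k the exponents of block k lie in [1, rho], and those of another block
    differ from them by a factor at least r, hence by at least 1 - 1/r. The smaller of the two
    scaled exponents is at most rho, so [expR_sub_ge] bounds all kinds of factors alike. *)
Lemma isolate_eigenvalue p k x q : x \in bl k -> q \in isolate p bl k (L k)^-1 ->
  expR (- rho) * (1 - expR (- (1 - r^-1))) <= `|q.1 * expR (- (x * (L k)^-1)) + q.2|.
Proof.
move=> xk; have r1 := bs_r BS; have Lk := bs_gt0 BS k.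
have /andP[Lx xL] := bs_bound BS xk.
pose h := (L k)^-1; have h0 : 0 < h by rewrite invr_gt0.
have xh1 : 1 <= x * h by rewrite ler_pdivlMr// mul1r.
have xhr : x * h <= rho by rewrite ler_pdivrMr.
have ir1 : r^-1 < 1 by rewrite invf_lt1//; lra.
have ir0 : 0 < r^-1 by rewrite invr_gt0; lra.
have rr : r * r^-1 = 1 by rewrite divff// gt_eqF//; lra.
have ir2 : 1 - r^-1 <= r - 1.
  have : 0 <= (r - 1) * (1 - r^-1) by rewrite mulr_ge0//; lra.
  have -> : (r - 1) * (1 - r^-1) = r - 1 - r * r^-1 + r^-1 by ring.
  rewrite rr; lra.
rewrite -/h; clearbody h.
rewrite !mem_cat => /or3P[/nseqP[-> _]|/nseqP[-> _]|/mapP[y yn ->]] /=.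
- rewrite addr0 mul1r gtr0_norm ?expR_gt0//.
  apply: (@le_trans _ _ (expR (- rho))); last by rewrite ler_expR; lra.
  rewrite ler_piMr ?expR_ge0//; have := expR_ge0 (- (1 - r^-1)); lra.
- apply: le_trans (ler_norm _); 
  rewrite [leRHS](_ : _ = expR (- 0) - expR (- (x * h))); last by rewrite oppr0 expR0; ring.
  by apply: expR_sub_ge; lra.
- move: yn => /flattenP[s /mapP[j jn ->] yj].
  move: jn; rewrite mem_filter => /andP[jk _].
  rewrite mul1r; move: jk; rewrite neq_ltn => /orP[jk|kj].
    have ryx := bs_gap BS jk yj xk.
    have ryxh : r * (y * h) <= x * h by rewrite mulrA ler_pM2r.
    have yxh : y * h <= r^-1 * (x * h) by rewrite ler_pdivlMl// (lt_trans ltr01 r1).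
    have yr : y * h <= rho.
      apply: le_trans yxh (le_trans _ xhr).
      by rewrite ler_piMl ?(ltW ir1)// (le_trans ler01 xh1).
    rewrite distrC; apply: le_trans (ler_norm _).
    apply: expR_sub_ge; first exact: yr.
    rewrite subr_ge0 (ltW ir1)/=.
    apply: (@le_trans _ _ ((1 - r^-1) * (x * h))).
      by rewrite ler_peMr// subr_ge0 ltW.
    by rewrite mulrBl mul1r lerD2l lerN2.
  have rxy := bs_gap BS kj xk yj.
  have rxyh : r * (x * h) <= y * h by rewrite mulrA ler_pM2r.
  apply: le_trans (ler_norm _); apply: expR_sub_ge => //.
  rewrite subr_ge0 (ltW ir1)/=; apply: (le_trans ir2).
  apply: (@le_trans _ _ ((r - 1) * (x * h))).
    by rewrite ler_peMr// subr_ge0 ltW.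
  by rewrite mulrBl mul1r lerD2r.
Qed.

Lemma isolate_invertible p k F : espan (bl k) F ->
  supnorm F <= (6 / (expR (- rho) * (1 - expR (- (1 - r^-1))))) ^+ (W * (2 * p + (2 * p).+1 * W))
    * supnorm (shift_op (L k)^-1 (isolate p bl k (L k)^-1) F).
Proof.
move=> lF; have l0 x : x \in bl k -> 0 <= x := @block_ge0 k x.
have r1 := bs_r BS.
set c := expR (- rho) * _; set o := isolate _ _ _ _.
have ir1 : r^-1 < 1 by rewrite invf_lt1//; lra.
have ir0 : 0 < r^-1 by rewrite invr_gt0; lra.
have h0 : 0 <= (L k)^-1 by rewrite invr_ge0 ltW ?(bs_gt0 BS).
have c0 : 0 < c.
  by rewrite mulr_gt0 ?expR_gt0// subr_gt0 -[ltRHS]expR0 ltr_expR; lra.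
have lo := espan_shift_op (L k)^-1 o lF.
have N0 := supnorm_ge0 l0 lo.
(* The empty block is set apart: rho >= 0, and with it c <= 2, is read off an exponent of the
   block. *)
case: (bl k) (@isolate_eigenvalue p k) (bs_bound BS (k := k)) (bs_size BS k) l0 lF lo N0
  => [|x l] ev bd sz l0 lF lo N0.
  have F0 : F = fun=> 0 by [].
  apply: (@le_trans _ _ 0); first by apply: supnorm_le => t _; rewrite F0 normr0.
  by apply: mulr_ge0; [rewrite exprn_ge0// divr_ge0// ltW|exact: N0].
have c2 : c <= 2.
  have /andP[h1 h2] := bd x (mem_head _ _).
  have rho0 : 0 <= rho.
    have := bs_gt0 BS k => Lk; rewrite -(pmulr_lge0 _ Lk); lra.
  have e1 : expR (- rho) <= 1 by rewrite -[leRHS]expR0 ler_expR oppr_le0.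
  have e2 : 0 <= 1 - expR (- (1 - r^-1)).
    by rewrite subr_ge0 -[leRHS]expR0 ler_expR oppr_le0 subr_ge0 ltW.
  have e3 := expR_ge0 (- (1 - r^-1)).
  rewrite /c; apply: (@le_trans _ _ (1 * 1)); last by rewrite mulr1 ler1n.
  by apply: ler_pM => //; rewrite ?expR_ge0 ?gerBl.
have c61 : 1 <= 6 / c by rewrite ler_pdivlMr// mul1r; lra.
apply: (le_trans (@supnorm_shift_op_inverse _ (L k)^-1 o (x :: l) c W F sz h0 c0 c2 l0 _ _ lF)).
- by move=> q; apply: isolate_bound => // j y; exact: block_ge0.
- by move=> q y qo yl; exact: ev.
rewrite ler_wpM2r// ler_weXn2l// leq_mul2l; apply/orP; right.
rewrite !size_cat !size_nseq size_map addnA addnn -mul2n leq_add2l.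
exact/size_neighbours/(bs_size BS).
Qed.

Lemma isolate_near (p k j : nat) F : j != k -> (k - p <= j <= k + p)%N -> espan (bl j) F ->
  shift_op (L k)^-1 (isolate p bl k (L k)^-1) F = fun=> 0.
Proof.
move=> jk kpj; apply: espan_diagonal_zero (diagonal_shift_op _ _) _ => x xj.
have /(map_f (fun y : R => (1 : R, - expR (- (y * (L k)^-1))))) : x \in neighbours p bl k.
  apply/flattenP; exists (bl j) => //; apply: map_f; rewrite mem_filter jk mem_iota /=.
  by case/andP: kpj => *; lia.
set q := (_, _) => qn; have : q \in isolate p bl k (L k)^-1 by rewrite !mem_cat qn !orbT.
by move=> /perm_to_rem/(perm_big _) ->; rewrite big_cons /= mul1r subrr mul0r.
Qed.

(** The two bounds are left free because the gain comes from the factors E on a block above k and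
    from the factors 1 - E on a block below; the other kind is then bounded by 2, as are the killing
    factors. *)
Lemma supnorm_isolate p k l h (g1 g2 : R) F : 0 <= h -> (forall x, x \in l -> 0 <= x) ->
  0 <= g1 -> 0 <= g2 ->
  (forall H, espan l H -> supnorm (shift_factor h (1, 0) H) <= g1 * supnorm H) ->
  (forall H, espan l H -> supnorm (shift_factor h (-1, 1) H) <= g2 * supnorm H) ->
  espan l F ->
  supnorm (shift_op h (isolate p bl k h) F) <=
    g1 ^+ p * (g2 ^+ p * (2 ^+ ((2 * p).+1 * W) * supnorm F)).
Proof.
move=> h0 l0 g10 g20 H1 H2 lF.
have N0 := supnorm_ge0 l0 lF.
rewrite /isolate /shift_op !foldr_cat -!/(shift_op _ _ _).
set o3 := [seq _ | _ <- _]; have l3 := espan_shift_op h o3 lF.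
have l2 := espan_shift_op h (nseq p (-1, 1)) l3.
have prodn (g : R) q : \prod_(i <- nseq p q) g = g ^+ p :> R.
  by rewrite big_const_seq count_predT size_nseq iter_mulr_1.
apply: (le_trans (@supnorm_shift_op _ h (nseq p (1, 0)) l _ (fun=> g1) _ _ l2)) => //.
  by move=> q H /nseqP[-> _]; exact: H1.
rewrite prodn ler_wpM2l ?exprn_ge0//.
apply: (le_trans (@supnorm_shift_op _ h (nseq p (-1, 1)) l _ (fun=> g2) _ _ l3)) => //.
  by move=> q H /nseqP[-> _]; exact: H2.
rewrite prodn ler_wpM2l ?exprn_ge0//.
apply: (le_trans (@supnorm_shift_op _ h o3 l _ (fun=> 2) _ _ lF)) => //.
  move=> q H qo lH; apply: (le_trans (supnorm_factor _ h0 l0 lH)).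
  rewrite ler_wpM2r ?(supnorm_ge0 l0 lH)//.
  apply: (@isolate_bound p bl k h) => // [j x|]; first exact: block_ge0.
  by rewrite !mem_cat qo !orbT.
rewrite ler_wpM2r// big_const_seq count_predT iter_mulr_1 ler_weXn2l//; first lra.
rewrite size_map; exact/size_neighbours/(bs_size BS).
Qed.

End with_blocks.

(** Blocks within distance p are killed. Otherwise let Q be the ratio of the smaller of the scales
    L_j, L_k to the larger: each of the p useful factors gains C Q, by [espan_shift_gain] if j is
    above k and by [espan_difference] if it is below, and Q <= r^(- d). *)
Lemma isolate_far (W : nat) (rho r : R) : exists2 C : R, 1 <= C & forall bl L,
  block_sequence W rho r bl L -> forall (p j k : nat) F, (2 <= p)%N -> j != k -> espan (bl j) F ->
  supnorm (shift_op (L k)^-1 (isolate p bl k (L k)^-1) F) / L k <=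
    2 ^+ (p + (2 * p).+1 * W) * C ^+ p * r^-1 ^+ (p * (p - 2)) * 
    (r^-1 ^+ ((j - k) + (k - j)) * (supnorm F / L j)).
Proof.
have [C1 C10 hi] := @espan_shift_gain R W.
have [C2 C20 lo] := @espan_difference R W rho.
pose C := Num.max 1 (Num.max C1 C2).
have C_1 : 1 <= C by rewrite /C le_max lexx.
have C1C : C1 <= C by rewrite /C !le_max lexx orbT.
have C2C : C2 <= C by rewrite /C !le_max lexx !orbT.
exists C => // bl L BS p j k F p2 jk lF.
have r1 := bs_r BS; have Lk := bs_gt0 BS k; have Lj := bs_gt0 BS j.
have ir1 : r^-1 < 1 by rewrite invf_lt1//; lra.
have ir0 : 0 < r^-1 by rewrite invr_gt0; lra.
have l0 x : x \in bl j -> 0 <= x by exact: block_ge0 BS _ _.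
have N0 := supnorm_ge0 l0 lF.
have h0 : 0 < (L k)^-1 by rewrite invr_gt0.
set d := ((j - k) + (k - j))%N.
have [near|far] := boolP ((k - p <= j <= k + p)%N).
  rewrite (isolate_near L jk near lF).
  apply: (@le_trans _ _ 0).
    by rewrite pmulr_lle0 ?invr_gt0//; apply: supnorm_le => t _; rewrite normr0.
  by rewrite !mulr_ge0 ?exprn_ge0 ?invr_ge0//; lra.
have dp : (p < d)%N by exact: dist_far.
suff key (Q : R) : 0 < Q -> Q <= r^-1 ^+ d -> L j / L k * Q <= 1 ->
    supnorm (shift_op (L k)^-1 (isolate p bl k (L k)^-1) F) <=
    2 ^+ (p + (2 * p).+1 * W) * (C * Q) ^+ p * supnorm F ->
    supnorm (shift_op (L k)^-1 (isolate p bl k (L k)^-1) F) / L k <=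
    2 ^+ (p + (2 * p).+1 * W) * C ^+ p * r^-1 ^+ (p * (p - 2)) *
    (r^-1 ^+ d * (supnorm F / L j)).
  have [jltk|kltj] : (j < k)%N \/ (k < j)%N.
  - by move: jk; rewrite neq_ltn => /orP[]; [left|right].
  - apply: (key (L j / L k)).
    + by rewrite divr_gt0.
    + rewrite ler_pdivrMr// exprVn ler_pdivlMl ?exprn_gt0//; last lra.
      rewrite /d dist_ltl//.
      have := bs_growth BS j (k - j); rewrite subnKC//; exact: ltnW.
    + have : L j / L k <= 1.
        rewrite ler_pdivrMr// mul1r.
        have := bs_growth BS j (k - j); rewrite subnKC ?(ltnW jltk)//.
        apply: le_trans; rewrite ler_peMl ?(ltW Lj)// exprn_ege1//; lra.
      move=> R1; rewrite mulr_ile1//; by rewrite divr_ge0 ?ltW.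
    + have R1 : L j * (L k)^-1 <= 1.
        rewrite ler_pdivrMr// mul1r.
        have := bs_growth BS j (k - j); rewrite subnKC ?(ltnW jltk)//.
        apply: le_trans; rewrite ler_peMl ?(ltW Lj)// exprn_ege1//; lra.
      have g2 : 0 <= C * (L j / L k) by rewrite mulr_ge0 ?divr_ge0 ?ltW//; lra.
      have TF := @supnorm_isolate W rho r bl L BS p k (bl j) (L k)^-1 2 (C * (L j / L k)) F
        (ltW h0) l0 (ler0n _ 2) g2 _ _ lF.
      apply: (le_trans (TF _ _)).
      * move=> H lH; apply: le_trans (supnorm_factor _ (ltW h0) l0 lH) _.
        by rewrite /= normr1 normr0 ler_wpM2r ?(supnorm_ge0 l0 lH)//; lra.
      * move=> H lH; apply: supnorm_le => t t0.
        have := lo (bl j) (L j) (L k)^-1 H (bs_size BS j) Lj (ltW h0) R1 _ lH t t0.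
        have bd x : x \in bl j -> 0 <= x <= rho * L j.
          by move=> xj; rewrite l0//; case/andP: (bs_bound BS xj).
        move=> /(_ bd); rewrite /shift_factor /= mulN1r mul1r addrC => HH.
        apply: (le_trans HH); rewrite ler_wpM2r ?(supnorm_ge0 l0 lH)// ler_wpM2r//.
        by rewrite divr_ge0 ?ltW.
      * rewrite exprD !mulrA le_eqVlt; apply/orP; left; apply/eqP; ring.
  - apply: (key (L k / L j)).
    + by rewrite divr_gt0.
    + rewrite ler_pdivrMr// exprVn ler_pdivlMl ?exprn_gt0//; last lra.
      rewrite /d dist_ltr//.
      have := bs_growth BS k (j - k); rewrite subnKC//; exact: ltnW.
    + by rewrite mulrA divfK ?gt_eqF// divff ?gt_eqF.
    + have g1 : 0 <= C * (L k / L j) by rewrite mulr_ge0 ?divr_ge0 ?ltW//; lra.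
      have TF := @supnorm_isolate W rho r bl L BS p k (bl j) (L k)^-1 (C * (L k / L j)) 2 F
        (ltW h0) l0 g1 (ler0n _ 2) _ _ lF.
      apply: (le_trans (TF _ _)).
      * move=> H lH; have := hi (bl j) (L j) (L k)^-1 H (bs_size BS j) Lj h0 _ lH.
        have bd x : x \in bl j -> L j <= x by move=> xj; case/andP: (bs_bound BS xj).
        move=> /(_ bd); rewrite /shift_factor /=.
        have -> : (fun t => 1 * H (t + (L k)^-1) + 0 * H t) = fun t => H (t + (L k)^-1).
          by apply/funext => t; ring.
        move=> HH; apply: (le_trans HH); rewrite ler_wpM2r ?(supnorm_ge0 l0 lH)//.
        by rewrite invfM invrK [(L j)^-1 * _]mulrC ler_wpM2r// divr_ge0 ?ltW.
      * move=> H lH; apply: le_trans (supnorm_factor _ (ltW h0) l0 lH) _.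
        by rewrite /= normrN1 normr1 ler_wpM2r ?(supnorm_ge0 l0 lH)//; lra.
      * rewrite exprD !mulrA le_eqVlt; apply/orP; left; apply/eqP; ring.
move=> Q0 Qd LQ HT.
(* One factor Q compensates L_j / L_k, which is large when j is above k; the remaining p - 1 factors
   are distributed by [exponent_bound]. *)
have QA : (Q ^+ p) * (L j / L k) <= r^-1 ^+ (p * (p - 2)) * r^-1 ^+ d.
  have -> : Q ^+ p = Q ^+ (p - 1) * Q by rewrite -exprSr subn1 prednK// ltnW.
  rewrite -mulrA [Q * _]mulrC.
  apply: (@le_trans _ _ (Q ^+ (p - 1))); first by rewrite ler_piMr// exprn_ge0// ltW.
  rewrite -exprD; apply: (@le_trans _ _ (r^-1 ^+ (d * (p - 1)))).
    by rewrite exprM; apply: lerXn2r; rewrite ?nnegrE ?exprn_ge0// ltW.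
  by apply: ler_wiXn2l; [exact: ltW|exact: ltW|exact: exponent_bound].
apply: (@le_trans _ _ (2 ^+ (p + (2 * p).+1 * W) * (C * Q) ^+ p * supnorm F / L k)).
  by rewrite ler_wpM2r// invr_ge0 ltW.
have -> : 2 ^+ (p + (2 * p).+1 * W) * (C * Q) ^+ p * supnorm F / L k =
  (2 ^+ (p + (2 * p).+1 * W) * C ^+ p) * ((Q ^+ p * (L j / L k)) * (supnorm F / L j)).
  rewrite exprMn; field; rewrite !gt_eqF//.
rewrite -[leRHS]mulrA ler_wpM2l//.
  by rewrite mulr_ge0 ?exprn_ge0//; lra.
by rewrite [leRHS]mulrA ler_wpM2r// divr_ge0// ltW.
Qed.

End blocks.

(** * Integrals on windows *)

Section absolute_integral.
Context {R : realType}.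
Implicit Types (F G f : R -> R) (a b c d h m x y t : R) (o : seq (R * R)).
Notation leb := (@lebesgue_measure R).

Definition absint a b F : R := \int[leb]_(t in `[a, b]) `|F t|.

Lemma continuous_abs_integrable F a b : continuous F ->
  leb.-integrable `[a, b] (EFin \o (fun t => `|F t|)).
Proof.
move=> cF; apply: continuous_compact_integrable; first exact: segment_compact.
by apply: continuous_subspaceT => x; apply: continuous_comp; [exact: cF|exact: norm_continuous].
Qed.

Lemma absint_ge0 a b F : 0 <= absint a b F.
Proof. by apply: Rintegral_ge0. Qed.

Lemma le_absint a b F G : continuous F -> continuous G ->
  (forall t, a <= t <= b -> `|F t| <= `|G t|) -> absint a b F <= absint a b G.
Proof.
move=> cF cG FG; apply: le_Rintegral => //; try exact: continuous_abs_integrable.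
Qed.

Lemma absint_cst a b c : a <= b -> absint a b (fun=> c) = `|c| * (b - a).
Proof.
move=> ab; rewrite /absint Rintegral_cst//= lebesgue_measure_itv/= lte_fin.
by move: ab; rewrite le_eqVlt => /predU1P[->|->]//; rewrite ltxx subrr.
Qed.

Lemma absint_le_bound a b F c : continuous F -> a <= b ->
  (forall t, a <= t <= b -> `|F t| <= c) -> absint a b F <= c * (b - a).
Proof.
move=> cF ab Fc; have c0 : 0 <= c by apply: le_trans (Fc a _); rewrite ?lexx.
rewrite -(ger0_norm c0) -absint_cst//; apply: le_absint => //; first exact: cst_continuous.
by move=> t /Fc; rewrite (ger0_norm c0).
Qed.

Lemma absint_split a b c F : continuous F -> a <= b -> b <= c ->
  absint a c F = absint a b F + absint b c F.
Proof.
move=> cF ab bc.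
have := @Rintegral_itvB R (fun t => `|F t|) (BLeft a) (BRight c) b
  (continuous_abs_integrable a c cF).
rewrite !bnd_simp => /(_ ab bc); rewrite /absint => /eqP; rewrite subr_eq addrC => /eqP ->.
congr (_ + _); apply: Rintegral_itv_obnd_cbnd.
by apply: integrableS (continuous_abs_integrable b c cF) => //; exact: subset_itv_oc_cc.
Qed.

Lemma absint_sub a b c d F : continuous F -> c <= a -> a <= b -> b <= d ->
  absint a b F <= absint c d F.
Proof.
move=> cF ca ab bd; have cb := le_trans ca ab.
rewrite (absint_split cF cb bd) (absint_split cF ca ab).
have := absint_ge0 c a F; have := absint_ge0 b d F; lra.
Qed.

Lemma absint_ge_bound a b x y F c : continuous F -> a <= x -> x <= y -> y <= b -> 0 <= c ->
  (forall t, x <= t <= y -> c <= `|F t|) -> c * (y - x) <= absint a b F.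
Proof.
move=> cF ax xy yb c0 Fc; apply: le_trans (absint_sub cF ax xy yb).
rewrite -{1}(ger0_norm c0) -absint_cst//; apply: le_absint => //; first exact: cst_continuous.
by move=> t /Fc; rewrite (ger0_norm c0).
Qed.

Lemma continuous_lin c d F G : continuous F -> continuous G ->
  continuous (fun t => c * F t + d * G t : R).
Proof.
move=> cF cG x; apply: cvgD; apply: cvgM; [exact: cvg_cst|exact: cF|exact: cvg_cst|exact: cG].
Qed.

Lemma absint_lin a b c d F G : continuous F -> continuous G ->
  absint a b (fun t => c * F t + d * G t) <= `|c| * absint a b F + `|d| * absint a b G.
Proof.
move=> cF cG.
have cn H : continuous H -> continuous (fun t => `|H t| : R).
  by move=> cH x; apply: continuous_comp; [exact: cH|exact: norm_continuous].
have cM (k : R) H : continuous H -> continuous (fun t => k * H t : R).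
  by move=> cH x; apply: cvgM; [exact: cvg_cst|exact: cH].
have int H : continuous H -> leb.-integrable `[a, b] (EFin \o H).
  move=> cH; apply: continuous_compact_integrable; first exact: segment_compact.
  exact: continuous_subspaceT.
rewrite /absint -!RintegralZl//; try by apply: int; apply: cn.
rewrite -RintegralD//; try by apply: int; apply: cM; apply: cn.
apply: le_Rintegral => //.
- by apply: int; apply: cn; exact: continuous_lin.
- by apply: int; apply: continuous_lin; exact: cn.
- by move=> t _; rewrite -!normrM ler_normD.
Qed.

Lemma absint_shift a b h F : continuous F -> a <= b ->
  absint a b (fun t => F (t + h)) = absint (a + h) (b + h) F.
Proof.
move=> cF ab; rewrite /absint /Rintegral; congr fine.
have dF : derive1 (fun t : R => t + h) = cst 1.
  apply/funext => t; rewrite derive1E deriveD// derive_id derive_cst addr0//.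
have cadd : continuous (fun t : R => t + h).
  by move=> x; apply: cvgD; [exact: cvg_id|exact: cvg_cst].
rewrite (@integration_by_substitution_increasing R (fun t => t + h) (fun t => `|F t|) a b ab).
- by apply: eq_integral => t _; rewrite fctE dF /= mulr1.
- by move=> x y _ _; rewrite ltrD2r.
- by rewrite dF => x _; exact: cst_continuous.
- by rewrite dF; exact: is_cvg_cst.
- by rewrite dF; exact: is_cvg_cst.
- split.
  + by move=> x _; apply: derivableD.
  + by apply: cvg_at_right_filter; exact: cadd.
  + by apply: cvg_at_left_filter; exact: cadd.
- by apply: continuous_subspaceT => x; apply: continuous_comp; [exact: cF|exact: norm_continuous].
Qed.

Lemma continuous_shift_op h o F : continuous F -> continuous (shift_op h o F).
Proof.
move=> cF; elim: o => //= p o IH.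
have cadd : continuous (fun t : R => t + h).
  by move=> y; apply: cvgD; [exact: cvg_id|exact: cvg_cst].
apply: continuous_lin => // x.
by apply: (@continuous_comp _ _ _ (fun t => t + h) (shift_op h o F)); [exact: cadd|exact: IH].
Qed.

(** A factor u E + v reads F on [a, b] and on [a + h, b + h]: the window grows by h to the right,
    and the bound doubles because |u| + |v| <= 2. *)
Lemma absint_shift_op a b h o F : continuous F -> 0 <= h -> a <= b ->
  (forall q, q \in o -> `|q.1| + `|q.2| <= 2) ->
  absint a b (shift_op h o F) <= 2 ^+ size o * absint a (b + (size o)%:R * h) F.
Proof.
move=> cF h0; elim: o b => [|q o IH] b ab o2.
  by rewrite expr0 mul1r mul0r addr0.
have q2 := o2 q (mem_head _ _).
have o2' p : p \in o -> `|p.1| + `|p.2| <= 2 by move=> po; apply: o2; rewrite inE po orbT.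
have co := @continuous_shift_op h o F cF.
have coh : continuous (fun t => shift_op h o F (t + h)).
  move=> x; apply: (@continuous_comp _ _ _ (fun t => t + h) (shift_op h o F)); last exact: co.
  by apply: cvgD; [exact: cvg_id|exact: cvg_cst].
apply: (le_trans (@absint_lin a b q.1 q.2 _ _ coh co)).
rewrite absint_shift//.
have abh : a <= b + h by lra.
have I1 : absint (a + h) (b + h) (shift_op h o F) <= absint a (b + h) (shift_op h o F).
  by apply: absint_sub => //; lra.
have I2 : absint a b (shift_op h o F) <= absint a (b + h) (shift_op h o F).
  by apply: absint_sub => //; lra.
apply: (@le_trans _ _ (2 * absint a (b + h) (shift_op h o F))).
  apply: (@le_trans _ _ ((`|q.1| + `|q.2|) * absint a (b + h) (shift_op h o F))).
    by rewrite mulrDl lerD// ler_wpM2l.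
  by rewrite ler_wpM2r// absint_ge0.
rewrite exprS -mulrA ler_wpM2l//; apply: (le_trans (IH _ abh o2')).
have -> // : b + (size (q :: o))%:R * h = b + h + (size o)%:R * h.
by rewrite /= -natr1; ring.
Qed.

Lemma absint_sum a b (n : nat) (F : nat -> R -> R) : (forall i, continuous (F i)) ->
  absint a b (fun t => \sum_(i < n) F i t) <= \sum_(i < n) absint a b (F i).
Proof.
move=> cF; elim: n => [|n IH].
  rewrite big_ord0 /absint; have -> : (fun t => `|\sum_(i < 0) F i t|) = fun=> 0.
    by apply/funext => t; rewrite big_ord0 normr0.
  by rewrite Rintegral_cst// mul0r.
rewrite big_ord_recr /=; have cS : continuous (fun t => \sum_(i < n) F i t).
  elim: (n) => [|m IHm] x.
    by under eq_fun do rewrite big_ord0; exact: cst_continuous.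
  under eq_fun do rewrite big_ord_recr /=; apply: cvgD; [exact: IHm|exact: cF].
have -> : (fun t => \sum_(i < n.+1) F i t) =
    fun t => 1 * (\sum_(i < n) F i t) + 1 * F n t.
  by apply/funext => t; rewrite big_ord_recr /= !mul1r.
apply: (le_trans (absint_lin _ _ _ _ cS (cF n))).
by rewrite normr1 !mul1r lerD2r.
Qed.

(* Telescoping: [[h k, D h k]] lies in [[h k, h (k - m)]]. *)
Lemma absint_overlap (h : nat -> R) D (m K : nat) F : continuous F -> 1 <= D ->
  (forall k, 0 < h k) -> (forall j k, (j <= k)%N -> h k <= h j) ->
  (forall k, D * h (k + m)%N <= h k) ->
  \sum_(k < K) absint (h k) (D * h k) F <= m%:R * absint 0 (D * h 0) F.
Proof.
move=> cF D1 h0 hm hD.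
(* For k < m there is no [h (k - m)]; its place is taken by [D * h 0], the right end of the largest
   window. *)
pose u (k : nat) : R := if (k < m)%N then D * h 0 else h (k - m)%N.
pose P v := absint 0 v F.
have u0 k : 0 <= u k.
  by rewrite /u; case: ifP => _; rewrite ?ltW// mulr_gt0//; lra.
have Dh k : h k <= D * h k by rewrite ler_peMl// ltW.
have uh k : u (k + m)%N = h k by rewrite /u ltnNge leq_addl /= addnK.
have hu k : D * h k <= u k.
  rewrite /u; case: ltnP => km; first by rewrite ler_pM2l; [exact: hm|lra].
  by have := hD (k - m)%N; rewrite subnK.
have le1 k : absint (h k) (D * h k) F <= P (u k) - P (u (k + m)%N).
  rewrite uh /P (@absint_split 0 (h k) (u k))//; last 2 first.
  - exact: ltW.
  - exact: le_trans (Dh k) (hu k).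
  by rewrite addrAC subrr add0r absint_sub.
apply: (@le_trans _ _ (\sum_(k < K) (P (u k) - P (u (k + m)%N)))).
  by apply: ler_sum => k _; exact: le1.
rewrite sumrB -!(big_mkord xpredT (fun k => P (u k))) -(big_mkord xpredT (fun k => P (u (k + m)%N))).
have : \sum_(0 <= k < K) P (u k) <= \sum_(0 <= k < K + m) P (u k).
  rewrite (@big_cat_nat _ _ _ K 0 (K + m))//= ?leq_addr// lerDl.
  by apply: sumr_ge0 => i _; exact: absint_ge0.
rewrite addnC (@big_cat_nat _ _ _ m 0 (m + K))//= ?leq_addr//.
rewrite -{2}[m]add0n big_addn addKn.
have : \sum_(0 <= k < m) P (u k) <= m%:R * P (D * h 0).
  have -> : m%:R * P (D * h 0) = \sum_(0 <= k < m) P (D * h 0).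
    by rewrite big_const_nat subn0 iter_addr_0 mulr_natl.
  by apply: ler_sum_nat => k /andP[_ km]; rewrite /u km.
rewrite -/(P _); lra.
Qed.

End absolute_integral.

(** * Diagonal dominance *)

Section geometric.
Context {R : realType}.
Implicit Types (x r M : R).

Lemma geometric_sum_le x n : 0 <= x < 1 -> \sum_(i < n) x ^+ i <= (1 - x)^-1.
Proof.
move=> /andP[x0 x1]; have x1' : 0 < 1 - x by lra.
rewrite -[leRHS]mul1r ler_pdivlMr// mulrC -[leRHS](subr0 1).
have -> : (1 - x) * \sum_(i < n) x ^+ i = 1 - x ^+ n.
  by rewrite -[RHS]opprB subrX1 -mulNr opprB.
by rewrite lerB// exprn_ge0.
Qed.

Lemma two_sided_geometric_sum_le x (j n : nat) : 0 <= x < 1 ->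
  \sum_(k < n) x ^+ ((j - k) + (k - j)) <= 2 / (1 - x).
Proof.
move=> x01; have /andP[x0 x1] := x01; have x1' : 0 < (1 - x)^-1 by rewrite invr_gt0; lra.
(* This sharper form survives induction on j: the term k = 0 of the left side is the last term of
   the finite sum on the right, and the other indices shift by one. *)
suff : \sum_(k < n) x ^+ ((j - k) + (k - j)) <= \sum_(i < j) x ^+ i.+1 + (1 - x)^-1.
  move=> /le_trans; apply; have := geometric_sum_le j x01.
  have : \sum_(i < j) x ^+ i.+1 <= \sum_(i < j) x ^+ i.
    by apply: ler_sum => i _; rewrite exprS ler_piMl ?exprn_ge0// ltW.
  lra.
elim: j n => [|j IH] n.
  rewrite big_ord0 add0r; under eq_bigr do rewrite sub0n subn0.
  exact: geometric_sum_le.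
case: n => [|n].
  rewrite big_ord0 addr_ge0 ?(ltW x1')// sumr_ge0// => i _.
  by rewrite exprn_ge0.
rewrite big_ord_recl big_ord_recr /= subn0 addn0 [leRHS]addrAC [leRHS]addrC lerD2l.
under eq_bigr do rewrite /bump leq0n add1n !subSS.
exact: IH.
Qed.

Lemma exists_expr_ge r M : 1 < r -> exists n : nat, M <= r ^+ n.
Proof.
move=> r1; have r10 : 0 < r - 1 by lra.
have bern n : 1 + n%:R * (r - 1) <= r ^+ n.
  elim: n => [|n IH]; first by rewrite mul0r addr0.
  rewrite exprS -natr1; apply: (@le_trans _ _ (r * (1 + n%:R * (r - 1)))); last first.
    by rewrite ler_pM2l//; lra.
  have : 0 <= n%:R * (r - 1) * (r - 1) by rewrite !mulr_ge0// ltW.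
  lra.
exists (Num.truncn (`|M| / (r - 1))).+1; apply: le_trans (bern _).
have y0 : 0 <= `|M| / (r - 1) by rewrite divr_ge0// ltW.
have /andP[_] := truncn_itv y0; rewrite ltr_pdivrMr// => H.
have := ler_norm M; lra.
Qed.

End geometric.

Section block_decomposition.
Context {R : realType}.
Implicit Types (L : nat -> R) (bl : nat -> seq R) (F : nat -> R -> R).

Lemma continuous_espan (l : seq R) (G : R -> R) : espan l G -> continuous G.
Proof.
elim: l G => [|x l IH] G /=; first by move=> -> y; exact: cvg_cst.
move=> [c [H lH ->]] y; apply: cvgD; last exact: IH lH _.
apply: cvgM; first exact: cvg_cst.
apply: (@continuous_comp _ _ _ (fun t => - (x * t)) expR); last exact: continuous_expR.
by apply: cvgN; apply: cvgM; [exact: cvg_cst|exact: cvg_id].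
Qed.

(** If r^n exceeds Z max(1, Y), raising to the power p = n + 2 gives the exponent n p = p (p -
    2). *)
Lemma exists_order (r Z Y : R) : 1 < r -> 1 <= Z ->
  exists2 p : nat, (2 <= p)%N & Y * Z ^+ p <= r ^+ (p * (p - 2)).
Proof.
move=> r1 Z1; have [n rn] := exists_expr_ge (Z * Num.max 1 Y) r1.
exists n.+2 => //; have -> : (n.+2 - 2 = n)%N by rewrite !subSS subn0.
have m1 : 1 <= Num.max 1 Y by rewrite le_max lexx.
have mY : Y <= Num.max 1 Y by rewrite le_max lexx orbT.
rewrite mulnC exprM; apply: (@le_trans _ _ ((Z * Num.max 1 Y) ^+ n.+2)).
  rewrite exprMn mulrC ler_wpM2l ?exprn_ge0//; first lra.
  by apply: (le_trans mY); rewrite exprS ler_peMr ?exprn_ege1//; lra.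
apply: lerXn2r => //; rewrite nnegrE; first by rewrite mulr_ge0//; lra.
by rewrite exprn_ge0//; lra.
Qed.

(** The number of factors is linear in p; together with [isolate_size_bound] this turns the costs
    into p-th powers, the form that [exists_order] expects. *)
Lemma weight_bound (x : R) (p W : nat) : 0 < x <= 2 -> (2 <= p)%N ->
  (6 / x) ^+ (W * (2 * p + (2 * p).+1 * W)) <= ((6 / x) ^+ (W * (2 + 3 * W))) ^+ p.
Proof.
move=> /andP[x0 x2] p2; rewrite -exprM ler_weXn2l//.
  by rewrite ler_pdivlMr// mul1r; lra.
nia.
Qed.

Lemma isolate_size_bound (p W : nat) : (2 <= p)%N ->
  (p + (2 * p).+1 * W <= (1 + 3 * W) * p)%N.
Proof. nia. Qed.

Lemma isolate_eigenvalue_bound (rho r : R) : 1 < r -> 0 <= rho ->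
  0 < expR (- rho) * (1 - expR (- (1 - r^-1))) <= 2.
Proof.
move=> r1 rho0; have ir1 : r^-1 < 1 by rewrite invf_lt1//; lra.
have e1 : expR (- rho) <= 1 by rewrite -[leRHS]expR0 ler_expR oppr_le0.
have e2 : 0 < 1 - expR (- (1 - r^-1)).
  by rewrite subr_gt0 -[ltRHS]expR0 ltr_expR oppr_lt0 subr_gt0.
have e3 := expR_ge0 (- (1 - r^-1)).
rewrite mulr_gt0 ?expR_gt0//=; apply: (@le_trans _ _ (1 * 1)); last by rewrite mulr1 ler1n.
by apply: ler_pM => //; rewrite ?expR_ge0 ?(ltW e2) ?gerBl.
Qed.

(* The isolating operators make the block norms diagonally dominant: up to
   [int_(t near 1 / L k) |f t|], whose sum over [k] is controlled by overlap,
   each block is bounded by a small geometric average of the others. *)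
Theorem block_inequality (W : nat) (rho r : R) bl L : 0 <= rho ->
  block_sequence W rho r bl L ->
  exists2 C, 0 < C & exists2 T, 0 < T & forall K F, (forall k, espan (bl k) (F k)) ->
    \sum_(k < K) supnorm (F k) / L k <= C * absint 0 T (fun t => \sum_(k < K) F k t).
Proof.
move=> rho0 BS; have r1 := bs_r BS.
have [D D0 [delta delta0 peak]] := @espan_peak R W rho.
have [C C1 far] := @isolate_far R W rho r.
pose x := expR (- rho) * (1 - expR (- (1 - r^-1))).
have /andP[x0 x2] : 0 < x <= 2 by exact: isolate_eigenvalue_bound.
have x61 : 1 <= 6 / x by rewrite ler_pdivlMr// mul1r; lra.
pose D1 := D + delta; have D10 : 0 < D1 by rewrite addr_gt0.
have ir1 : r^-1 < 1 by rewrite invf_lt1//; lra.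
have ir0 : 0 < r^-1 by rewrite invr_gt0; lra.
pose S := 2 / (1 - r^-1); have S0 : 0 < S by rewrite divr_gt0// subr_gt0.
pose e := delta / 2; have e0 : 0 < e by rewrite divr_gt0.
pose Z1 := (6 / x) ^+ (W * (2 + 3 * W)).
have Z11 : 1 <= Z1 by exact: exprn_ege1.
pose Z2 : R := 2 ^+ (1 + 3 * W); have Z21 : 1 <= Z2 by apply: exprn_ege1; lra.
have Z1C : 1 <= Z1 * Z2 * C by rewrite !mulr_ege1.
(* Z1^p is the cost of inverting on block k, Z2^p that of the factors bounded by 2, C^p that of the
   gains; D1 is the window length in units of 1 / L_k and S the total geometric weight. The order p
   makes the off-diagonal part at most e / 2, half of the diagonal constant e. *)
have [p p2 pZ] := exists_order (D1 * S * (2 / e)) r1 Z1C.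
pose w := 2 ^+ (p + (2 * p).+1 * W) * C ^+ p * r^-1 ^+ (p * (p - 2)).
have w0 : 0 <= w by rewrite /w !mulr_ge0 ?exprn_ge0// ?(ltW ir0)//; lra.
have wS : Z1 ^+ p * D1 * w * S <= e / 2.
  have rp0 : 0 < r ^+ (p * (p - 2)) by rewrite exprn_gt0//; lra.
  have w2 : w <= Z2 ^+ p * C ^+ p / r ^+ (p * (p - 2)).
    rewrite /w exprVn ler_wpM2r ?invr_ge0 ?(ltW rp0)// ler_wpM2r ?exprn_ge0//; first lra.
    by rewrite /Z2 -exprM ler_weXn2l ?ler1n//; exact: isolate_size_bound.
  apply: (@le_trans _ _ (Z1 ^+ p * D1 * (Z2 ^+ p * C ^+ p / r ^+ (p * (p - 2))) * S)).
    rewrite ler_wpM2r ?(ltW S0)// ler_wpM2l// mulr_ge0 ?(ltW D10)// exprn_ge0//; lra.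
  have -> : Z1 ^+ p * D1 * (Z2 ^+ p * C ^+ p / r ^+ (p * (p - 2))) * S =
     (D1 * S * (2 / e) * (Z1 * Z2 * C) ^+ p) * (e / 2) / r ^+ (p * (p - 2)).
    by rewrite !exprMn; field; rewrite !gt_eqF.
  rewrite ler_pdivrMr// mulrC ler_pM2l// divr_gt0//.
pose o k := isolate p bl k (L k)^-1.
pose h k := (L k)^-1.
have h0 k : 0 < h k by rewrite invr_gt0 (bs_gt0 BS).
have bl0 j y : y \in bl j -> 0 <= y by exact: block_ge0 BS _ _.
pose n := ((2 * p) + (2 * p).+1 * W)%N.
(* D1 contains the peak, n accounts for the growth of the window under the shifts, and 1 for its
   initial displacement. By the choice of m below, window k + m ends before window k begins. *)
pose D' := D1 + n%:R + 1; have D'1 : 1 <= D' by rewrite /D'; have := ler0n R n; lra.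
have [m Dm] := exists_expr_ge D' r1.
have hdec j k : (j <= k)%N -> h k <= h j.
  move=> jk; rewrite lef_pV2 ?posrE ?(bs_gt0 BS)//.
  have := bs_growth BS j (k - j); rewrite subnKC//; apply: le_trans.
  by rewrite ler_peMl ?(ltW (bs_gt0 BS _))// exprn_ege1// ltW.
have hD k : D' * h (k + m)%N <= h k.
  have := bs_growth BS k m; rewrite -ler_pdivlMr ?(bs_gt0 BS)// => H.
  rewrite /h ler_pdivrMr ?(bs_gt0 BS)// mulrC.
  exact: le_trans Dm H.
(* Using [m.+1] instead of m keeps the constant positive when m = 0. *)
exists (2 / e * Z1 ^+ p * 2 ^+ n * m.+1%:R).
  have Z10 : 0 < Z1 by apply: lt_le_trans Z11.
  apply: mulr_gt0; last by rewrite ltr0Sn.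
  by apply: mulr_gt0; [apply: mulr_gt0; [exact: divr_gt0|exact: exprn_gt0]|exact: exprn_gt0].
exists (D' * h 0); first by rewrite mulr_gt0//; lra.
move=> K F lF; set f := (X in absint 0 _ X).
have cF k : continuous (F k) by exact: continuous_espan (lF k).
have cf : continuous f.
  rewrite /f; elim: (K) => [|k IH] t.
    by under eq_fun do rewrite big_ord0; exact: cvg_cst.
  by under eq_fun do rewrite big_ord_recr /=; apply: cvgD; [exact: IH|exact: cF].
have N0 k : 0 <= supnorm (F k) / L k.
  by rewrite divr_ge0 ?(ltW (bs_gt0 BS k))//; exact: supnorm_ge0 (bl0 k) (lF k).
have oB k q : q \in o k -> `|q.1| + `|q.2| <= 2.
  exact: isolate_bound (ltW (h0 k)) bl0.
(* With T the operator isolating block k, the peak of T F_k bounds its norm by its integral. Then T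
   F_k is T f minus the other T F_j, whose integrals are at most their sup norms times the window
   length. *)
have step k : (k < K)%N -> e * (supnorm (F k) / L k) <=
    Z1 ^+ p * absint 0 (D1 * h k) (shift_op (h k) (o k) f) +
    Z1 ^+ p * D1 * w * \sum_(j < K) r^-1 ^+ ((j - k) + (k - j)) * (supnorm (F j) / L j).
  move=> kK; have Lk := bs_gt0 BS k.
  pose T := shift_op (h k) (o k).
  have lT j : espan (bl j) (T (F j)) by exact: espan_shift_op.
  have cT j : continuous (T (F j)) by exact: continuous_espan (lT j).
  have [s /andP[s0 sD] pk] := peak (bl k) (L k) (T (F k)) (bs_size BS k) Lk
    (@bs_bound _ _ _ _ _ _ BS k) (lT k).
  have NT0 j : 0 <= supnorm (T (F j)) by exact: supnorm_ge0 (bl0 j) (lT j).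
  have low : e * (supnorm (T (F k)) / L k) <= absint 0 (D1 * h k) (T (F k)).
    have -> : e * (supnorm (T (F k)) / L k) = supnorm (T (F k)) / 2 * (s + delta / L k - s).
      by rewrite /e; field; rewrite gt_eqF.
    have dL0 : 0 < delta / L k by rewrite divr_gt0.
    apply: absint_ge_bound => //.
    - lra.
    - by rewrite /D1 /h mulrDl; lra.
    - by rewrite divr_ge0.
  have inv : supnorm (F k) <= Z1 ^+ p * supnorm (T (F k)).
    apply: (le_trans (isolate_invertible BS p (lF k))).
    apply: ler_wpM2r; first exact: NT0.
    have x02 : 0 < x <= 2 by rewrite x0 x2.
    exact: weight_bound x02 p2.
  have up : absint 0 (D1 * h k) (T (F k)) <= absint 0 (D1 * h k) (T f) +
      D1 * w * \sum_(j < K) r^-1 ^+ ((j - k) + (k - j)) * (supnorm (F j) / L j).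
    pose G j := if j == k then fun=> 0 else T (F j).
    have cG j : continuous (G j).
      by rewrite /G; case: eqP => _; [move=> ?; exact: cvg_cst|exact: cT].
    have TE : T (F k) = fun t => 1 * T f t + (-1) * \sum_(j < K) G j t.
      apply/funext => t; rewrite /T /f shift_op_sum.
      rewrite (bigD1 (Ordinal kK)) //= [X in _ + -1 * X](bigD1 (Ordinal kK)) //=.
      rewrite {1}/G eqxx add0r mul1r mulN1r -addrA -sumrB big1 ?addr0// => j jk.
      by rewrite /G ifN ?subrr//; apply: contra jk; rewrite -val_eqE.
    have cTf : continuous (T f) by exact: continuous_shift_op.
    have cSG : continuous (fun t => \sum_(j < K) G j t).
      elim: (K) => [|i IH] t.
        by under eq_fun do rewrite big_ord0; exact: cvg_cst.
      by under eq_fun do rewrite big_ord_recr /=; apply: cvgD; [exact: IH|exact: cG].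
    rewrite [in leLHS]TE; apply: (le_trans (absint_lin _ _ _ _ cTf cSG)).
    rewrite normr1 normrN1 !mul1r lerD2l; apply: (le_trans (absint_sum _ _ _ cG)).
    rewrite mulr_sumr; apply: ler_sum => j _.
    have Dh : 0 <= D1 * h k by rewrite mulr_ge0// ltW.
    have [jk|jk] := eqVneq (val j) k.
      rewrite /G jk eqxx; apply: (@le_trans _ _ 0).
        by rewrite absint_cst// normr0 mul0r.
      apply: mulr_ge0; first by rewrite mulr_ge0// ltW.
      by apply: mulr_ge0; [rewrite exprn_ge0// ltW|exact: N0].
    rewrite /G (negbTE jk).
    apply: (@le_trans _ _ (supnorm (T (F j)) * (D1 * h k - 0))).
      apply: absint_le_bound => // t /andP[t0 _]; exact: supnorm_ub (bl0 j) (lT j) t0.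
    rewrite subr0 mulrCA -mulrA ler_pM2l//.
    exact: far BS p j k (F j) p2 jk (lF j).
  have Z1p : 0 <= Z1 ^+ p by rewrite exprn_ge0//; lra.
  apply: (@le_trans _ _ (Z1 ^+ p * (e * (supnorm (T (F k)) / L k)))).
    rewrite [leRHS]mulrCA ler_pM2l// mulrA ler_wpM2r// invr_ge0 ltW//.
  apply: (@le_trans _ _ (Z1 ^+ p * absint 0 (D1 * h k) (T (F k)))).
    by rewrite ler_wpM2l.
  by have := ler_wpM2l Z1p up; rewrite mulrDr !mulrA.
(* One factor E is applied last and moves the window from 0 to h k. Windows starting at 0 would all
   share a neighbourhood of 0, and their overlap would not be bounded. *)
have win k : absint 0 (D1 * h k) (shift_op (h k) (o k) f) <=
    2 ^+ n * absint (h k) (D' * h k) f.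
  have [p' pE] : exists p', p = p'.+1 by case: (p) p2 => // p' _; exists p'.
  pose o' := nseq p' (1, 0) ++ nseq p (-1, 1) ++
    [seq (1, - expR (- (y * h k))) | y <- neighbours p bl k] : seq (R * R).
  have oE : o k = (1, 0) :: o' by rewrite /o /isolate /o' {1}pE.
  have Dh : 0 <= D1 * h k by rewrite mulr_ge0// ltW.
  have hk := ltW (h0 k).
  have szo : (size (o k) <= n)%N.
    rewrite /o !size_cat !size_nseq size_map addnA addnn -mul2n leq_add2l.
    exact/size_neighbours/(bs_size BS).
  have sz : (size o' <= n)%N by move: szo; rewrite oE; exact: ltnW.
  rewrite oE /= (_ : shift_factor (h k) (1, 0) (shift_op (h k) o' f) =
      fun t => shift_op (h k) o' f (t + h k)); last first.
    by apply/funext => t; rewrite /shift_factor /= mul1r mul0r addr0.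
  rewrite absint_shift//; last exact: continuous_shift_op.
  rewrite add0r; apply: (@le_trans _ _ (2 ^+ size o' *
      absint (h k) (D1 * h k + h k + (size o')%:R * h k) f)).
    apply: absint_shift_op => //; first by rewrite lerDr.
    by move=> q qo; apply: (oB k); rewrite oE inE qo orbT.
  have szR : (size o')%:R <= n%:R :> R by rewrite ler_nat.
  have szh : (size o')%:R * h k <= n%:R * h k by rewrite ler_wpM2r.
  have szh0 : 0 <= (size o')%:R * h k by rewrite mulr_ge0.
  apply: ler_pM; rewrite ?exprn_ge0 ?absint_ge0//.
    by rewrite ler_weXn2l//; lra.
  apply: absint_sub => //; first lra.
  by rewrite /D' !mulrDl mul1r; lra.
have ov := absint_overlap K cf D'1 h0 hdec hD.
set A := \sum_(k < K) _.
(* Summed over k for fixed j, the geometric weights total at most S; what remains is e / 2 times A,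
   which the left side absorbs, A being a finite sum. *)
have sumstep : e * A <= Z1 ^+ p * (2 ^+ n * (m%:R * absint 0 (D' * h 0) f)) + e / 2 * A.
  rewrite {1}/A mulr_sumr; apply: (@le_trans _ _ (\sum_(k < K)
    (Z1 ^+ p * (2 ^+ n * absint (h k) (D' * h k) f) +
    Z1 ^+ p * D1 * w * \sum_(j < K) r^-1 ^+ ((j - k) + (k - j)) * (supnorm (F j) / L j)))).
    apply: ler_sum => k _; apply: (le_trans (step k (ltn_ord k))).
    by rewrite lerD2r ler_wpM2l// exprn_ge0//; lra.
  rewrite big_split /=; apply: lerD.
    rewrite -!mulr_sumr !ler_wpM2l// ?exprn_ge0//; lra.
  rewrite -mulr_sumr exchange_big /=.
  apply: (@le_trans _ _ (Z1 ^+ p * D1 * w * (S * A))).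
    rewrite ler_wpM2l//.
      rewrite !mulr_ge0// ?(ltW D10)// exprn_ge0//; lra.
    rewrite /A mulr_sumr; apply: ler_sum => j _; rewrite -mulr_suml ler_wpM2r//.
    apply: two_sided_geometric_sum_le; rewrite ltW//.
  rewrite mulrA ler_wpM2r// /A sumr_ge0// => k _; exact: N0.
have I0 := absint_ge0 0 (D' * h 0) f.
have -> : 2 / e * Z1 ^+ p * 2 ^+ n * m.+1%:R * absint 0 (D' * h 0) f =
  (Z1 ^+ p * (2 ^+ n * (m.+1%:R * absint 0 (D' * h 0) f))) / (e / 2).
  by field; rewrite gt_eqF.
rewrite ler_pdivlMr ?divr_gt0//.
have : Z1 ^+ p * (2 ^+ n * (m%:R * absint 0 (D' * h 0) f)) <=
   Z1 ^+ p * (2 ^+ n * (m.+1%:R * absint 0 (D' * h 0) f)).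
  by rewrite !ler_wpM2l ?exprn_ge0 ?ler_wpM2r ?ler_nat//; lra.
lra.
Qed.

End block_decomposition.

(** * Blocks of a quasilacunary sequence *)

Section reblocking.
Context {R : realType}.
Implicit Types (lambda : nat -> R) (r q : R).

Lemma exists_small_root (N : nat) q : 1 < q -> exists2 r, 1 < r & r ^+ N <= q.
Proof.
move=> q1; have N0 : 0 < 4 ^+ N :> R by rewrite exprn_gt0.
pose z : R := Num.min 1 ((q - 1) / 4 ^+ N).
have z0 : 0 < z by rewrite /z lt_min ltr01/= divr_gt0//; lra.
have z1 : z <= 1 by rewrite /z ge_min lexx.
have zq : 4 ^+ N * z <= q - 1.
  by rewrite mulrC -ler_pdivlMr// /z ge_min lexx orbT.
exists (1 + z); first lra.
apply: (le_trans (pow1D_le N _)); first by rewrite (ltW z0).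
lra.
Qed.

Definition jump lambda r i := r * lambda i <= lambda i.+1.

Lemma no_jump_growth lambda r a d : 1 < r -> (forall n, 0 < lambda n) ->
  (forall i, (a <= i < a + d)%N -> ~~ jump lambda r i) ->
  lambda (a + d)%N <= r ^+ d * lambda a /\ ((0 < d)%N -> lambda (a + d)%N < r ^+ d * lambda a).
Proof.
move=> r1 l0; elim: d => [|d IH] nj; first by rewrite addn0 expr0 mul1r lexx.
suff : lambda (a + d.+1)%N < r ^+ d.+1 * lambda a by move=> H; rewrite H ltW.
have [IH1 _] : lambda (a + d)%N <= r ^+ d * lambda a /\
    ((0 < d)%N -> lambda (a + d)%N < r ^+ d * lambda a).
  by apply: IH => i /andP[ai id]; apply: nj; rewrite ai addnS ltnS ltnW.
have : ~~ jump lambda r (a + d)%N by apply: nj; rewrite leq_addr addnS leqnn.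
rewrite /jump -ltNge -addnS => /lt_le_trans; apply.
by rewrite exprS -mulrA ler_pM2l//; lra.
Qed.

(** Take r with r^N <= q. If every ratio between n_k and n_(k+1) stayed below r, the growth over
    these at most N steps would be below q; so each such stretch contains a jump. *)
Lemma quasilacunary_jumps lambda : (forall n, 0 < lambda n) -> quasilacunary lambda ->
  exists2 r, 1 < r & exists W, forall m, exists2 i, (m <= i < m + W)%N & jump lambda r i.
Proof.
move=> l0 [n [q [ninc q1 nq [N nN]]]].
have [r r1 rN] := exists_small_root N q1.
(* The first n_k at or after m is at most m + N, or is n 0; a jump follows within N more steps. *)
exists r => //; exists (N + N + n 0)%N => m.
have nlt k : (n k < n k.+1)%N by rewrite (leqW_mono ninc).
have nge k : (k <= n k)%N by elim: k => // k IH; apply: leq_ltn_trans (nlt k).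
have exk : exists k, (m <= n k)%N by exists m.
case: (ex_minnP exk) => k mk kmin.
have nk : (n k <= m + N + n 0)%N.
  case: k mk kmin => [|k] mk kmin; first by rewrite leq_addl.
  have : (n k < m)%N by rewrite ltnNge; apply/negP => /kmin; rewrite ltnn.
  have := nN k; lia.
have [i /andP[ai ib] ji] : exists2 i, (n k <= i < n k.+1)%N & jump lambda r i.
  apply: contrapT => H.
  have nj i : (n k <= i < n k + (n k.+1 - n k))%N -> ~~ jump lambda r i.
    rewrite subnKC ?(ltnW (nlt k))// => ik; apply/negP => ji; apply: H.
    by exists i.
  have [_] := no_jump_growth r1 l0 nj; rewrite subn_gt0 nlt => /(_ isT).
  rewrite subnKC ?(ltnW (nlt k))// => H1.
  have := nq k; rewrite ler_pdivlMr// => H2.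
  have : r ^+ (n k.+1 - n k) <= r ^+ N by apply: ler_weXn2l; [lra|exact: nN].
  move=> H3; have : r ^+ (n k.+1 - n k) * lambda (n k) <= q * lambda (n k).
    by rewrite ler_pM2r//; apply: le_trans rN.
  lra.
exists i => //; have := nN k; have := nlt k; lia.
Qed.

(** A block is closed at the first jump at or after its start. Inside it consecutive ratios stay
    below r, so at most W exponents span a ratio at most r^W; the closing jump is the gap to the
    next block. *)
Theorem quasilacunary_blocks lambda : increasing_seq lambda -> (forall n, 0 < lambda n) ->
  quasilacunary lambda -> exists (s : nat -> nat) (W : nat) (rho r : R),
  [/\ s 0 = 0%N, forall k, (s k < s k.+1)%N, 0 <= rho &
    block_sequence W rho r (fun k => [seq lambda i | i <- index_iota (s k) (s k.+1)])
      (fun k => lambda (s k))].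
Proof.
move=> linc l0 ql; have [r r1 [W jW]] := quasilacunary_jumps l0 ql.
have exj m : exists i, (m <= i)%N && jump lambda r i.
  by have [i /andP[mi _] ji] := jW m; exists i; rewrite mi.
pose next m := (ex_minn (exj m)).+1.
pose s := fix s k := if k is k'.+1 then next (s k') else 0%N.
have sP k : [/\ (s k < s k.+1)%N, (s k.+1 <= s k + W)%N, jump lambda r (s k.+1).-1 &
    forall i, (s k <= i < (s k.+1).-1)%N -> ~~ jump lambda r i].
  rewrite /= /next; case: ex_minnP => j /andP[kj jj] jmin /=; split => //.
  - have [i /andP[mi iW] ji] := jW (s k); apply: leq_ltn_trans iW.
    by apply: jmin; rewrite mi.
  - move=> i /andP[ki ij]; apply/negP => ji; have := jmin i.
    by rewrite ki ji => /(_ isT); rewrite leqNgt ij.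
have smono j k : (j <= k)%N -> (s j <= s k)%N.
  elim: k => [|k IH]; first by rewrite leqn0 => /eqP ->.
  rewrite leq_eqVlt => /predU1P[->//|]; rewrite ltnS => /IH /leq_trans; apply.
  by have [/ltnW] := sP k.
have inbl k : lambda (s k) \in [seq lambda i | i <- index_iota (s k) (s k.+1)].
  by apply: map_f; rewrite mem_index_iota leqnn; have [] := sP k.
have gap j k x y : (j < k)%N -> x \in [seq lambda i | i <- index_iota (s j) (s j.+1)] ->
    y \in [seq lambda i | i <- index_iota (s k) (s k.+1)] -> r * x <= y.
  move=> jk /mapP[i + ->] /mapP[i' + ->]; rewrite !mem_index_iota => /andP[ji ij] /andP[ki _].
  have [sj _ jj _] := sP j.
  apply: (@le_trans _ _ (r * lambda (s j.+1).-1)).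
    rewrite ler_pM2l; [rewrite linc|lra].
    by rewrite -ltnS prednK//; apply: leq_ltn_trans sj.
  apply: (le_trans jj); rewrite prednK; last by apply: leq_ltn_trans sj.
  by rewrite linc; apply: leq_trans ki; exact: smono.
exists s, W, (r ^+ W), r; split => //.
- by move=> k; have [] := sP k.
- by rewrite exprn_ge0//; lra.
- split => //.
  + move=> k; rewrite size_map size_iota; have [_ + _ _] := sP k.
    by rewrite leq_subLR.
  + move=> k x /mapP[i]; rewrite mem_index_iota => /andP[ki ik] ->; rewrite linc ki/=.
    have [ss sW _ nj] := sP k.
    have [|H _] := @no_jump_growth lambda r (s k) (i - s k) r1 l0.
      move=> i'; rewrite subnKC// => /andP[ki' ii']; apply: nj.
      by rewrite ki' andTb ltn_predRL (leq_ltn_trans ii').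
    rewrite subnKC// in H; apply: (le_trans H); rewrite ler_pM2r//.
    apply: ler_weXn2l; first exact: ltW.
    by rewrite leq_subLR ltnW// (leq_trans ik).
  + move=> j; elim=> [|d IH]; first by rewrite expr0 mul1r addn0.
    rewrite exprS -mulrA; apply: (@le_trans _ _ (r * lambda (s (j + d)%N))).
      by rewrite ler_pM2l//; lra.
    by apply: (gap (j + d)%N (j + d).+1) => //; rewrite ?addnS; exact: inbl.
Qed.

End reblocking.

(** * Block norms of polynomials *)

Section transfer.
Context {R : realType}.
Implicit Types (f p : R -> R) (T : R).

Lemma derive1_expRN : derive1 (fun t : R => expR (- t)) = fun t => - expR (- t).
Proof.
apply/funext => t; rewrite derive1E.
have dN : is_derive t 1 (fun t : R => - t) (-1) by exact: is_deriveN.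
have H := @is_derive1_comp _ expR (fun t : R => - t) t _ _ (is_derive_expR (- t)) dN.
by rewrite (@derive_val _ _ _ _ _ _ _ H) mulrN1.
Qed.

(** Under x = e^(- t) Lebesgue measure becomes e^(- t) dt, which dominates e^(- T) dt on [0, T]
    only; this is why the window in [block_inequality] has to be bounded. *)
Lemma absint_le_Lnorm p f T : 0 <= T -> continuous f ->
  measurable_fun setT (p : measurableTypeR R -> measurableTypeR R) ->
  (forall t, f t = p (expR (- t))) ->
  ((absint 0 T f)%:E <= (expR T)%:E * 'N[@leb01 R]_1[EFin \o p])%E.
Proof.
move=> T0 cf mp fp; rewrite Lnorm1.
pose leb := @lebesgue_measure R.
have cexpN : continuous (fun t : R => expR (- t)).
  by move=> t; apply: continuous_comp; [exact: cvgN|exact: continuous_expR].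
have cNf t : {for t, continuous (fun t => `|f t| : R)}.
  by apply: continuous_comp; [exact: cf|exact: norm_continuous].
have -> : ((absint 0 T f)%:E = \int[leb]_(t in `[0%R, T]) (`|f t|)%:E)%E.
  rewrite /absint fineK//; apply: integrable_fin_num => //.
  exact: continuous_abs_integrable.
pose G x := `|f (- ln x)|.
have sub : (\int[leb]_(x in `[expR (- T), expR (- 0)]) (G x)%:E =
    \int[leb]_(t in `[0%R, T]) ((`|f t| * expR (- t)))%:E)%E.
  rewrite (@integration_by_substitution_decreasing R (fun t => expR (- t)) G 0 T T0).
  - by apply: eq_integral => t _; rewrite !fctE derive1_expRN /G expRK opprK opprK.
  - by move=> x y _ _ xy; rewrite ltr_expR ltrN2.
  - by rewrite derive1_expRN => x _; apply: cvgN; exact: cexpN.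
  - rewrite derive1_expRN; apply/cvg_ex; exists (- expR (- 0)).
    by apply: cvg_at_right_filter; apply: cvgN; exact: cexpN.
  - rewrite derive1_expRN; apply/cvg_ex; exists (- expR (- T)).
    by apply: cvg_at_left_filter; apply: cvgN; exact: cexpN.
  - split.
    + move=> x _; apply: ex_derive.
    + by apply: cvg_at_right_filter; exact: cexpN.
    + by apply: cvg_at_left_filter; exact: cexpN.
  - apply: (@subspace_eq_continuous _ _ _ G) => //.
    apply: continuous_in_subspaceT => x; rewrite inE/= in_itv/= => /andP[x0 _].
    have x0' : 0 < x by apply: lt_le_trans x0; exact: expR_gt0.
    apply: (@continuous_comp _ _ _ (fun x => - ln x) (fun t => `|f t|)); last exact: cNf.
    by apply: cvgN; exact: continuous_ln.
rewrite oppr0 expR0 in sub.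
apply: (@le_trans _ _ ((expR T)%:E * \int[leb]_(t in `[0%R, T]) ((`|f t| * expR (- t)))%:E)%E).
  have mf : measurable_fun `[0, T] (fun t => (`|f t|)%:E).
    apply/measurable_EFinP; apply: measurable_funTS; exact: continuous_measurable_fun.
  have mfe : measurable_fun `[0, T] (fun t => (`|f t| * expR (- t))%:E).
    apply/measurable_EFinP; apply: measurable_funTS; apply: continuous_measurable_fun => t.
    by apply: cvgM; [exact: cNf|exact: cexpN].
  have fe0 t : `[0, T]%classic t -> (0 <= (`|f t| * expR (- t))%:E)%E.
    by move=> _; rewrite lee_fin mulr_ge0// expR_ge0.
  have eT0 : (0 <= (expR T)%:E)%E by rewrite lee_fin expR_ge0.
  rewrite -ge0_integralZl//.
  apply: ge0_le_integral => //.
  - exact: measurable_funeM.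
  - move=> t /=; rewrite in_itv/= => /andP[_ tT]; rewrite -EFinM lee_fin mulrCA.
    by rewrite ler_peMr// -expRD -expR0 ler_expR; lra.
rewrite lee_pmul2l// ?lte_fin ?expR_gt0// -sub.
have -> : (\int[leb]_(x in `[expR (- T), 1%R]) (G x)%:E =
   \int[@leb01 R]_(x in `[expR (- T), 1%R]) `|(EFin \o p) x|)%E.
  rewrite (@eq_measure_integral _ _ _ _ (@leb01 R) leb); last first.
    move=> A mA AT; suff H : A `&` `[0%R, 1%R] = A by rewrite -[in LHS]H.
    rewrite setIidl// => x /AT /=.
    rewrite !in_itv/= => /andP[x0 ->]; rewrite andbT; apply: le_trans x0.
    exact: expR_ge0.
  apply: eq_integral => x; rewrite inE/= in_itv/= => /andP[x0 _].
  have x0' : 0 < x by apply: lt_le_trans x0; exact: expR_gt0.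
  by rewrite /G fp opprK lnK.
apply: ge0_subset_integral => //.
apply: measurableT_comp => //; exact/measurable_EFinP.
Qed.

End transfer.

(** * Power sums in x and exponential sums in t = - ln x *)

Section power_sums.
Context {R : realType}.
Implicit Types (lambda a b : nat -> R) (x t : R).

(** Coefficients are full sequences, of which only a range is read: one sequence serves all
    truncations and is a point of a product space. *)
Definition power_sum lambda a (m n : nat) x : R :=
  \sum_(m <= i < n) a i * x `^ lambda i.

Definition exp_sum lambda a (m n : nat) t : R :=
  \sum_(m <= i < n) a i * expR (- (lambda i * t)).

Lemma power_sum_expR lambda a m n t :
  power_sum lambda a m n (expR (- t)) = exp_sum lambda a m n t.
Proof.
apply: eq_bigr => i _; congr (_ * _).
by rewrite /powR gt_eqF ?expR_gt0// expRK mulrN.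
Qed.

Lemma power_sum0 lambda a m n : (forall i, 0 < lambda i) -> power_sum lambda a m n 0 = 0.
Proof.
by move=> l0; rewrite /power_sum big1// => i _; rewrite powR0 ?mulr0// gt_eqF.
Qed.

Lemma espan_exp_sum lambda a m n :
  espan [seq lambda i | i <- index_iota m n] (exp_sum lambda a m n).
Proof.
rewrite /exp_sum; elim: (index_iota m n) => [|i l IH] /=.
  by apply/funext => t; rewrite big_nil.
exists (a i); exists (fun t => \sum_(j <- l) a j * expR (- (lambda j * t))) => //.
by apply/funext => t; rewrite big_cons.
Qed.

Lemma diagonal_sum (A : (R -> R) -> R -> R) (al : R -> R) lambda a (l : seq nat) :
  diagonal A al ->
  A (fun t => \sum_(i <- l) a i * expR (- (lambda i * t))) =
  fun t => \sum_(i <- l) a i * al (lambda i) * expR (- (lambda i * t)).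
Proof.
move=> dA; have [Al Ae] := dA; elim: l => [|i l IH].
  have -> : (fun t : R => \sum_(i <- [::]) a i * expR (- (lambda i * t))) = fun=> 0.
    by apply/funext => t; rewrite big_nil.
  by rewrite (diagonal0 dA); apply/funext => t; rewrite big_nil.
have -> : (fun t => \sum_(j <- i :: l) a j * expR (- (lambda j * t))) =
    fun t => a i * expR (- (lambda i * t)) + (fun t => \sum_(j <- l) a j * expR (- (lambda j * t))) t.
  by apply/funext => t; rewrite big_cons.
by rewrite Al Ae IH; apply/funext => t; rewrite big_cons mulrA.
Qed.

(* The product of the operators killing all the exponents of the block but
   [lambda i] extracts the coefficient [a i]. *)
Lemma coefficient_bound lambda m n i : injective lambda -> (forall j, 0 < lambda j) ->
  (m <= i < n)%N ->
  exists2 c, 0 < c & forall a, `|a i| <= c * supnorm (exp_sum lambda a m n).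
Proof.
move=> linj l0 imn.
pose o := [seq (1, - expR (- (lambda j * 1))) | j <- index_iota m n & j != i] : seq (R * R).
pose al x := \prod_(p <- o) (p.1 * expR (- (x * 1)) + p.2).
have ali : 0 < `|al (lambda i)|.
  rewrite normr_gt0 /al prodf_seq_neq0; apply/allP => p /mapP[j].
  rewrite mem_filter => /andP[ji _] -> /=; rewrite mul1r subr_eq0.
  apply: contra ji => /eqP/expR_inj/oppr_inj; rewrite !mulr1 => /linj ->.
  exact: eqxx.
have alj j : (m <= j < n)%N -> j != i -> al (lambda j) = 0.
  move=> jmn ji; have : (1, - expR (- (lambda j * 1))) \in o.
    by apply: (map_f (fun j => (1, - expR (- (lambda j * 1))))); rewrite mem_filter ji mem_index_iota.
  by rewrite /al => /perm_to_rem/(perm_big _) ->; rewrite big_cons /= mul1r subrr mul0r.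
exists (2 ^+ size o / `|al (lambda i)|); first by rewrite divr_gt0// exprn_gt0.
move=> a; rewrite mulrAC ler_pdivlMr//.
set l := [seq lambda j | j <- index_iota m n].
have ll0 y : y \in l -> 0 <= y by move=> /mapP[j _ ->]; exact: ltW.
have lE := espan_exp_sum lambda a m n; rewrite -/l in lE.
have dT := diagonal_shift_op (1 : R) o.
have TE : shift_op 1 o (exp_sum lambda a m n) = fun t => a i * al (lambda i) * expR (- (lambda i * t)).
  rewrite /exp_sum (diagonal_sum lambda a _ dT); apply/funext => t.
  rewrite (bigD1_seq i) ?mem_index_iota ?iota_uniq//=.
  rewrite [X in _ + X]big_seq_cond [X in _ + X]big1 ?addr0//.
  move=> j; rewrite mem_index_iota => /andP[jmn ji].
  by rewrite -/(al _) alj// mulr0 mul0r.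
have lT := espan_shift_op (1 : R) o lE.
have := supnorm_ub ll0 lT (lexx 0); rewrite TE mulr0 oppr0 expR0 mulr1 normrM.
move=> /le_trans; apply; rewrite -TE.
apply: le_trans (@supnorm_shift_op _ 1 o l _ (fun=> 2) _ _ lE) _ => //.
  move=> p H po lH; apply: le_trans (supnorm_factor _ ler01 ll0 lH) _.
  rewrite ler_wpM2r ?(supnorm_ge0 ll0 lH)//.
  move: po => /mapP[j _ ->] /=; rewrite normr1 normrN gtr0_norm ?expR_gt0//.
  have : expR (- (lambda j * 1)) <= 1.
    by rewrite -[leRHS]expR0 ler_expR oppr_le0 mulr1 ltW.
  lra.
by rewrite big_const_seq count_predT iter_mulr_1.
Qed.

Lemma exp_sum_le lambda a m n t : (forall j, 0 < lambda j) -> 0 <= t ->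
  `|exp_sum lambda a m n t| <= \sum_(m <= i < n) `|a i|.
Proof.
move=> l0 t0; apply: (le_trans (ler_norm_sum _ _ _)); apply: ler_sum => i _.
rewrite normrM ler_piMr// gtr0_norm ?expR_gt0// -[leRHS]expR0 ler_expR oppr_le0.
by rewrite mulr_ge0// ltW.
Qed.

Lemma measurable_power_sum lambda a m n :
  measurable_fun setT (power_sum lambda a m n : measurableTypeR R -> measurableTypeR R).
Proof.
rewrite /power_sum; apply: measurable_sum => i; apply: measurable_funM => //.
Qed.

End power_sums.

(* [A a k] is the sup norm of the [k]-th block of the polynomial with
   coefficients [a], divided by its smallest exponent; it is comparable to the
   L^1 norm of the block. *)
Record block_norm {R : realType} (lambda : nat -> R) (s : nat -> nat) (C theta : R)
    (A : (nat -> R) -> nat -> R) : Prop := BlockNorm {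
  bn_s0 : s 0 = 0%N ;
  bn_s : forall k, (s k < s k.+1)%N ;
  bn_C : 0 < C ;
  bn_theta : 0 < theta ;
  bn_ge0 : forall a k, 0 <= A a k ;
  bn_sum : forall a K, ((\sum_(k < K) A a k)%:E <=
    C%:E * 'N[@leb01 R]_1[EFin \o power_sum lambda a 0 (s K)])%E ;
  bn_le : forall a k x, 0 <= x <= 1 ->
    `|power_sum lambda a (s k) (s k.+1) x| <=
      C * (lambda (s k) * A a k) * x `^ (theta * lambda (s k)) ;
  bn_coef : forall i k, (s k <= i < s k.+1)%N ->
    exists2 c, 0 < c & forall a, `|a i| <= c * A a k ;
  bn_lip : forall a b k, A a k <= A b k +
    (\sum_(s k <= i < s k.+1) `|a i - b i|) / lambda (s k) ;
  bn_cofinal : forall M, exists k0, forall k, (k0 <= k)%N -> M <= lambda (s k) }.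

Theorem exists_block_norm {R : realType} (lambda : nat -> R) : increasing_seq lambda ->
  (forall n, 0 < lambda n) -> quasilacunary lambda ->
  exists s C theta A, block_norm lambda s C theta A.
Proof.
move=> linc l0 ql.
have [s [W [rho [r [s0 s1 rho0 BS]]]]] := quasilacunary_blocks linc l0 ql.
have [C C0 [T T0 ineq]] := block_inequality rho0 BS.
have [th th0 dec] := @espan_exp_decay R W.
pose A (a : nat -> R) k := supnorm (exp_sum lambda a (s k) (s k.+1)) / lambda (s k).
have lF a k := espan_exp_sum lambda a (s k) (s k.+1).
have bl0 k y : y \in [seq lambda i | i <- index_iota (s k) (s k.+1)] -> 0 <= y.
  by move=> /mapP[j _ ->]; exact: ltW.
have N0 a k := supnorm_ge0 (bl0 k) (lF a k).
have A0 a k : 0 <= A a k by rewrite divr_ge0 ?N0 ?ltW.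
(* One constant for two fields: [C * expR T] comes from the change of variable in [bn_sum], and 2
   from the exponential decay behind [bn_le]. *)
exists s, (2 + C * expR T), th, A; split => //.
- by rewrite addr_gt0// mulr_gt0 ?expR_gt0.
- move=> a K.
  have fE : (fun t => \sum_(k < K) exp_sum lambda a (s k) (s k.+1) t) = exp_sum lambda a 0 (s K).
    apply/funext => t; elim: (K) => [|k IH]; first by rewrite big_ord0 s0 /exp_sum big_geq.
    by rewrite big_ord_recr /= IH /exp_sum -big_cat_nat//= ltnW.
  have cf : continuous (exp_sum lambda a 0 (s K)).
    exact: continuous_espan (espan_exp_sum lambda a 0 (s K)).
  have := ineq K (fun k => exp_sum lambda a (s k) (s k.+1)) (lF a); rewrite fE => H.
  have tr := absint_le_Lnorm (ltW T0) cf (measurable_power_sum lambda a 0 (s K))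
    (fun t => esym (power_sum_expR lambda a 0 (s K) t)).
  apply: (@le_trans _ _ (C%:E * (absint 0 T (exp_sum lambda a 0 (s K)))%:E)%E).
    by rewrite -EFinM lee_fin.
  apply: (@le_trans _ _ (C%:E * ((expR T)%:E *
      'N[@leb01 R]_1[EFin \o power_sum lambda a 0 (s K)]))%E).
    by rewrite lee_pmul2l// lte_fin.
  rewrite muleA -EFinM; apply: lee_wpmul2r; first exact: Lnorm_ge0.
  by rewrite lee_fin lerDr.
- move=> a k x /andP[x0 x1].
  have LA : lambda (s k) * A a k = supnorm (exp_sum lambda a (s k) (s k.+1)).
    by rewrite /A mulrCA divff ?mulr1// gt_eqF.
  rewrite LA; move: x0; rewrite le_eqVlt => /predU1P[<-|x0].
    by rewrite power_sum0// normr0 mulr_ge0 ?powR_ge0// mulr_ge0// addr_ge0// mulr_ge0 ?expR_ge0// ltW.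
  have xE : x = expR (- - ln x) by rewrite opprK lnK.
  rewrite [in leLHS]xE power_sum_expR.
  have lx0 : 0 <= - ln x by rewrite oppr_ge0 ln_le0.
  have Lx y : y \in [seq lambda i | i <- index_iota (s k) (s k.+1)] -> lambda (s k) <= y.
    by move=> /(bs_bound BS)/andP[].
  apply: (le_trans (dec _ _ _ (bs_size BS k) (l0 _) Lx (lF a k) _ lx0)).
  rewrite /powR gt_eqF//.
  have -> : - (th * (lambda (s k) * - ln x)) = th * lambda (s k) * ln x by ring.
  by rewrite !ler_wpM2r ?expR_ge0 ?N0// lerDl mulr_ge0 ?expR_ge0// ltW.
- move=> i k ik; have linj : injective lambda 
    by move=> x y xy; apply/eqP; rewrite eqn_leq -!linc xy lexx.
  have [c c0 H] := coefficient_bound linj l0 ik.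
  exists (c * lambda (s k)); first by rewrite mulr_gt0.
  by move=> a; apply: (le_trans (H a)); rewrite /A mulrA mulrAC mulfK// gt_eqF.
- move=> a b k; rewrite /A -mulrDl ler_wpM2r ?invr_ge0 ?(ltW (l0 _))//.
  apply: supnorm_le => t t0.
  have -> : exp_sum lambda a (s k) (s k.+1) t = exp_sum lambda b (s k) (s k.+1) t +
      exp_sum lambda (fun i => a i - b i) (s k) (s k.+1) t.
    by rewrite /exp_sum -big_split /=; apply: eq_bigr => i _; ring.
  apply: (le_trans (ler_normD _ _)); apply: lerD; last exact: exp_sum_le.
  exact: supnorm_ub (bl0 k) (lF b k) t0.
- move=> M; have [n Mn] := exists_expr_ge (M / lambda (s 0)) (bs_r BS).
  exists n => k nk; have := bs_growth BS 0 k; rewrite add0n; apply: le_trans.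
  rewrite -ler_pdivrMr//; apply: (le_trans Mn); apply: ler_weXn2l => //.
  by have := bs_r BS; lra.
Qed.

(** * Moments of vanishing sublinear measures *)

Section moments.
Context {R : realType}.
Implicit Types (x z theta L c : R).

Lemma arithmetic_geometric_sum_le z (J : nat) : 0 <= z < 1 ->
  \sum_(j < J) z ^+ j * j.+1%:R <= ((1 - z) ^+ 2)^-1.
Proof.
move=> /andP[z0 z1]; rewrite -[leRHS]mul1r ler_pdivlMr ?exprn_gt0 ?subr_gt0//.
have -> : (\sum_(j < J) z ^+ j * j.+1%:R) * (1 - z) ^+ 2 =
    1 - (z ^+ J * (J%:R * (1 - z) + 1)).
  elim: J => [|J IH]; first by rewrite big_ord0 expr0; ring.
  by rewrite big_ord_recr /= mulrDl IH [z ^+ J.+1]exprS -natr1; ring.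
rewrite gerBl mulr_ge0 ?exprn_ge0// addr_ge0// mulr_ge0// subr_ge0 ltW//.
Qed.

(** Squaring e^(c L / 2) >= c L / 2 gives e^(c L) >= (c L)^2 / 4, whence the threshold 4 / (c^2
    e). *)
Lemma expRN_small c e : 0 < c -> 0 < e ->
  exists2 M, 0 < M & forall L, M <= L -> L * expR (- (c * L)) <= e.
Proof.
move=> c0 e0; exists (4 / (c ^+ 2 * e)); first by rewrite divr_gt0// mulr_gt0// exprn_gt0.
move=> L ML; have L0 : 0 < L.
  by apply: lt_le_trans ML; rewrite divr_gt0// mulr_gt0// exprn_gt0.
rewrite expRN ler_pdivrMr ?expR_gt0//.
have -> : c * L = c * L / 2 + c * L / 2 by field.
rewrite expRD.
have h : c * L / 2 <= expR (c * L / 2) by have := expR_ge1Dx (c * L / 2); lra.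
have h0 : 0 <= c * L / 2 by rewrite divr_ge0// mulr_ge0// ltW.
have h2 : (c * L / 2) * (c * L / 2) <= expR (c * L / 2) * expR (c * L / 2).
  exact: ler_pM.
apply: (@le_trans _ _ (e * ((c * L / 2) * (c * L / 2)))); last by rewrite ler_pM2l.
move: ML; rewrite ler_pdivrMr ?mulr_gt0 ?exprn_gt0// => ML.
have -> : e * (c * L / 2 * (c * L / 2)) = (L * (c ^+ 2 * e)) / 4 * L by field.
by rewrite ler_peMl ?(ltW L0)//; lra.
Qed.

Lemma powR_le_expR x y : 0 <= x <= 1 -> 0 <= y -> x `^ y <= expR (- (y * (1 - x))).
Proof.
move=> /andP[x0 x1] y0; have xe : x <= expR (- (1 - x)).
  by have := expR_ge1Dx (- (1 - x)); lra.
apply: (@le_trans _ _ (expR (- (1 - x)) `^ y)).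
  by apply: ge0_ler_powR; rewrite ?nnegrE ?expR_ge0.
by rewrite /powR gt_eqF ?expR_gt0// expRK mulrN.
Qed.

(* Slicing [[0, 1]] into the layers [j <= L (1 - x) < j + 1]. *)
Lemma powR_layers x theta L (J : nat) : 0 <= x <= 1 -> 0 < theta -> 0 < L ->
  x `^ (theta * L) <= \sum_(j < J) expR (- theta) ^+ j *
      \1_(`[1 - j.+1%:R / L, 1]%classic : set R) x + expR (- theta) ^+ J.
Proof.
move=> x01 th0 L0; have /andP[x0 x1] := x01.
have y0 : 0 <= L * (1 - x) by rewrite mulr_ge0 ?(ltW L0)// subr_ge0.
have /andP[jy yj] := truncn_itv y0; set j := Num.truncn _ in jy yj.
have z0 := expR_gt0 (- theta).
have z1 : expR (- theta) <= 1 by rewrite -expR0 ler_expR oppr_le0 ltW.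
apply: (le_trans (powR_le_expR x01 _)); first by rewrite mulr_ge0// ltW.
apply: (@le_trans _ _ (expR (- theta) ^+ j)).
  by rewrite -expRM_natl ler_expR mulrN lerN2 mulrC -mulrA ler_pM2l.
have t0 (i : nat) : 0 <= expR (- theta) ^+ i * \1_(`[1 - i.+1%:R / L, 1]%classic : set R) x.
  by rewrite mulr_ge0 ?exprn_ge0// ltW.
have [jJ|Jj] := ltnP j J.
  rewrite (bigD1 (Ordinal jJ))//= indicE mem_set/= ?mulr1; last first.
    rewrite in_itv/= x1 andbT.
    have : 1 - x <= j.+1%:R / L by rewrite ler_pdivlMr// mulrC ltW.
    lra.
  by rewrite -addrA lerDl addr_ge0 ?exprn_ge0 ?(ltW z0)// sumr_ge0.
apply: (@le_trans _ _ (expR (- theta) ^+ J)); first by apply: ler_wiXn2l => //; exact: ltW.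
by rewrite lerDr sumr_ge0.
Qed.

Variable mu : {finite_measure set (measurableTypeR R) -> \bar R}.

(** Layers close to 1 have measure at most e1 (j + 1) / L, and the factor (1 - z)^2 in e1 cancels
    the sum of z^j (j + 1). The rest of [0, 1] carries a weight exponentially small in L. *)
Lemma moment_small theta e : 0 < theta -> 0 < e -> vanishing_sublinear mu ->
  exists2 M, 0 < M & forall L, M <= L ->
    (L%:E * \int[mu]_(x in `[0%R, 1%R]) (x `^ (theta * L))%:E <= e%:E)%E.
Proof.
move=> th0 e0 muv.
have mufin (A : set (measurableTypeR R)) : measurable A -> mu A \is a fin_num.
  by move=> mA; exact: fin_num_measure.
pose z := expR (- theta); have z0 : 0 < z by exact: expR_gt0.
have z1 : z < 1 by rewrite /z -expR0 ltr_expR; lra.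
pose e1 := e / 2 * (1 - z) ^+ 2.
have e10 : 0 < e1 by rewrite mulr_gt0 ?divr_gt0// exprn_gt0// subr_gt0.
have [eta eta0 etaP] : exists2 eta, 0 < eta & forall d, 0 < d < eta ->
    fine (mu `[1 - d, 1]%classic) <= e1 * d.
  move/cvgrPdist_le : muv => /(_ e1 e10)[eta /= eta0 H]; exists eta => // d /andP[d0 de].
  have := H d; rewrite /= sub0r normrN gtr0_norm// => /(_ de d0).
  by rewrite sub0r normrN ger0_norm ?divr_ge0 ?fine_ge0 ?(ltW d0)// ler_pdivrMr.
pose m := fine (mu `[0%R, 1%R]%classic); have m0 : 0 <= m by rewrite fine_ge0.
pose c := theta * eta / 2; have c0 : 0 < c by rewrite divr_gt0// mulr_gt0.
(* The factor [expR theta] pays for rounding J down; m + 1 dominates the mass m and does not vanish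
   with it. *)
pose e2 := e / 2 / (expR theta * (m + 1)).
have em0 : 0 < expR theta * (m + 1) by rewrite mulr_gt0 ?expR_gt0//; lra.
have e20 : 0 < e2 by rewrite divr_gt0// divr_gt0.
have [M M0 HM] := expRN_small c0 e20.
exists M => // L ML; have L0 : 0 < L by apply: lt_le_trans ML.
have y0 : 0 <= eta * L / 2 by rewrite divr_ge0// mulr_ge0// ltW.
(* J is the integer part of eta L / 2: for j < J the layer has width (j + 1) / L < eta, while z^J is
   still exponentially small in L. *)
have /andP[Jy yJ] := truncn_itv y0; set J := Num.truncn _ in Jy yJ.
pose E j : set (measurableTypeR R) := `[1 - j.+1%:R / L, 1]%classic.
have mE j : measurable (E j) by exact: measurable_itv.
have mterm j : measurable_fun (`[0%R, 1%R]%classic : set (measurableTypeR R)) (fun x => (z ^+ j * \1_(E j) x)%:E).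
  by apply/measurable_EFinP; apply: measurable_funM => //; exact: measurable_indic.
have term0 j x : (0 <= (z ^+ j * \1_(E j) x)%:E)%E.
  by rewrite lee_fin mulr_ge0 ?exprn_ge0// ltW.
have intE : (\int[mu]_(x in `[0%R, 1%R]) (x `^ (theta * L))%:E <=
    (\sum_(j < J) z ^+ j * fine (mu (E j)) + z ^+ J * m)%:E)%E.
  apply: (@le_trans _ _ (\int[mu]_(x in `[0%R, 1%R])
      (\sum_(j < J) (z ^+ j * \1_(E j) x)%:E + (z ^+ J)%:E))%E).
    apply: ge0_le_integral => //.
    - by move=> x _; rewrite lee_fin powR_ge0.
    - by apply/measurable_EFinP/measurable_funTS; exact: measurable_powR.
    - apply: emeasurable_funD; last exact: measurable_cst.
      by apply: emeasurable_sum => j; exact: mterm.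
    - move=> x /=; rewrite in_itv/= => x01; rewrite sumEFin -EFinD lee_fin.
      exact: powR_layers.
  rewrite ge0_integralD//; last 3 first.
  - by move=> x _; apply: sume_ge0 => j _; exact: term0.
  - by apply: emeasurable_sum => j; exact: mterm.
  - by move=> x _; rewrite lee_fin exprn_ge0// ltW.
  rewrite integral_cst// EFinD; apply: leeD; last first.
    by rewrite EFinM /m fineK// mufin.
  have -> := @ge0_integral_sum _ _ _ mu _ (measurable_itv `[0%R, 1%R]) _
    (fun (j : 'I_J) x => (z ^+ j * \1_(E j) x)%:E) (fun j => mterm j)
    (fun j x _ => term0 j x) (index_enum 'I_J).
  rewrite -sumEFin; apply: lee_sum => j _.
  under eq_integral do rewrite EFinM.
  have zj0 : 0 <= z ^+ j by rewrite exprn_ge0// ltW.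
  have mi : measurable_fun (`[0%R, 1%R]%classic : set (measurableTypeR R))
      (fun x => (\1_(E j) x : R)%:E).
    by apply/measurable_EFinP; exact: measurable_indic.
  rewrite ge0_integralZl_EFin//.
  rewrite integral_indic// EFinM fineK ?mufin//.
  rewrite lee_pmul2l ?lte_fin ?exprn_gt0//; apply: le_measure; rewrite ?inE//.
  by apply: measurableI => //; exact: mE.
apply: (@le_trans _ _ (L%:E * (\sum_(j < J) z ^+ j * fine (mu (E j)) + z ^+ J * m)%:E)%E).
  by rewrite lee_pmul2l.
rewrite -EFinM lee_fin mulrDr [leRHS]splitr; apply: lerD.
  rewrite mulr_sumr; apply: (@le_trans _ _ (\sum_(j < J) e1 * (z ^+ j * j.+1%:R))).
    apply: ler_sum => j _; have jL0 : 0 < j.+1%:R / L by rewrite divr_gt0.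
    have : fine (mu (E j)) <= e1 * (j.+1%:R / L).
      apply: etaP; rewrite jL0/= ltr_pdivrMr//.
      have : j.+1%:R <= J%:R :> R by rewrite ler_nat.
      have : 0 < eta * L by rewrite mulr_gt0.
      lra.
    move=> H; rewrite mulrCA [e1 * _]mulrCA ler_wpM2l ?exprn_ge0 ?(ltW z0)//.
    apply: (@le_trans _ _ (L * (e1 * (j.+1%:R / L)))); first by rewrite ler_pM2l.
    by rewrite le_eqVlt; apply/orP; left; apply/eqP; field; rewrite gt_eqF.
  rewrite -mulr_sumr /e1 -mulrA -[leRHS]mulr1 ler_pM2l ?divr_gt0//.
  rewrite mulrC -ler_pdivlMr ?exprn_gt0 ?subr_gt0// mul1r.
  by apply: arithmetic_geometric_sum_le; rewrite (ltW z0).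
have zJ : z ^+ J <= expR theta * expR (- (c * L)).
  rewrite /z -expRM_natl -expRD ler_expR /c.
  have : theta * (eta * L / 2) <= theta * J.+1%:R by rewrite ler_pM2l// ltW.
  rewrite -natr1; lra.
have := HM L ML; rewrite /e2 ler_pdivlMr// => HL.
apply: le_trans HL; rewrite -mulrA ler_pM2l//.
apply: (@le_trans _ _ (expR theta * expR (- (c * L)) * m)); first by rewrite ler_wpM2r.
have := mulr_ge0 (expR_ge0 theta) (expR_ge0 (- (c * L))); lra.
Qed.

End moments.

(** * Limits in the L^1 norm *)

Section L1_norm.
Context {R : realType}.
Notation T := (measurableTypeR R).
Implicit Types (nu : {measure set T -> \bar R}) (f g h : T -> R).

Lemma measurable_abs_EFin (D : set T) f : measurable_fun setT f ->
  measurable_fun D (fun x => `|(EFin \o f) x|%E).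
Proof.
move=> mf; apply: measurable_funTS; apply: (@measurableT_comp _ _ _ _ _ _ (@abse R)) => //.
exact/measurable_EFinP.
Qed.

Lemma measurable_norm_EFin (D : set T) f : measurable_fun setT f ->
  measurable_fun D (fun x => (`|f x|)%:E).
Proof.
by move=> mf; apply/measurable_EFinP; apply: measurable_funTS; exact: measurableT_comp.
Qed.

Lemma Lnorm_triangle nu f g h : measurable_fun setT f -> measurable_fun setT g ->
  measurable_fun setT h ->
  ('N[nu]_1[EFin \o (f \- h)%R] <= 'N[nu]_1[EFin \o (f \- g)%R] + 'N[nu]_1[EFin \o (g \- h)%R])%E.
Proof.
move=> mf mg mh; rewrite (@eq_Lnorm _ _ _ _ _ _ (EFin \o ((f \- g) \+ (g \- h))%R)).
  by apply: minkowski_EFin => //; exact: measurable_funB.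
by move=> x /=; rewrite addrA subrK.
Qed.

Lemma Lnorm_add nu f g : measurable_fun setT f -> measurable_fun setT g ->
  ('N[nu]_1[EFin \o (f \+ g)%R] <= 'N[nu]_1[EFin \o f] + 'N[nu]_1[EFin \o g])%E.
Proof. by move=> mf mg; apply: minkowski_EFin. Qed.

Lemma Lnorm_subC nu f g : ('N[nu]_1[EFin \o (f \- g)%R] = 'N[nu]_1[EFin \o (g \- f)%R])%E.
Proof.
rewrite -oppe_Lnorm; apply: eq_Lnorm => x /=; by rewrite opprB.
Qed.

Lemma Lnorm_ae nu f g : measurable_fun setT f -> measurable_fun setT g ->
  f = g %[ae nu] -> ('N[nu]_1[EFin \o f] = 'N[nu]_1[EFin \o g])%E.
Proof.
move=> mf mg fg; rewrite !Lnorm1; apply: ae_eq_integral => //.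
- exact: measurable_abs_EFin.
- exact: measurable_abs_EFin.
- by apply: filterS fg => x /(_ I) /= ->.
Qed.

Lemma Lnorm_on nu (D : set T) f : measurable D -> nu (~` D) = 0%E ->
  measurable_fun setT f ->
  ('N[nu]_1[EFin \o f] = \int[nu]_(x in D) (`|f x|)%:E)%E.
Proof.
move=> mD D0 mf; rewrite Lnorm1 (@ge0_negligible_integral _ _ _ _ _ (~` D))//.
- by rewrite setTD setCK.
- exact: measurableC.
- exact: measurable_abs_EFin.
Qed.

Lemma Lnorm_bound nu (D : set T) f (c : R) : measurable D -> nu (~` D) = 0%E ->
  measurable_fun setT f -> (forall x, D x -> `|f x| <= c) ->
  ('N[nu]_1[EFin \o f] <= c%:E * nu D)%E.
Proof.
move=> mD D0 mf fc; rewrite (Lnorm_on mD D0 mf) -integral_cst//.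
apply: ge0_le_integral => //.
exact: measurable_norm_EFin.
Qed.

Lemma Lnorm_sum nu (f : nat -> T -> R) (e : nat -> R) (m n : nat) :
  (forall k, measurable_fun setT (f k)) ->
  (forall k, 'N[nu]_1[EFin \o f k] <= (e k)%:E)%E ->
  ('N[nu]_1[EFin \o (fun x => (\sum_(m <= k < n) f k x)%R)] <= (\sum_(m <= k < n) e k)%:E)%E.
Proof.
move=> mf fe; elim: (index_iota m n) => [|k l IH].
  rewrite big_nil (@eq_Lnorm _ _ _ _ _ _ (cst 0%E)) ?Lnorm0// => x /=.
  by rewrite big_nil.
rewrite (@eq_Lnorm _ _ _ _ _ _ (EFin \o (f k \+ (fun x => \sum_(k <- l) f k x))%R)); last first.
  by move=> x /=; rewrite big_cons.
apply: (le_trans (Lnorm_add _ (mf k) _)); first exact: measurable_sum.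
by rewrite big_cons EFinD; apply: leeD.
Qed.

Definition pointwise_limit (q : nat -> R -> R) : R -> R :=
  fun x => if 0 <= x < 1 then limn (q ^~ x) else 0.

Lemma limn_einf_le (u : (\bar R)^nat) c : (forall n, u n <= c)%E -> (limn_einf u <= c)%E.
Proof.
move=> uc; rewrite limn_einf_lim; apply: lime_le; first exact: is_cvg_einfs.
apply: nearW => n; apply: le_trans (uc n).
by apply: ereal_inf_lbound; exists n => /=.
Qed.

(** Fatou's lemma passes the Cauchy rate to the pointwise limit. The limit function does not depend
    on [nu], so a single representative serves both Lebesgue measure and [mu]. *)
Lemma L1_limit nu (q : nat -> R -> R) (e : nat -> R) : nu (~` `[0, 1[%classic) = 0%E ->
  (forall n, measurable_fun setT (q n : T -> R)) ->
  (forall x, 0 <= x < 1 -> cvgn (q ^~ x)) ->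
  (forall n j, (n <= j)%N -> 'N[nu]_1[EFin \o (q j \- q n)%R] <= (e n)%:E)%E ->
  measurable_fun setT (pointwise_limit q : T -> R) /\
  forall n, ('N[nu]_1[EFin \o (pointwise_limit q \- q n)%R] <= (e n)%:E)%E.
Proof.
move=> nu0 mq cq qe.
pose D : set T := `[0, 1[%classic.
have mD : measurable D by exact: measurable_itv.
pose f := pointwise_limit q.
have fD x : D x -> q n x @[n --> \oo] --> f x.
  by rewrite /D /= in_itv/= => x01; rewrite /f /pointwise_limit x01; exact: cq.
have mf : measurable_fun setT (f : T -> R).
  (* Multiplying by the indicator of [0, 1) makes the convergence hold everywhere. *)
  apply: (@measurable_fun_cvg _ _ _ setT (fun n x => q n x * \1_D x)).
    by move=> n; apply: measurable_funM; [exact: mq|exact: measurable_indic].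
  move=> x _; have [Dx|Dx] := boolP (0 <= x < 1).
    have D1 : \1_D x = 1 :> R by rewrite indicE mem_set// /D /= in_itv.
    under eq_fun do rewrite D1 mulr1.
    by apply: fD; rewrite /D /= in_itv.
  have D1 : \1_D x = 0 :> R.
    by rewrite indicE memNset// /D /= in_itv /=; exact/negP.
  rewrite /f /pointwise_limit (negbTE Dx); under eq_fun do rewrite D1 mulr0.
  exact: cvg_cst.
split=> // n.
have mfq : measurable_fun setT (f \- q n : T -> R) by exact: measurable_funB.
rewrite (Lnorm_on mD nu0 mfq).
have mqn j : measurable_fun D (fun x => (`|q (j + n)%N x - q n x|)%:E).
  have mB : measurable_fun setT (q (j + n)%N \- q n : T -> R) by exact: measurable_funB.
  apply/measurable_EFinP; apply: measurable_funTS; apply: measurableT_comp => //.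
have := @fatou _ _ _ nu D mD (fun j x => (`|q (j + n)%N x - q n x|)%:E) mqn _.
have q0 : forall (j : nat) x, D x -> (0 <= (`|q (j + n)%N x - q n x|)%:E)%E by [].
move=> /(_ q0) fat.
have -> : (\int[nu]_(x in D) (`|(f \- q n) x|)%:E =
    \int[nu]_(x in D) limn_einf (fun j => (`|q (j + n)%N x - q n x|)%:E))%E.
  apply: eq_integral => x; rewrite inE => Dx.
  have c : (`|q (j + n)%N x - q n x|)%:E @[j --> \oo] --> (`|(f \- q n) x|)%:E.
    apply: cvg_EFin; first by apply: nearW.
    apply: cvg_norm; apply: cvgB; last exact: cvg_cst.
    by move: (fD x Dx); rewrite -(cvg_shiftn n).
  by case: (cvg_limn_einf_sup c) => ->.
apply: (le_trans fat); apply: limn_einf_le => j.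
have mB : measurable_fun setT (q (j + n)%N \- q n : T -> R) by exact: measurable_funB.
rewrite -(Lnorm_on mD nu0 mB); apply: qe; exact: leq_addl.
Qed.

End L1_norm.

(** * Estimates for polynomials *)

Section leb01_facts.
Context {R : realType}.
Notation T := (measurableTypeR R).

Lemma leb01E (S : set T) : @leb01 R S = lebesgue_measure (S `&` `[0%R, 1%R]%classic).
Proof. by []. Qed.

Lemma leb01_setC01 : @leb01 R (~` `[0%R, 1%R]%classic) = 0%E.
Proof. by rewrite leb01E setICl measure0. Qed.

Lemma leb01_itv01 : @leb01 R `[0%R, 1%R]%classic = 1%E.
Proof.
by rewrite leb01E setIid lebesgue_measure_itv/= lte_fin ltr01 oppr0 adde0.
Qed.

Lemma leb01_setC01o : @leb01 R (~` `[0%R, 1%R[%classic) = 0%E.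
Proof.
rewrite leb01E (_ : _ `&` _ = [set 1%R]) ?lebesgue_measure_set1//.
apply/seteqP; split => x /=; rewrite !in_itv/=.
  by move=> [/negP + /andP[x0 x1]]; rewrite x0/= -leNgt => x1'; apply/le_anti; rewrite x1.
by move=> ->; rewrite ltxx andbF lexx ler01; split.
Qed.

Lemma measure_setC01o (nu : {measure set T -> \bar R}) :
  nu (~` `[0%R, 1%R]%classic) = 0%E -> nu [set 1%R] = 0%E ->
  nu (~` `[0%R, 1%R[%classic) = 0%E.
Proof.
move=> n1 n2; apply/eqP; rewrite eq_le measure_ge0 andbT.
have sub : ~` `[0%R, 1%R[%classic `<=` ~` `[0%R, 1%R]%classic `|` [set 1%R : T].
  move=> x /= /negP; rewrite in_itv/= => nx.
  have [->|x1] := eqVneq x 1%R; first by right.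
  left; apply/negP; rewrite in_itv/=; apply: contra nx => /andP[->] /=.
  by rewrite le_eqVlt (negbTE x1).
have m1 : measurable (~` `[0%R, 1%R]%classic : set T) by exact: measurableC.
have m2 : measurable [set 1%R : T] by exact: measurable_set1.
apply: (@le_trans _ _ (nu (~` `[0%R, 1%R]%classic `|` [set 1%R]))).
  apply: le_measure => //; rewrite inE; last exact: measurableU.
  by apply: measurableC; exact: measurable_itv.
apply: (le_trans (measureU2 _ m1 m2)).
rewrite -[leRHS](adde0 0%E); apply: leeD; rewrite le_eqVlt; apply/orP; left; apply/eqP.
  exact: n1.
exact: n2.
Qed.

End leb01_facts.

Lemma powR_le1 {R : realType} (x y : R) : 0 <= x <= 1 -> 0 <= y -> x `^ y <= 1.
Proof.
move=> x01 y0; apply: (le_trans (powR_le_expR x01 y0)).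
rewrite -[leRHS]expR0 ler_expR oppr_le0 mulr_ge0// subr_ge0.
by case/andP: x01.
Qed.

Section polynomials.
Context {R : realType}.
Notation T := (measurableTypeR R).
Variables (lambda : nat -> R) (s : nat -> nat) (C theta : R)
  (A : (nat -> R) -> nat -> R).
Hypothesis l0 : forall n, 0 < lambda n.
Hypothesis BN : block_norm lambda s C theta A.
Implicit Types (a b : nat -> R) (x : R).

Let C0 : 0 < C := bn_C BN.
Let th0 : 0 < theta := bn_theta BN.

Lemma block_start_mono m n : (m <= n)%N -> (s m <= s n)%N.
Proof.
elim: n => [|n IH]; first by rewrite leqn0 => /eqP ->.
rewrite leq_eqVlt => /predU1P[->//|]; rewrite ltnS => /IH /leq_trans; apply.
exact: ltnW (bn_s BN n).
Qed.

Lemma block_start_ge n : (n <= s n)%N.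
Proof. by elim: n => // n IH; apply: leq_ltn_trans IH (bn_s BN n). Qed.

Lemma power_sum_blocks a m n x : (m <= n)%N ->
  power_sum lambda a (s m) (s n) x =
  \sum_(m <= k < n) power_sum lambda a (s k) (s k.+1) x.
Proof.
move=> mn; rewrite -(subnKC mn); elim: (n - m)%N => [|d IH].
  by rewrite addn0 /power_sum !big_geq.
rewrite addnS big_nat_recr ?leq_addr//= -IH /power_sum -big_cat_nat//=.
  exact/block_start_mono/leq_addr.
exact: ltnW (bn_s BN _).
Qed.

Lemma power_sum_le a m n x : 0 <= x <= 1 ->
  `|power_sum lambda a m n x| <= \sum_(m <= i < n) `|a i|.
Proof.
move=> /andP[x0 x1]; apply: (le_trans (ler_norm_sum _ _ _)); apply: ler_sum => i _.
rewrite normrM ler_piMr// ger0_norm ?powR_ge0//.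
by apply: powR_le1; [rewrite x0|exact: ltW].
Qed.

Lemma Lnorm_power_sum_le (nu : {measure set T -> \bar R}) a m n :
  nu (~` `[0%R, 1%R]%classic) = 0%E ->
  ('N[nu]_1[EFin \o power_sum lambda a m n] <=
    (\sum_(m <= i < n) `|a i|)%:E * nu `[0%R, 1%R]%classic)%E.
Proof.
move=> n0; apply: Lnorm_bound => //; first exact: measurable_power_sum.
by move=> x /=; rewrite in_itv/=; exact: power_sum_le.
Qed.

Lemma Lnorm_power_sum_fin a m n :
  ('N[@leb01 R]_1[EFin \o power_sum lambda a m n] \is a fin_num)%E.
Proof.
rewrite ge0_fin_numE ?Lnorm_ge0//.
apply: le_lt_trans (Lnorm_power_sum_le _ _ _ leb01_setC01) _.
by rewrite [X in (_ * X)%E]leb01_itv01 mule1 ltry.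
Qed.

Definition poly_norm a K : R := fine ('N[@leb01 R]_1[EFin \o power_sum lambda a 0 (s K)])%E.

Lemma poly_normE a K :
  ('N[@leb01 R]_1[EFin \o power_sum lambda a 0 (s K)] = (poly_norm a K)%:E)%E.
Proof. by rewrite /poly_norm fineK// Lnorm_power_sum_fin. Qed.

Lemma block_sum_le a K : \sum_(k < K) A a k <= C * poly_norm a K.
Proof. by have := bn_sum BN a K; rewrite poly_normE -EFinM lee_fin. Qed.

Lemma block_sum_mono a m n : (m <= n)%N -> \sum_(k < m) A a k <= \sum_(k < n) A a k.
Proof.
move=> mn; rewrite -!(big_mkord xpredT (A a)) (@big_cat_nat _ _ _ m 0 n)//= lerDl.
by apply: sumr_ge0 => k _; exact: (bn_ge0 BN).
Qed.

(** The factor L = [lambda (s k)] of [bn_le] disappears because L e^(- theta L (1 - x)) <= 1 /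
    (theta (1 - x)); the bound is uniform in k and degenerates only at x = 1. *)
Lemma block_le a k x : 0 <= x < 1 ->
  `|power_sum lambda a (s k) (s k.+1) x| <= C / (theta * (1 - x)) * A a k.
Proof.
move=> /andP[x0 x1]; have x01 : 0 <= x <= 1 by rewrite x0 ltW.
apply: (le_trans (bn_le BN a k x01)).
have A0 := bn_ge0 BN a k.
set L := lambda (s k); have L0 : 0 < L by exact: l0.
have y0 : 0 < theta * (1 - x) by rewrite mulr_gt0// subr_gt0.
have pe : x `^ (theta * L) <= expR (- (theta * L * (1 - x))).
  by apply: powR_le_expR => //; rewrite mulr_ge0// ltW.
have Lp : L * x `^ (theta * L) <= (theta * (1 - x))^-1.
  apply: (@le_trans _ _ (L * expR (- (theta * L * (1 - x))))); first by rewrite ler_pM2l.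
  rewrite expRN ler_pdivrMr ?expR_gt0// ler_pdivlMl//.
  have := expR_ge1Dx (theta * L * (1 - x)).
  have -> : theta * (1 - x) * L = theta * L * (1 - x) by ring.
  lra.
have -> : C * (L * A a k) * x `^ (theta * L) = C * A a k * (L * x `^ (theta * L)) by ring.
by rewrite [leRHS]mulrAC ler_wpM2l// mulr_ge0// ltW.
Qed.

Lemma power_sum_pointwise a m n x : (m <= n)%N -> 0 <= x < 1 ->
  `|power_sum lambda a (s m) (s n) x| <=
    C / (theta * (1 - x)) * \sum_(m <= k < n) A a k.
Proof.
move=> mn x01; rewrite power_sum_blocks// mulr_sumr.
by apply: (le_trans (ler_norm_sum _ _ _)); apply: ler_sum => k _; exact: block_le.
Qed.

Lemma poly_pointwise a K x : 0 <= x < 1 ->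
  `|power_sum lambda a 0 (s K) x| <= C ^+ 2 / (theta * (1 - x)) * poly_norm a K.
Proof.
move=> x01; have := power_sum_pointwise a (leq0n K) x01; rewrite (bn_s0 BN).
move=> /le_trans; apply; rewrite big_mkord.
have y0 : 0 < theta * (1 - x) by rewrite mulr_gt0// subr_gt0; case/andP: x01.
have -> : C ^+ 2 / (theta * (1 - x)) * poly_norm a K =
  C / (theta * (1 - x)) * (C * poly_norm a K) by ring.
by rewrite ler_wpM2l ?block_sum_le// divr_ge0// ltW.
Qed.

Variable mu : {finite_measure set T -> \bar R}.
Hypothesis mu01 : measure_on01 mu.
Hypothesis mu_vs : vanishing_sublinear mu.

(** [d k] is C [lambda (s k)] times the moment of [mu] of order theta [lambda (s k)]. From here on
    the sublinearity of [mu] acts through [d] alone. *)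
Lemma block_measure_bound : exists d : nat -> R, [/\ forall k, 0 <= d k,
  forall a k, ('N[mu]_1[EFin \o power_sum lambda a (s k) (s k.+1)] <= (d k * A a k)%:E)%E &
  forall e, 0 < e -> exists k0, forall k, (k0 <= k)%N -> d k <= e].
Proof.
have [m0 m1] := mu01.
pose I k := (\int[mu]_(x in `[0%R, 1%R]) (x `^ (theta * lambda (s k)))%:E)%E.
have mp (y : R) (D : set T) : measurable_fun D (fun x => (x `^ y)%:E).
  by apply/measurable_EFinP/measurable_funTS; exact: measurable_powR.
have I0 k : (0 <= I k)%E by apply: integral_ge0 => x _; rewrite lee_fin powR_ge0.
have Ifin k : I k \is a fin_num.
  rewrite ge0_fin_numE//; apply: (@le_lt_trans _ _ (mu `[0%R, 1%R]%classic)).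
    rewrite -[leRHS]mul1e -integral_cst//; apply: ge0_le_integral => //.
    - by move=> x _; rewrite lee_fin powR_ge0.
    - move=> x /=; rewrite in_itv/= lee_fin => /andP[x0 x1].
      by apply: powR_le1; rewrite ?x0// mulr_ge0// ltW.
  by rewrite -ge0_fin_numE// fin_num_measure.
exists (fun k => C * (lambda (s k) * fine (I k))); split.
- by move=> k; rewrite mulr_ge0 ?(ltW C0)// mulr_ge0 ?fine_ge0// ltW.
- move=> a k; rewrite (Lnorm_on _ m0)//; last exact: measurable_power_sum.
  have c0 : 0 <= C * (lambda (s k) * A a k).
    by rewrite mulr_ge0 ?(ltW C0)// mulr_ge0 ?(bn_ge0 BN)// ltW.
  apply: (@le_trans _ _ (\int[mu]_(x in `[0%R, 1%R])
      ((C * (lambda (s k) * A a k))%:E * (x `^ (theta * lambda (s k)))%:E))%E).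
    apply: ge0_le_integral => //.
    - by apply: measurable_norm_EFin; exact: measurable_power_sum.
    - by apply: measurable_funeM.
    - by move=> x /=; rewrite in_itv/= -EFinM lee_fin; exact: (bn_le BN).
  rewrite ge0_integralZl_EFin//; last by move=> x _; rewrite lee_fin powR_ge0.
  rewrite -/(I k) -(fineK (Ifin k)) -EFinM lee_fin /=.
  by rewrite le_eqVlt; apply/orP; left; apply/eqP; ring.
- move=> e e0; have eC0 : 0 < e / C by rewrite divr_gt0.
  have [M M0 HM] := moment_small th0 eC0 mu_vs.
  have [k0 Hk0] := bn_cofinal BN M; exists k0 => k /Hk0/HM.
  rewrite -/(I k) -(fineK (Ifin k)) -EFinM lee_fin /= => H.
  by rewrite mulrC -ler_pdivlMr.
Qed.

End polynomials.

(** * Continuous representatives *)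

Section continuity.
Context {R : realType}.
Implicit Types (f g : R -> R) (x c e : R).

Lemma cvg_halves c e : 0 < e -> exists n : nat, c * 2^-1 ^+ n <= e.
Proof.
move=> e0; have [n cn] := @exists_expr_ge R 2 (c / e) (ltr1n _ 2).
exists n; rewrite exprVn ler_pdivrMr ?exprn_gt0//.
by move: cn; rewrite ler_pdivrMr// mulrC.
Qed.

Lemma halves_le m n : (m <= n)%N -> 2^-1 ^+ n <= 2^-1 ^+ m :> R.
Proof. by move=> mn; apply: ler_wiXn2l => //; lra. Qed.

Lemma halves_gt0 n : 0 < 2^-1 ^+ n :> R.
Proof. by rewrite exprn_gt0 ?invr_gt0. Qed.

Lemma cauchy_halves (u : nat -> R) c : 0 <= c ->
  (forall n j, (n <= j)%N -> `|u j - u n| <= c * 2^-1 ^+ n) ->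
  cvgn u /\ forall n, `|limn u - u n| <= c * 2^-1 ^+ n.
Proof.
move=> c0 uc; have cu : cvgn u.
  apply/cauchy_cvgP/cauchy_exP => e /= e0.
  have [n cn] := cvg_halves c (divr_gt0 e0 (ltr0Sn R 1)).
  exists (u n); exists n => // j /= nj.
  change (`|u n - u j| < e); rewrite distrC.
  by apply: (le_lt_trans (uc n j nj)); apply: (le_lt_trans cn); lra.
split=> // n.
have cn : `|u j - u n| @[j --> \oo] --> `|limn u - u n|.
  by apply: cvg_norm; apply: cvgB => //; exact: cvg_cst.
rewrite -(cvg_lim _ cn)//; apply: limr_le; first by apply/cvg_ex; eexists; exact: cn.
by exists n => // j /= nj; exact: uc.
Qed.

Lemma within_powR (l : R) : 0 < l -> {within `[0, 1[, continuous (fun x : R => x `^ l)}.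
Proof.
move=> l0; apply/subspace_continuousP => x /=; rewrite in_itv/= => /andP[x0 x1].
move: x0; rewrite le_eqVlt => /predU1P[<-|x0].
  rewrite /from_subspace; apply/cvgrPdist_le => e e0 /=.
  rewrite near_withinE powR0 ?gt_eqF//.
  exists (e `^ l^-1) => /=; first by rewrite powR_gt0.
  move=> y /=; rewrite sub0r normrN => ye; rewrite in_itv/= => /andP[y0 y1].
  rewrite sub0r normrN ger0_norm ?powR_ge0//.
  rewrite (ger0_norm y0) in ye.
  have -> : e = (e `^ l^-1) `^ l by rewrite -powRrM mulVf ?gt_eqF// powRr1// ltW.
  apply: ge0_ler_powR; rewrite ?nnegrE//; [exact: ltW|exact: powR_ge0|exact: ltW].
rewrite /from_subspace; apply: cvg_within_filter.
have c : {for x, continuous (fun y : R => expR (l * ln y))}.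
  apply: (@continuous_comp _ _ _ (fun y => l * ln y) expR); last exact: continuous_expR.
  by apply: cvgM; [exact: cvg_cst|exact: continuous_ln].
apply: cvg_trans (_ : expR (l * ln y) @[y --> x] --> x `^ l); last first.
  by rewrite /powR gt_eqF.
apply: near_eq_cvg; near=> y; rewrite /powR gt_eqF//.
near: y; exact: lt_nbhsr.
Unshelve. all: by end_near. Qed.

Lemma within_power_sum (lambda a : nat -> R) m n : (forall i, 0 < lambda i) ->
  {within `[0, 1[, continuous (power_sum lambda a m n)}.
Proof.
move=> l0; rewrite /power_sum; elim: (index_iota m n) => [|i l IH].
  have -> : (fun x : R => \sum_(i <- [::]) a i * x `^ lambda i) = fun=> 0.
    by apply/funext => x; rewrite big_nil.
  by apply: continuous_subspaceT => x; exact: cvg_cst.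
have -> : (fun x : R => \sum_(j <- i :: l) a j * x `^ lambda j) =
    fun x => a i * x `^ lambda i + \sum_(j <- l) a j * x `^ lambda j.
  by apply/funext => x; rewrite big_cons.
apply/subspace_continuousP => x x01; rewrite /from_subspace; apply: cvgD.
  apply: cvgM; first exact: cvg_cst.
  have /subspace_continuousP := within_powR (l0 i); exact.
have /subspace_continuousP := IH; exact.
Qed.

(** For y < (1 + x) / 2 the error bound is at most twice its value at x, so convergence is uniform
    near x and an e / 3 argument applies. *)
Lemma within_limit (p : nat -> R -> R) f c : 0 <= c ->
  (forall n, {within `[0, 1[, continuous (p n)}) ->
  (forall n x, 0 <= x < 1 -> `|f x - p n x| <= c / (1 - x) * 2^-1 ^+ n) ->
  {within `[0, 1[, continuous f}.
Proof.
move=> c0 cp fp; apply/subspace_continuousP => x /=; rewrite in_itv/= => x01.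
have /andP[x0 x1] := x01; have x10 : 0 < 1 - x by rewrite subr_gt0.
apply/cvgrPdist_le => e e0.
have [n nP] := cvg_halves (2 * c / (1 - x)) (divr_gt0 e0 (ltr0Sn R 2)).
have /subspace_continuousP/(_ x) := cp n; rewrite /= in_itv/= => /(_ x01).
move=> /cvgrPdist_le /(_ _ (divr_gt0 e0 (ltr0Sn R 2))); rewrite !near_withinE => H.
near=> y; rewrite /= in_itv/= => y01.
have /andP[y0 y1] := y01; have y10 : 0 < 1 - y by rewrite subr_gt0.
have py : `|p n x - p n y| <= e / 3.
  have : 0 <= y < 1 -> `|p n x - p n y| <= e / 3.
    by near: y; apply: filterS H => z /=; rewrite in_itv.
  exact.
have yx : y < (1 + x) / 2 by near: y; apply: lt_nbhsl; lra.
have bnd z : 0 <= z < 1 -> (1 - x) / 2 <= 1 - z -> `|f z - p n z| <= e / 3.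
  move=> z01 zx; have z10 : 0 < 1 - z by rewrite subr_gt0; case/andP: z01.
  apply: (le_trans (fp n z z01)); apply: (le_trans _ nP).
  rewrite ler_wpM2r ?(ltW (halves_gt0 _))// ler_pdivrMr// mulrAC ler_pdivlMr//.
  have : c * (1 - x) <= c * (2 * (1 - z)) by rewrite ler_wpM2l//; lra.
  lra.
have fx := bnd x x01 _; have fy := bnd y y01 _.
have {}fx : `|f x - p n x| <= e / 3 by apply: fx; lra.
have {}fy : `|f y - p n y| <= e / 3 by apply: fy; lra.
have -> : f x - f y = (f x - p n x) + (p n x - p n y) + - (f y - p n y) by ring.
apply: (le_trans (ler_normD _ _)); rewrite normrN.
have := ler_normD (f x - p n x) (p n x - p n y); lra.
Unshelve. all: by end_near. Qed.

(** Functions differing at x would differ on an interval to the right of x inside [0, 1), which has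
    positive Lebesgue measure. This identifies the unspecified representative in [iota_graph] with
    the constructed one. *)
Lemma within_eq_ae f g : {within `[0, 1[, continuous f} -> {within `[0, 1[, continuous g} ->
  f = g %[ae (@leb01 R)] -> forall x, 0 <= x < 1 -> f x = g x.
Proof.
move=> cf cg fg x x01; apply/eqP; apply: contrapT => /negP fgx.
have /andP[x0 x1] := x01.
pose e := `|f x - g x| / 3; have e0 : 0 < e by rewrite divr_gt0// normr_gt0 subr_eq0.
have /subspace_continuousP/(_ x) := cf; rewrite /= in_itv/= => /(_ x01).
have /subspace_continuousP/(_ x) := cg; rewrite /= in_itv/= => /(_ x01).
move=> /cvgrPdist_le /(_ _ e0) + /cvgrPdist_le /(_ _ e0); rewrite !near_withinE.
move=> [d1 /= d10 H1] [d2 /= d20 H2].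
pose d := Num.min (Num.min d1 d2) (1 - x).
have d0 : 0 < d by rewrite /d !lt_min d10 d20 subr_gt0.
have [N [mN N0 sN]] := fg.
have sub : `]x, x + d[%classic `<=` N.
  move=> y /=; rewrite in_itv/= => /andP[xy yd]; apply: sN => /= /(_ I) fgy.
  have : d <= d1 by rewrite /d !ge_min lexx.
  have : d <= d2 by rewrite /d !ge_min lexx orbT.
  have : d <= 1 - x by rewrite /d !ge_min lexx orbT.
  move=> dx dd2 dd1.
  have y01 : 0 <= y < 1 by apply/andP; split; lra.
  have xyd : `|x - y| < d by rewrite ltr0_norm; lra.
  have := H1 y (lt_le_trans xyd dd1); rewrite /= in_itv/= => /(_ y01) g1.
  have := H2 y (lt_le_trans xyd dd2); rewrite /= in_itv/= => /(_ y01) f1.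
  have : `|f x - g x| <= `|f x - f y| + `|g x - g y|.
    rewrite fgy; have -> : f x - g x = (f x - g y) - (g x - g y) by ring.
    exact: ler_normB.
  rewrite /e in f1 g1 e0; lra.
pose J : set (measurableTypeR R) := `]x, x + d[%classic.
have : (@leb01 R J <= @leb01 R N)%E.
  by apply: le_measure; rewrite ?inE//; exact: measurable_itv.
rewrite [X in (_ <= X)%E]N0 leb01E setIidl /J; last first.
  move=> y /=; rewrite !in_itv/= => /andP[xy yd].
  have : d <= 1 - x by rewrite /d !ge_min lexx orbT.
  by move=> dx; apply/andP; split; lra.
rewrite lebesgue_measure_itv/= lte_fin ltrDl d0 -EFinD lee_fin; lra.
Qed.

End continuity.

(** * The embedding *)

Section ae_equality.
Context {R : realType}.
Notation T := (measurableTypeR R).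
Implicit Types (nu : {measure set T -> \bar R}) (f g h : T -> R).

Lemma ae_eq_sub nu f g h : f = g %[ae nu] -> (h \- f) = (h \- g) %[ae nu].
Proof. by apply: filterS => x /(_ I) /= ->. Qed.

Lemma ae_eq_sym nu f g : f = g %[ae nu] -> g = f %[ae nu].
Proof. by apply: filterS => x /(_ I). Qed.

Lemma ae_eq_trans nu f g h : f = g %[ae nu] -> g = h %[ae nu] -> f = h %[ae nu].
Proof. by apply: filterS2 => x /(_ I) + /(_ I) => ->. Qed.

Lemma Lnorm_sub_eq0 nu f g : measurable_fun setT f -> measurable_fun setT g ->
  ('N[nu]_1[EFin \o (f \- g)%R] = 0)%E -> f = g %[ae nu].
Proof.
move=> mf mg fg; have mfg : measurable_fun setT (EFin \o (f \- g)%R).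
  by apply/measurable_EFinP; exact: measurable_funB.
have := Lnorm_eq0_eq0 mfg lte01 fg.
by apply: filterS => x /(_ I) /= [] /eqP; rewrite subr_eq0 => /eqP.
Qed.

End ae_equality.

Section embedding.
Context {R : realType}.
Notation T := (measurableTypeR R).
Variables (lambda : nat -> R) (s : nat -> nat) (C theta : R)
  (A : (nat -> R) -> nat -> R).
Hypothesis l0 : forall n, 0 < lambda n.
Hypothesis BN : block_norm lambda s C theta A.
Implicit Types (a b : nat -> R) (x : R) (p q : R -> R).

Let C0 : 0 < C := bn_C BN.
Let th0 : 0 < theta := bn_theta BN.

Lemma power_sum_extend a K N x : (forall i, (s K <= i)%N -> a i = 0) -> (s K <= N)%N ->
  power_sum lambda a 0 N x = power_sum lambda a 0 (s K) x.
Proof.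
move=> aK KN; rewrite /power_sum (@big_cat_nat _ _ _ (s K) 0 N)//=.
rewrite [X in _ + X]big_nat_cond [X in _ + X]big1 ?addr0// => i /andP[/andP[ki _] _].
by rewrite aK// mul0r.
Qed.

(** The coefficients are padded by zeros up to a block boundary, using n <= s n, so that every block
    is complete. *)
Lemma muntz_polynomialE p : muntz_polynomial lambda p ->
  exists a K, p = power_sum lambda a 0 (s K) /\ forall i, (s K <= i)%N -> a i = 0.
Proof.
move=> [n [c ->]]; pose a i := if insub i is Some j then c j else 0.
have an i : (n <= i)%N -> a i = 0 by move=> ni; rewrite /a insubF// ltnNge ni.
exists a, n; have nsn := block_start_ge BN n; split; last first.
  by move=> i /(leq_trans nsn); exact: an.
apply/funext => x; rewrite /power_sum (@big_cat_nat _ _ _ n 0 (s n))//=.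
rewrite [X in _ = _ + X]big_nat_cond [X in _ = _ + X]big1 ?addr0; last first.
  by move=> i /andP[/andP[ni _] _]; rewrite an// mul0r.
by rewrite big_mkord; apply: eq_bigr => i _; rewrite /a valK.
Qed.

Lemma power_sum_muntz a n : muntz_polynomial lambda (power_sum lambda a 0 n).
Proof. by exists n, (fun i => a i); apply/funext => x; rewrite /power_sum big_mkord. Qed.

Lemma muntz_polynomial_sub p q : muntz_polynomial lambda p -> muntz_polynomial lambda q ->
  muntz_polynomial lambda (p \- q).
Proof.
move=> /muntz_polynomialE[a [K [-> aK]]] /muntz_polynomialE[b [N [-> bN]]].
have -> : power_sum lambda a 0 (s K) \- power_sum lambda b 0 (s N) =
    power_sum lambda (fun i => a i - b i) 0 (maxn (s K) (s N)).
  apply/funext => x /=; rewrite -(power_sum_extend x aK (leq_maxl _ (s N))).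
  rewrite -(power_sum_extend x bN (leq_maxr (s K) _)) /power_sum -sumrB.
  by apply: eq_bigr => i _; ring.
exact: power_sum_muntz.
Qed.

Lemma measurable_muntz p : muntz_polynomial lambda p -> measurable_fun setT (p : T -> R).
Proof. by move=> /muntz_polynomialE[a [K [-> _]]]; exact: measurable_power_sum. Qed.

Lemma within_muntz p : muntz_polynomial lambda p -> {within `[0, 1[, continuous p}.
Proof. by move=> /muntz_polynomialE[a [K [-> _]]]; exact: within_power_sum. Qed.

Lemma muntz_fin_num p : muntz_polynomial lambda p ->
  ('N[@leb01 R]_1[EFin \o p] \is a fin_num)%E.
Proof. by move=> /muntz_polynomialE[a [K [-> _]]]; exact: (Lnorm_power_sum_fin l0). Qed.

Lemma muntz_pointwise p x (c : R) : muntz_polynomial lambda p -> 0 <= x < 1 ->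
  ('N[@leb01 R]_1[EFin \o p] <= c%:E)%E ->
  `|p x| <= C ^+ 2 / theta * c / (1 - x).
Proof.
move=> /muntz_polynomialE[a [K [-> _]]] x01; rewrite (poly_normE s l0) lee_fin => pc.
apply: (le_trans (poly_pointwise l0 BN a K x01)).
have x1 : 0 < 1 - x by rewrite subr_gt0; case/andP: x01.
have -> : C ^+ 2 / (theta * (1 - x)) * poly_norm lambda s a K =
  C ^+ 2 / theta * poly_norm lambda s a K / (1 - x) by field; rewrite !gt_eqF.
by rewrite ler_pM2r ?invr_gt0// ler_pM2l// divr_gt0// exprn_gt0.
Qed.

Variable mu : {finite_measure set T -> \bar R}.
Hypothesis mu01 : measure_on01 mu.
Variable d : nat -> R.
Hypothesis d0 : forall k, 0 <= d k.
Hypothesis dP : forall a k,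
  ('N[mu]_1[EFin \o power_sum lambda a (s k) (s k.+1)] <= (d k * A a k)%:E)%E.
Hypothesis d_small : forall e, 0 < e -> exists k0, forall k, (k0 <= k)%N -> d k <= e.

Lemma block_measure_bounded : exists2 D, 0 < D & forall k, d k <= D.
Proof.
have [k0 H] := d_small ltr01; exists (1 + \sum_(k < k0) d k).
  by rewrite ltr_pwDl// sumr_ge0.
move=> k; have [kk|kk] := leqP k0 k.
  by apply: (le_trans (H k kk)); rewrite lerDl sumr_ge0.
rewrite (bigD1 (Ordinal kk))//= addrCA lerDl addr_ge0// sumr_ge0//.
Qed.

(** Only the values of [d] from m on must be below D: with D bounding all of [d] this is the
    embedding, with D a small tail bound it is the finite rank approximation. *)
Lemma Lnorm_blocks_le a m n (D : R) : (m <= n)%N -> 0 <= D ->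
  (forall k, (m <= k)%N -> d k <= D) ->
  ('N[mu]_1[EFin \o power_sum lambda a (s m) (s n)] <= (D * \sum_(k < n) A a k)%:E)%E.
Proof.
move=> mn D0 dD.
have -> : power_sum lambda a (s m) (s n) =
    fun x => \sum_(m <= k < n) power_sum lambda a (s k) (s k.+1) x.
  by apply/funext => x; rewrite (power_sum_blocks BN).
have mb k : measurable_fun setT (power_sum lambda a (s k) (s k.+1) : T -> R).
  exact: measurable_power_sum.
apply: (le_trans (Lnorm_sum m n mb (dP a))); rewrite lee_fin.
apply: (@le_trans _ _ (\sum_(m <= k < n) D * A a k)).
  apply: ler_sum_nat => k /andP[mk _]; apply: ler_wpM2r; [exact: (bn_ge0 BN)|exact: dD].
rewrite -mulr_sumr ler_wpM2l// -(big_mkord xpredT (A a)) (@big_cat_nat _ _ _ m 0 n)//= lerDr.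
by apply: sumr_ge0 => k _; exact: (bn_ge0 BN).
Qed.

Lemma muntz_embedding : exists2 D, 0 < D & forall p, muntz_polynomial lambda p ->
  ('N[mu]_1[EFin \o p] <= D%:E * 'N[@leb01 R]_1[EFin \o p])%E.
Proof.
have [D D0 dD] := block_measure_bounded; exists (D * C); first by rewrite mulr_gt0.
move=> p /muntz_polynomialE[a [K [-> _]]].
have := Lnorm_blocks_le a (leq0n K) (ltW D0) (fun k _ => dD k).
rewrite (bn_s0 BN) => /le_trans; apply.
rewrite (poly_normE s l0) -EFinM lee_fin -mulrA ler_pM2l//.
exact: (block_sum_le l0 BN).
Qed.

(* Polynomials converging fast in L^1 converge locally uniformly on [0, 1) by the
   pointwise bound, and Fatou's lemma transfers the rate to both measures. *)
Lemma muntz_representative (F : L1 (@leb01 R)) : muntz_space lambda F ->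
  exists (f : R -> R) (p : nat -> R -> R) (c : R), [/\ 0 < c,
    measurable_fun setT (f : T -> R), {within `[0, 1[, continuous f},
    (F : R -> R) = f %[ae (@leb01 R)] &
    forall n, [/\ muntz_polynomial lambda (p n),
      ('N[@leb01 R]_1[EFin \o ((F : R -> R) \- p n)%R] <= (2^-1 ^+ n)%:E)%E &
      ('N[mu]_1[EFin \o (f \- p n)%R] <= (c * 2^-1 ^+ n)%:E)%E]].
Proof.
move=> MF; have [D D0 emb] := muntz_embedding.
have mF := L1_measurable F.
have /choice[p pP] : forall n, exists p, muntz_polynomial lambda p /\
    ('N[@leb01 R]_1[EFin \o ((F : R -> R) \- p)%R] <= (2^-1 ^+ n)%:E)%E.
  move=> n; have := MF (ball F (2^-1 ^+ n)) (nbhsx_ballx F _ (halves_gt0 n)).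
  move=> [P [[p pp Pp] FP]]; exists p; split => //.
  have : L1dist F P < 2^-1 ^+ n by move: FP; rewrite ballEmdist.
  rewrite -lte_fin -L1dist_fin => /ltW; apply: le_trans; rewrite le_eqVlt; apply/orP; left.
  apply/eqP; apply: Lnorm_ae.
  - by apply: measurable_funB => //; exact: measurable_muntz.
  - by apply: measurable_funB => //; exact: L1_measurable.
  - exact: (ae_eq_sub F (ae_eq_sym Pp)).
have mp n : measurable_fun setT (p n : T -> R) by apply: measurable_muntz; case: (pP n).
have pp n j : (n <= j)%N -> ('N[@leb01 R]_1[EFin \o (p j \- p n)%R] <= (2 * 2^-1 ^+ n)%:E)%E.
  move=> nj; apply: (le_trans (Lnorm_triangle _ (mp j) mF (mp n))).
  have -> : 2 * 2^-1 ^+ n = 2^-1 ^+ n + 2^-1 ^+ n :> R by ring.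
  rewrite EFinD; apply: leeD; last by case: (pP n).
  rewrite Lnorm_subC; case: (pP j) => _ /le_trans; apply.
  by rewrite lee_fin; exact: halves_le.
pose c x := C ^+ 2 / theta * 2 / (1 - x).
have ptw x : 0 <= x < 1 -> cvgn (p ^~ x) /\ forall n, `|limn (p ^~ x) - p n x| <= c x * 2^-1 ^+ n.
  move=> x01; have x1 : 0 < 1 - x by rewrite subr_gt0; case/andP: x01.
  apply: cauchy_halves; first by rewrite !mulr_ge0 ?invr_ge0 ?exprn_ge0// ltW.
  move=> n j nj; have ppn := muntz_polynomial_sub (pP j).1 (pP n).1.
  apply: (le_trans (muntz_pointwise ppn x01 (pp n j nj))).
  by rewrite /c le_eqVlt; apply/orP; left; apply/eqP; ring.
pose f := pointwise_limit p.
have [mf fleb] := L1_limit leb01_setC01o mp (fun x x01 => (ptw x x01).1) pp.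
have [m0 m1] := mu01.
have ppmu n j : (n <= j)%N -> ('N[mu]_1[EFin \o (p j \- p n)%R] <= (D * (2 * 2^-1 ^+ n))%:E)%E.
  move=> nj; apply: (le_trans (emb _ (muntz_polynomial_sub (pP j).1 (pP n).1))).
  by rewrite EFinM lee_pmul2l ?lte_fin//; exact: pp.
have [_ fmu] := L1_limit (measure_setC01o m0 m1) mp (fun x x01 => (ptw x x01).1) ppmu.
exists f, p, (D * 2); split => //.
- by rewrite mulr_gt0.
- apply: (@within_limit _ p _ (C ^+ 2 / theta * 2)).
  + by rewrite !mulr_ge0 ?invr_ge0 ?exprn_ge0// ltW.
  + by move=> n; apply: within_muntz; case: (pP n).
  + by move=> n x x01; rewrite /f /pointwise_limit x01; exact: (ptw x x01).2.
- have FfO : ('N[@leb01 R]_1[EFin \o ((F : R -> R) \- f)%R] = 0)%E.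
    apply/eqP; rewrite eq_le Lnorm_ge0 andbT; apply/lee_addgt0Pr => e e0; rewrite add0e.
    have [n ne] := cvg_halves 3 e0.
    apply: (le_trans (Lnorm_triangle _ mF (mp n) mf)).
    apply: (@le_trans _ _ ((2^-1 ^+ n)%:E + (2 * 2^-1 ^+ n)%:E)%E).
      by apply: leeD; [case: (pP n)|rewrite Lnorm_subC; exact: fleb].
    rewrite -EFinD lee_fin; lra.
  exact: Lnorm_sub_eq0 FfO.
- move=> n; case: (pP n) => pn Fn; split => //.
  by have := fmu n; rewrite mulrA.
Qed.

End embedding.

(** * Compactness *)

Section L1_classes.
Context {R : realType}.
Notation T := (measurableTypeR R).
Implicit Types (nu : {measure set T -> \bar R}) (f g : T -> R).

Lemma L1_class_of nu f : measurable_fun setT f -> ('N[nu]_1[EFin \o f] < +oo)%E ->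
  exists G : L1 nu, (G : T -> R) = f %[ae nu].
Proof.
move=> mf ff; apply: L1_class; rewrite inE; apply/andP; split; rewrite inE//=.
Qed.

Lemma L1dist_ae nu (F G : L1 nu) f g : measurable_fun setT f -> measurable_fun setT g ->
  (F : T -> R) = f %[ae nu] -> (G : T -> R) = g %[ae nu] ->
  ((L1dist F G)%:E = 'N[nu]_1[EFin \o (f \- g)%R])%E.
Proof.
move=> mf mg Ff Gg; rewrite -L1dist_fin; apply: Lnorm_ae.
- by apply: measurable_funB; exact: L1_measurable.
- exact: measurable_funB.
- by move: Ff Gg; apply: filterS2 => x /(_ I) + /(_ I) /= => -> ->.
Qed.

Lemma Lnorm_le_sub nu f g : measurable_fun setT f -> measurable_fun setT g ->
  ('N[nu]_1[EFin \o f] <= 'N[nu]_1[EFin \o (f \- g)%R] + 'N[nu]_1[EFin \o g])%E.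
Proof.
move=> mf mg; have {1}-> : f = (f \- g) \+ g by apply/funext => x /=; rewrite subrK.
by apply: Lnorm_add => //; exact: measurable_funB.
Qed.

Lemma ae_eq_on nu (D : set T) f g : measurable D -> nu (~` D) = 0%E ->
  (forall x, D x -> f x = g x) -> f = g %[ae nu].
Proof.
move=> mD D0 fg; exists (~` D); split => //; first exact: measurableC.
by move=> x /= nfg Dx; apply: nfg => _; exact: fg.
Qed.

End L1_classes.

Section compactness.
Import ArrowAsProduct.
Context {R : realType}.
Notation T := (measurableTypeR R).
Variables (lambda : nat -> R) (s : nat -> nat) (C theta : R)
  (A : (nat -> R) -> nat -> R).
Hypothesis l0 : forall n, 0 < lambda n.
Hypothesis BN : block_norm lambda s C theta A.
Implicit Types (a b : nat -> R) (x e : R).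

(** An l^1-type ball for the block norms, with infinitely many nonzero coefficients allowed;
    otherwise the set would not be closed in the product topology. *)
Definition coefficients (B : R) : set (nat -> R) :=
  [set a | forall m, \sum_(k < m) A a k <= B].

Lemma nbhs_coordinates a (N : nat) e : 0 < e ->
  nbhs a [set b : nat -> R | forall i, (i < N)%N -> `|a i - b i| <= e].
Proof.
move=> e0; elim: N => [|N IH].
  by apply: filterS filterT => b _ i; rewrite ltn0.
have : nbhs a [set b : nat -> R | `|a N - b N| <= e].
  have := @proj_continuous nat (fun=> R) N a.
  move=> /cvgrPdist_le /(_ e e0); exact.
move=> H; apply: filterS2 IH H => b Hb HN i.
by rewrite ltnS leq_eqVlt => /predU1P[->//|]; exact: Hb.
Qed.

(** Each of the conditions involves finitely many coordinates, and depends on them continuously by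
    [bn_lip]. *)
Lemma closed_coefficients (B : R) : closed (coefficients B).
Proof.
move=> a aB m; apply/ler_addgt0Pr => e e0.
pose S := \sum_(k < m) (s k.+1 - s k)%:R / lambda (s k).
have S0 : 0 <= S by rewrite sumr_ge0// => k _; rewrite divr_ge0// ltW.
pose eta := e / (S + 1); have eta0 : 0 < eta by rewrite divr_gt0//; lra.
have [b [bB ab]] := aB _ (nbhs_coordinates a (s m) eta0).
apply: (@le_trans _ _ (\sum_(k < m) (A b k + eta * ((s k.+1 - s k)%:R / lambda (s k))))).
  apply: ler_sum => k _; apply: (le_trans (bn_lip BN a b k)); rewrite lerD2l mulrA.
  rewrite ler_wpM2r ?invr_ge0 ?(ltW (l0 _))//.
  apply: (@le_trans _ _ (\sum_(s k <= i < s k.+1) eta)).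
    apply: ler_sum_nat => i /andP[_ ik]; apply: ab; apply: (leq_trans ik).
    by apply: (block_start_mono BN); exact: ltn_ord.
  by rewrite big_const_nat iter_addr_0 mulr_natr.
rewrite big_split /= -mulr_sumr -/S; apply: lerD; first exact: bB.
rewrite /eta mulrAC ler_pdivrMr; last lra.
by rewrite ler_pM2l//; lra.
Qed.

(** By [bn_coef] every coordinate stays in a fixed segment, so this is a closed subset of a product
    of segments. The segments may grow with the coordinate in any way. *)
Lemma compact_coefficients (B : R) : compact (coefficients B).
Proof.
have /choice[c cP] : forall i, exists c : R, forall a, `|a i| <= c * `|B| \/ ~ coefficients B a.
  move=> i; have [k ik] : exists k, (s k <= i < s k.+1)%N.
    have exk : exists k, (i < s k.+1)%N by exists i; exact: block_start_ge BN i.+1.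
    case: (ex_minnP exk) => k ik kmin; exists k; rewrite ik andbT.
    case: k ik kmin => [|k] ik kmin; first by rewrite (bn_s0 BN).
    by rewrite leqNgt; apply/negP => /kmin; rewrite ltnn.
  have [c c0 H] := bn_coef BN ik; exists c => a.
  have [aB|aB] := pselect (coefficients B a); [left|by right].
  apply: (le_trans (H a)); rewrite ler_pM2l//; apply: le_trans (ler_norm B).
  apply: le_trans (aB k.+1); rewrite big_ord_recr /= lerDr sumr_ge0// => j _.
  exact: (bn_ge0 BN).
apply: (@subclosed_compact _ (coefficients B)
    [set a : nat -> R | forall i, `[- (c i * `|B|), c i * `|B|]%classic (a i)]).
- exact: closed_coefficients.
- have := @tychonoff nat (fun=> R) (fun i => `[- (c i * `|B|), c i * `|B|]%classic).
  by apply => i; exact: segment_compact.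
- move=> a aB i; rewrite /= in_itv/= -ler_norml.
  by case: (cP i a) => // /(_ aB).
Qed.

Variable mu : {finite_measure set T -> \bar R}.
Hypothesis mu01 : measure_on01 mu.
Variable d : nat -> R.
Hypothesis d0 : forall k, 0 <= d k.
Hypothesis dP : forall a k,
  ('N[mu]_1[EFin \o power_sum lambda a (s k) (s k.+1)] <= (d k * A a k)%:E)%E.
Hypothesis d_small : forall e, 0 < e -> exists k0, forall k, (k0 <= k)%N -> d k <= e.

Definition tail_bound n : R := sup [set d k | k in [set k | (n <= k)%N]].

Lemma tail_bound_ge n k : (n <= k)%N -> d k <= tail_bound n.
Proof.
move=> nk; apply: sup_upper_bound; last by exists k.
have [D D0 dD] := block_measure_bounded d0 d_small.
split; first by exists (d n), n => /=.
by exists D => _ [j _ <-]; exact: dD.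
Qed.

Lemma tail_bound_ge0 n : 0 <= tail_bound n.
Proof. exact: le_trans (d0 n) (tail_bound_ge (leqnn n)). Qed.

Lemma tail_bound_small e : 0 < e -> exists n, tail_bound n <= e.
Proof.
move=> e0; have [n H] := d_small e0; exists n.
apply: ge_sup; first by exists (d n), n => /=.
by move=> _ [k nk <-]; exact: H.
Qed.

Definition partial a n : R -> R := power_sum lambda a 0 (s n).

(** Truncations are made at block boundaries only, where the block norms control them. *)
Definition series_sum a : R -> R := pointwise_limit (partial a).

Lemma partial_sub a n j : (n <= j)%N ->
  partial a j \- partial a n = power_sum lambda a (s n) (s j).
Proof.
move=> nj; apply/funext => x; rewrite /partial /power_sum /=.
by rewrite (@big_cat_nat _ _ _ (s n) 0 (s j))//= ?(block_start_mono BN)// addrAC subrr add0r.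
Qed.

Lemma coefficients_cvg B a x : coefficients B a -> 0 <= x < 1 -> cvgn (partial a ^~ x).
Proof.
move=> aB x01; pose S n := \sum_(k < n) A a k.
have Smono : nondecreasing_seq S by move=> m n mn; exact: (block_sum_mono BN).
have cS : cvgn S.
  by apply: nondecreasing_is_cvgn => //; exists B => _ [n _ <-]; exact: aB.
have Sl n : S n <= limn S by exact: nondecreasing_cvgn_le.
have x1 : 0 < 1 - x by rewrite subr_gt0; case/andP: x01.
pose c := C / (theta * (1 - x)).
have c0 : 0 < c by rewrite divr_gt0 ?(bn_C BN)// mulr_gt0// (bn_theta BN).
apply/cauchy_cvgP/cauchy_exP => e /= e0.
have : \forall n \near \oo, `|limn S - S n| <= e / (2 * c).
  by move/cvgrPdist_le: cS; apply; rewrite divr_gt0// mulr_gt0.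
move=> [n _ Hn]; exists (partial a n x); exists n => // j /= nj.
change (`|partial a n x - partial a j x| < e).
have -> : partial a n x - partial a j x = - (partial a j \- partial a n) x.
  by rewrite /= opprB.
rewrite normrN partial_sub//.
apply: (le_lt_trans (power_sum_pointwise l0 BN a nj x01)); rewrite -/c.
have : \sum_(n <= k < j) A a k <= e / (2 * c).
  apply: le_trans (Hn n (leqnn n)); apply: le_trans (ler_norm _).
  rewrite lerBrDr addrC; apply: le_trans (Sl j).
  by rewrite /S -!(big_mkord xpredT (A a)) [leRHS](@big_cat_nat _ _ _ n 0 j).
rewrite -(ler_pM2l c0) => /le_lt_trans; apply.
have -> : c * (e / (2 * c)) = e / 2 by field; rewrite gt_eqF.
lra.
Qed.

Lemma measurable_partial a n : measurable_fun setT (partial a n : T -> R).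
Proof. exact: measurable_power_sum. Qed.

Lemma series_sum_bound B a : 0 <= B -> coefficients B a ->
  measurable_fun setT (series_sum a : T -> R) /\
  forall n, ('N[mu]_1[EFin \o (series_sum a \- partial a n)%R] <= (tail_bound n * B)%:E)%E.
Proof.
move=> B0 aB; have [m0 m1] := mu01.
apply: L1_limit => //; first exact: measure_setC01o.
- exact: measurable_partial.
- by move=> x; exact: coefficients_cvg aB.
- move=> n j nj; rewrite partial_sub//.
  apply: (le_trans (Lnorm_blocks_le BN dP a nj (tail_bound_ge0 n) _)).
    by move=> k; exact: tail_bound_ge.
  by rewrite lee_fin ler_wpM2l ?tail_bound_ge0.
Qed.

Lemma series_sum_class B : 0 <= B -> exists Phi : (nat -> R) -> L1 mu,
  forall a, coefficients B a -> (Phi a : T -> R) = series_sum a %[ae mu].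
Proof.
move=> B0; suff /choice[Phi PhiP] : forall a, exists G : L1 mu,
    coefficients B a -> (G : T -> R) = series_sum a %[ae mu] by exists Phi.
move=> a.
have [aB|aB] := pselect (coefficients B a); last first.
  have [|G _] := @L1_class_of R mu (fun=> 0) (measurable_cst _).
    by rewrite (@eq_Lnorm _ _ _ _ _ _ (cst 0%E)) ?Lnorm0.
  by exists G.
have [ms sb] := series_sum_bound B0 aB.
have [|G Ga] := @L1_class_of R mu (series_sum a) ms; last by exists G.
have := sb 0%N; have -> : series_sum a \- partial a 0 = series_sum a.
  by apply/funext => x; rewrite /partial /power_sum /= (bn_s0 BN) big_geq// subr0.
by move=> /le_lt_trans; apply; exact: ltry.
Qed.

(** The remainder after n blocks is uniformly small on the whole ball, since [tail_bound] tends to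
    0, and the first n blocks depend continuously on finitely many coordinates. *)
Lemma series_sum_continuous B (Phi : (nat -> R) -> L1 mu) : 0 <= B ->
  (forall a, coefficients B a -> (Phi a : T -> R) = series_sum a %[ae mu]) ->
  {within coefficients B, continuous Phi}.
Proof.
move=> B0 PhiP; have [m0 m1] := mu01.
apply/subspace_continuousP => a aB; rewrite /from_subspace; apply/cvg_ballP => e e0.
pose e' := e / 4 / (B + 1); have e'0 : 0 < e' by rewrite !divr_gt0//; lra.
have [n ne] := tail_bound_small e'0.
have nB : tail_bound n * B <= e / 4.
  apply: (@le_trans _ _ (e' * B)); first by rewrite ler_wpM2r.
  rewrite /e' mulrAC ler_pdivrMr; last lra.
  by rewrite ler_pM2l ?divr_gt0//; lra.
pose m := fine (mu `[0%R, 1%R]%classic); have m_0 : 0 <= m by rewrite fine_ge0.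
have mE : (mu `[0%R, 1%R]%classic = m%:E)%E by rewrite /m fineK// fin_num_measure.
pose S : R := (s n)%:R * m + 1; have S0 : 0 < S by rewrite ltr_wpDl ?mulr_ge0.
pose eta := e / 4 / S; have eta0 : 0 < eta by rewrite !divr_gt0.
rewrite near_withinE; apply: filterS (nbhs_coordinates a (s n) eta0) => b ab bB.
rewrite ballEmdist /=.
change (L1dist (Phi a) (Phi b) < e).
have [msa sa] := series_sum_bound B0 aB; have [msb sb] := series_sum_bound B0 bB.
rewrite -lte_fin (L1dist_ae msa msb (PhiP a aB) (PhiP b bB)).
have mpa := measurable_partial a n; have mpb := measurable_partial b n.
have pab : ('N[mu]_1[EFin \o (partial a n \- partial b n)%R] <= (e / 4)%:E)%E.
  have -> : partial a n \- partial b n = power_sum lambda (fun i => a i - b i) 0 (s n).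
    by apply/funext => x; rewrite /partial /power_sum /= -sumrB; apply: eq_bigr => i _; ring.
  apply: (le_trans (Lnorm_power_sum_le l0 _ _ _ m0)); rewrite [X in (_ * X)%E]mE -EFinM lee_fin.
  apply: (@le_trans _ _ ((\sum_(0 <= i < s n) eta) * m)).
    by rewrite ler_wpM2r//; apply: ler_sum_nat => i /andP[_ ?]; exact: ab.
  have -> : (\sum_(0 <= i < s n) eta) * m = e / 4 * ((s n)%:R * m) / S.
    by rewrite big_const_nat iter_addr_0 subn0 -[eta *+ _]mulr_natl /eta; ring.
  by rewrite ler_pdivrMr// ler_pM2l ?divr_gt0// lerDl.
apply: (@le_lt_trans _ _ ((e / 4)%:E + ((e / 4)%:E + (e / 4)%:E))%E); last first.
  by rewrite -!EFinD lte_fin; lra.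
apply: (le_trans (Lnorm_triangle _ msa mpa msb)); apply: leeD.
  by apply: (le_trans (sa n)); rewrite lee_fin.
apply: (le_trans (Lnorm_triangle _ mpa mpb msb)); apply: leeD => //.
by rewrite Lnorm_subC; apply: (le_trans (sb n)); rewrite lee_fin.
Qed.

Lemma series_sum_polynomial a K x : (forall i, (s K <= i)%N -> a i = 0) -> 0 <= x < 1 ->
  series_sum a x = partial a K x.
Proof.
move=> aK x01; rewrite /series_sum /pointwise_limit x01; apply/cvg_lim => //.
apply: cvg_near_cst; exists K => // j /= Kj.
by rewrite /partial (power_sum_extend lambda x aK)// (block_start_mono BN).
Qed.

(** If F has norm at most 1, its approximating polynomials have norm at most 1 + 2^(- n) <= 2, so
    their coefficients lie in the ball of radius B = 2 C. Their classes converge to G in L^1(mu),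
    and G belongs to the image of the ball because this image is compact, hence closed. *)
Theorem precompact_image : precompact [set G : L1 mu | exists2 F : L1 (@leb01 R),
  ('N[@leb01 R]_1[EFin \o F] <= 1)%E & iota_graph lambda F G].
Proof.
have [m0 m1] := mu01; have muo := measure_setC01o m0 m1.
pose B := C * 2; have B0 : 0 <= B by rewrite mulr_ge0// ltW// (bn_C BN).
have [Phi PhiP] := series_sum_class B0.
have cK : compact (Phi @` coefficients B).
  apply: continuous_compact; last exact: compact_coefficients.
  exact: series_sum_continuous.
have clK : closed (Phi @` coefficients B) by apply: compact_closed => //; exact: metric_hausdorff.
apply: (@precompact_subset _ _ (Phi @` coefficients B)); last first.
  by apply: compact_precompact => //; exact: metric_hausdorff.
move=> G [F F1 [MF [g [cg Fg Gg]]]]; apply: clK.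
have [f [p [c [c0 mf cf Ff pP]]]] := muntz_representative l0 BN mu01 d0 dP d_small MF.
(* The representatives g and f agree Lebesgue-a.e. only; continuity makes them equal at every point
   of [0, 1), hence [mu]-a.e. *)
have fg x : 0 <= x < 1 -> g x = f x.
  exact: (within_eq_ae cg cf (ae_eq_trans (ae_eq_sym Fg) Ff)).
have Gf : (G : T -> R) = f %[ae mu].
  apply: (ae_eq_trans Gg); apply: (ae_eq_on (measurable_itv _) muo) => x /=.
  by rewrite in_itv; exact: fg.
move=> U; rewrite -nbhs_ballE => -[e /= e0 eU].
have [n ne] := cvg_halves c (divr_gt0 e0 (ltr0Sn R 1)).
have [pn Fpn fpn] := pP n.
have [a [K [pE aK]]] := muntz_polynomialE BN pn.
have mp := measurable_muntz BN pn.
have mF := L1_measurable F.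
have p2 : poly_norm lambda s a K <= 2.
  rewrite -lee_fin -(poly_normE s l0) -pE.
  apply: (le_trans (Lnorm_le_sub (@leb01 R) mp mF)).
  have -> : 2 = 1 + 1 :> R by [].
  rewrite EFinD; apply: leeD => //; rewrite Lnorm_subC.
  by apply: (le_trans Fpn); rewrite lee_fin exprn_ile1// invf_le1// ler1n.
have aB : coefficients B a.
  move=> m; apply: (@le_trans _ _ (\sum_(k < maxn m K) A a k)).
    by apply: (block_sum_mono BN); exact: leq_maxl.
  apply: (le_trans (block_sum_le l0 BN a (maxn m K))).
  rewrite /B ler_pM2l ?(bn_C BN)//; apply: le_trans p2.
  rewrite /poly_norm; have -> // : power_sum lambda a 0 (s (maxn m K)) = power_sum lambda a 0 (s K).
  apply/funext => x; apply: power_sum_extend => //.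
  by apply: (block_start_mono BN); exact: leq_maxr.
exists (Phi a); split; first by exists a.
apply: eU; rewrite ballEmdist /=; change (L1dist G (Phi a) < e).
have Phip : (Phi a : T -> R) = p n %[ae mu].
  apply: (ae_eq_trans (PhiP a aB)); apply: (ae_eq_on (measurable_itv _) muo) => x /=.
  by rewrite in_itv/= => x01; rewrite (series_sum_polynomial aK x01) pE.
rewrite -lte_fin (L1dist_ae mf mp Gf Phip); apply: (le_lt_trans fpn).
by rewrite lte_fin; apply: (le_lt_trans ne); lra.
Qed.

End compactness.

Unset Implicit Arguments.

Theorem corollary5p7 (R : realType) (lambda : nat -> R)
  (lambda_incr : increasing_seq lambda)
  (lambda_gt0 : forall n, 0 < lambda n)
  (lambda_sum : (\sum_(0 <= n <oo) ((lambda n)^-1)%:E < +oo)%E)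
  (lambda_ql : quasilacunary lambda)
  (mu : {finite_measure set (measurableTypeR R) -> \bar R})
  (mu01 : measure_on01 mu)
  (mu_vs : vanishing_sublinear mu) :
  compact_iota lambda mu.
Proof.
have [s [C [theta [A BN]]]] := exists_block_norm lambda_incr lambda_gt0 lambda_ql.
have [d [d0 dP d_small]] := block_measure_bound lambda_gt0 BN mu01 mu_vs.
have [D D0 emb] := muntz_embedding lambda_gt0 BN d0 dP d_small.
split; first by exists D.
- move=> F MF.
  have [f [p [c [c0 mf cf Ff pP]]]] :=
    muntz_representative lambda_gt0 BN mu01 d0 dP d_small MF.
  (* The norm of f in L^1(mu) is finite because f is at finite distance from the polynomial p 0, to
     which the embedding inequality applies. *)
  have [p0 _ fp0] := pP 0%N; have mp := measurable_muntz BN p0.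
  have [|G Gf] := @L1_class_of R mu f mf; last by exists G; split => //; exists f.
  apply: (le_lt_trans (Lnorm_le_sub mu mf mp)); apply: lte_add_pinfty.
    by apply: (le_lt_trans fp0); exact: ltry.
  apply: (le_lt_trans (emb _ p0)).
  by rewrite -(fineK (muntz_fin_num lambda_gt0 BN p0)) -EFinM ltry.
- exact (precompact_image lambda_gt0 BN mu01 d0 dP d_small).
Qed.
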